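(* Let $n\ge2$ and let $\omega$ be a Poincaré like metric on $M^0=M\setminus\{p_1,\dots,p_k\}$. There is a constant $\lambda_1>0$ (depending only on $(M^0,\omega)$) such that for any $f\in H^1_\omega(M^0)$ with $\int_{M^0}f\,dV_\omega=0$, $$\int_{M^0}f^2\,dV_\omega\le\lambda_1^{-1}\int_{M^0}|\nabla_\omega f|^2\,dV_\omega .$$
   Context: Setting: $M$ is a compact connected smooth manifold (without boundary) of dimension $n$, $p_1,\dots,p_k\in M$ are finitely many distinct points, and $M^0=M\setminus\{p_1,\dots,p_k\}$. For each $i$ choose a neighborhood $U_i$ of $p_i$ with $U_i\cap U_j=\emptyset$ for $i\ne j$ and a diffeomorphism $\varphi_i:U_i\to B_1(0)\subset\mathbb{R}^n$ with $\varphi_i(p_i)=0$, where $B_1(0)$ is the unit ball. Poincaré like model metric: on $U_i\setminus\{p_i\}$, in the coordinates $x=\varphi_i(\cdot)\in B_1(0)\setminus\{0\}$, put $ds^2=\frac{ds_0^2}{|x|^2(1-\log|x|)^2}$, where $ds_0^2$ is the Euclidean metric; extend this to a Riemannian metric on $M^0$. A Poincaré like metric $\omega$ is a complete Riemannian metric on $M^0$ quasi-isometric to such a metric, i.e. $c^{-1}ds^2\le\omega\le c\,ds^2$ for some constant $c\ge1$. Notation: $dV_\omega$ is the volume element of $\omega$, $\nabla_\omega$ is the gradient of $\omega$, $\|u\|_{L^p_\omega}=(\int_{M^0}|u|^p\,dV_\omega)^{1/p}$, and $H^1_\omega(M^0)$ is the completion of $C^\infty(M)$ in the norm $\|\nabla_\omega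 u\|_{L^2_\omega}+\|u\|_{L^2_\omega}$. *)

(* Defs.v *)
From HB Require Import structures.
From mathcomp Require Import all_boot all_order all_algebra.
From mathcomp Require Import all_classical all_reals all_analysis.
Import Order.TTheory GRing.Theory Num.Theory.
Import numFieldNormedType.Exports.

Set Implicit Arguments.
Unset Strict Implicit.
Unset Printing Implicit Defensive.

Local Open Scope classical_set_scope.
Local Open Scope ring_scope.

Section euclidean.
Context {R : realType}.

(* The norm that the library puts on ['rV[R]_n] is the sup norm. *)
Definition enorm n (x : 'rV[R]_n) : R := Num.sqrt (\sum_i x 0 i ^+ 2).

Fixpoint Ck n (k : nat) (U : set 'rV[R]_n) (f : 'rV[R]_n -> R) : Prop :=
  (forall x, U x -> {for x, continuous f}) /\
  if k is k'.+1 then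
    forall i : 'I_n,
      (forall x, U x -> derivable f x (delta_mx 0 i)) /\
      Ck k' U (fun x => 'D_(delta_mx 0 i) f x)
  else True.

Definition smooth n (U : set 'rV[R]_n) (f : 'rV[R]_n -> R) :=
  forall k, Ck k U f.

Definition smooth_map n m (U : set 'rV[R]_n) (F : 'rV[R]_n -> 'rV[R]_m) :=
  forall j, smooth U (fun x => F x 0 j).

(* Lebesgue integral of a nonnegative Borel function on R^n, as the iterated
   integral of Tonelli's theorem: the library has no Lebesgue measure on R^n
   for general n. *)
Fixpoint lebesgue_int n : ('rV[R]_n -> \bar R) -> \bar R :=
  match n with
  | 0 => fun h => h 0
  | m.+1 => fun h =>
      (\int[lebesgue_measure]_t
         lebesgue_int (fun y : 'rV[R]_m =>
           h (row_mx (t%:M : 'rV[R]_1) y : 'rV[R]_(1 + m))))%E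
  end.

End euclidean.

Section manifold.
Context {R : realType} {n : nat}.

(* [chart_map] and [chart_inv] are total; only their values on [chart_dom]
   and on [chart_img] are relevant. *)
Record chart (M : ptopologicalType) := Chart {
  chart_dom : set M ;
  chart_map : M -> 'rV[R]_n ;
  chart_inv : 'rV[R]_n -> M ;
  chart_dom_open : open chart_dom ;
  chart_img_open : open (chart_map @` chart_dom) ;
  chart_mapK : forall p, chart_dom p -> chart_inv (chart_map p) = p ;
  chart_map_cont : forall p, chart_dom p -> {for p, continuous chart_map} ;
  chart_inv_cont : forall x, (chart_map @` chart_dom) x ->
    {for x, continuous chart_inv}
}.

Definition chart_img (M : ptopologicalType) (a : chart M) : set 'rV[R]_n :=
  chart_map a @` chart_dom a.

Definition smooth_transition (M : ptopologicalType) (a b : chart M) :=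
  smooth_map (chart_map a @` (chart_dom a `&` chart_dom b))
    (chart_map b \o chart_inv a).

(* The atlas is maximal, so that its members are exactly the diffeomorphisms
   from open subsets of [M] onto open subsets of R^n. *)
Record smooth_manifold (M : ptopologicalType) := SmoothManifold {
  manifold_hausdorff : hausdorff_space M ;
  manifold_second_countable : @second_countable M ;
  atlas : set (chart M) ;
  atlas_cover : forall p, exists a, atlas a /\ chart_dom a p ;
  atlas_smooth : forall a b, atlas a -> atlas b -> smooth_transition a b ;
  atlas_maximal : forall a,
    (forall b, atlas b -> smooth_transition a b /\ smooth_transition b a) ->
    atlas a
}.

End manifold.
Arguments chart R n M : clear implicits.
Arguments smooth_manifold R n M : clear implicits.

Section riemannian.
Context {R : realType} {n : nat} {M : ptopologicalType}.
Variable S : smooth_manifold R n M.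
Implicit Types (O : set M) (a b : chart R n M) (p q : M).
Implicit Types (u f : M -> R) (X : M -> 'rV[R]_n) (g : M -> 'M[R]_n).

(* The tangent space at [p] is ['rV[R]_n]: a tangent vector at [p] is given by
   its row of components in the chart [chart_at p]. *)
Definition chart_at p : chart R n M := sval (cid (atlas_cover S p)).

(* Right multiplication by this matrix turns the components in [a] of a tangent
   vector at [p] into its components in [b]. *)
Definition change_frame a b p : 'M[R]_n :=
  jacobian (chart_map b \o chart_inv a) (chart_map a p).

Definition components a X p : 'rV[R]_n := X p *m change_frame (chart_at p) a p.

(* A Riemannian metric is a field of Gram matrices [g p] on the tangent spaces,
   and [gram g a p] is the matrix of its coefficients in the chart [a]. *)
Definition gram g a p : 'M[R]_n :=
  change_frame a (chart_at p) p *m g p *m (change_frame a (chart_at p) p)^T.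

Definition tangent_norm2 g p (v : 'rV[R]_n) : R := (v *m g p *m v^T) 0 0.
Definition tangent_norm g p (v : 'rV[R]_n) : R :=
  Num.sqrt (tangent_norm2 g p v).

Definition riemannian_metric O g :=
  (forall p, O p ->
     (g p)^T = g p /\ forall v, v != 0 -> 0 < tangent_norm2 g p v) /\
  (forall a, atlas S a -> forall i j,
     smooth (chart_map a @` (chart_dom a `&` O))
       (fun x => gram g a (chart_inv a x) i j)).

(* The C^1 condition is imposed on a neighborhood of [0, 1], where it makes
   sense with two-sided derivatives; corners are allowed in [joined] below. *)
Definition C1_curve O (c : R -> M) :=
  forall t, 0 <= t <= 1 ->
    [/\ O (c t), {for t, continuous c} &
      forall a, atlas S a -> chart_dom a (c t) ->
        (\forall s \near t, derivable (chart_map a \o c) s 1) /\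
        {for t, continuous (fun s => derive1 (chart_map a \o c) s)}].

Definition velocity (c : R -> M) (t : R) : 'rV[R]_n :=
  derive1 (chart_map (chart_at (c t)) \o c) t.

Definition curve_length g (c : R -> M) : \bar R :=
  (\int[lebesgue_measure]_(t in `[0%R, 1%R])
     (tangent_norm g (c t) (velocity c t))%:E)%E.

(* [joined O g p q L]: some piecewise C^1 curve in [O] from [p] to [q] has
   [g]-length [L]. *)
Inductive joined O g : M -> M -> \bar R -> Prop :=
| joined_refl p : O p -> joined O g p p 0%E
| joined_step (c : R -> M) q L :
    C1_curve O c -> joined O g (c 1) q L ->
    joined O g (c 0) q (curve_length g c + L)%E.

Definition riemannian_dist O g p q : \bar R :=
  ereal_inf [set L | joined O g p q L].

Definition complete_metric O g :=
  forall u : nat -> M, (forall j, O (u j)) ->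
    (forall e : R, 0 < e -> exists N, forall i j, (N <= i)%N -> (N <= j)%N ->
       (riemannian_dist O g (u i) (u j) < e%:E)%E) ->
    exists2 p, O p & riemannian_dist O g (u j) p @[j --> \oo] --> 0%E.

Definition smooth_fun u :=
  forall a, atlas S a -> smooth (chart_img a) (u \o chart_inv a).

Definition differential u p : 'rV[R]_n :=
  \row_i 'D_(delta_mx 0 i) (u \o chart_inv (chart_at p))
           (chart_map (chart_at p) p).

Definition gradient g u p : 'rV[R]_n := differential u p *m invmx (g p).

Definition borel : measurableType (@open M).-sigma :=
  g_sigma_algebraType (@open M).

(* [vol] is the volume element of [g] on [O]: dV = sqrt(det g) dx^1...dx^n in
   every chart. This determines [vol] on the Borel subsets of [O]. *)
Definition volume_element O g (vol : {measure set borel -> \bar R}) :=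
  forall a, atlas S a ->
  forall A : set borel, measurable A -> A `<=` chart_dom a `&` O ->
    vol A = lebesgue_int (fun x =>
      (\1_(chart_map a @` A) x * Num.sqrt (\det (gram g a (chart_inv a x))))%:E).

Section sobolev.
Variables (O : set M) (g : M -> 'M[R]_n) (vol : {measure set borel -> \bar R}).

Definition L2norm f : \bar R :=
  ((\int[vol]_(p in O) (`|f p| ^+ 2)%:E) `^ 2^-1)%E.

(* [H1norm u (gradient g u)] is the norm ||grad u||_{L^2} + ||u||_{L^2}. *)
Definition H1norm f X : \bar R :=
  (L2norm (fun p => tangent_norm g p (X p)) + L2norm f)%E.

Definition measurable_field X :=
  forall a i, atlas S a ->
    measurable_fun (chart_dom a `&` O : set borel)
      (fun p => components a X p 0 i).

(* The map u |-> (u, grad u) embeds the smooth functions on [M], with the H^1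
   norm, isometrically into the complete space of pairs of an L^2 function and
   an L^2 vector field on [O]. Their completion is thus the closure of the image:
   [H1 f X] says that (f, X) lies in it, that is, f is in H^1 and grad f = X. *)
Definition H1 f X :=
  [/\ measurable_fun (O : set borel) f, measurable_field X &
    exists u : nat -> M -> R, (forall j, smooth_fun (u j)) /\
      H1norm (fun p => f p - u j p) (fun p => X p - gradient g (u j) p)
        @[j --> \oo] --> 0%E].

End sobolev.

Section poincare_like.
Variables (k : nat) (pt : 'I_k -> M).

Definition punctured : set M := [set p | forall i, p != pt i].

Definition model_metric g :=
  riemannian_metric punctured g /\
  exists phi : 'I_k -> chart R n M,
    [/\ forall i, [/\ atlas S (phi i), chart_dom (phi i) (pt i),
                   chart_map (phi i) (pt i) = 0 &
                   chart_img (phi i) = [set x | enorm x < 1]],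
        forall i j, i != j -> chart_dom (phi i) `&` chart_dom (phi j) = set0 &
        forall i p, chart_dom (phi i) p -> p != pt i ->
          let r := enorm (chart_map (phi i) p) in
          gram g (phi i) p = ((r ^+ 2 * (1 - ln r) ^+ 2)^-1)%:M].

Definition quasi_isometric O g h :=
  exists2 c : R, 1 <= c & forall p, O p -> forall v : 'rV[R]_n,
    c^-1 * tangent_norm2 h p v <= tangent_norm2 g p v <= c * tangent_norm2 h p v.

Definition poincare_like_metric g :=
  [/\ riemannian_metric punctured g, complete_metric punctured g &
    exists2 ds, model_metric ds & quasi_isometric punctured g ds].

End poincare_like.
End riemannian.

(* Main.v *)
From HB Require Import structures.
Require Import Defs.
From mathcomp Require Import all_boot all_order all_algebra.
From mathcomp Require Import finmap all_classical all_reals all_analysis.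
From mathcomp Require Import perm measurable_realfun ring lra.
Import Order.TTheory GRing.Theory Num.Theory.
Import numFieldNormedType.Exports.

(** The inequality holds because the volume of a cusp is finite and a function
    can oscillate in a cusp only by spending energy. Call a Borel set V of finite
    volume a Poincare set if there is C such that, for every smooth u on M, the
    squared L^2(V) distance of u to some constant is at most C times the energy
    of u on the whole of M^0. The theorem follows once M^0 itself is a Poincare set, and
    this is obtained by gluing small pieces.

    Two Poincare sets whose intersection has positive volume have a Poincare
    union ([poincare_set_union]): both constants approximate u on the overlap, so
    they are close to each other. Small coordinate boxes are Poincare sets
    ([poincare_box]), since the metric is comparable there with the Euclidean
    one and a Euclidean box satisfies the inequality by induction on the
    dimension ([box_poincare]).

    The heart of the matter is a punctured box around a puncture. Put
    P = r (1 - ln r) with r the Euclidean radius. Quasi-isometry with the model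
    makes the volume density comparable with P^-n and the energy density with
    P^(2-n) |du|^2. The radial field x r^-n (1 - ln r)^(1-n) has divergence
    (n-1) P^-n and length P^(1-n), so the divergence theorem applied to
    (u - c)^2 times this field gives the Hardy inequality [hardy_box]: the
    weighted L^2 norm of u - c near the puncture is controlled by the energy and
    by the L^2 norm of u - c away from the puncture. As u is smooth across the
    puncture, replacing r^2 by r^2 + e and letting e tend to 0 avoids every
    boundary term there. The function 1 in this inequality shows that the cusp
    has finite volume. Away from the puncture the box is covered by the 2n slabs
    on which some coordinate stays away from 0; they form a connected chain
    because n >= 2, so they glue, and the punctured box is a Poincare set
    ([poincare_cusp]).

    Every point of M therefore has an open neighbourhood W such that W minus the
    punctures is a Poincare set. The set M is connected and M^0 is dense, so
    chains of such neighbourhoods join any two points, and finitely many of them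
    cover M by compactness ([poincare_global]). Lastly, for f of mean zero the
    constant 0 is the best one ([mean_zero_min]), and the inequality passes from
    smooth functions to their H^1 closure ([poincare_H1]). *)

Set Implicit Arguments.
Unset Strict Implicit.
Unset Printing Implicit Defensive.

Local Open Scope classical_set_scope.
Local Open Scope ring_scope.

(** * Borel sets and Lebesgue measure on R^n *)

Section borel_sets.
Context {T : ptopologicalType}.

Lemma open_borel (A : set T) : open A -> measurable (A : set (borel (M := T))).
Proof. exact: sub_sigma_algebra. Qed.

Lemma closed_borel (A : set T) :
  closed A -> measurable (A : set (borel (M := T))).
Proof. move=> cA; rewrite -(setCK A).
by apply: measurableC; apply: open_borel; exact: closed_openC. Qed.

Lemma continuous_on_open_preimage (T' : topologicalType) (f : T -> T')
    (D : set T) (B : set T') :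
  open D -> (forall x, D x -> {for x, continuous f}) -> open B ->
  open (D `&` f @^-1` B).
Proof.
move=> oD cf oB; rewrite openE => x [Dx fBx]; rewrite /interior.
apply: filterI; first exact: open_nbhs_nbhs.
by apply: (cf x Dx); exact: open_nbhs_nbhs.
Qed.

Lemma continuous_on_borel (T' : ptopologicalType) (f : T -> T') (D : set T) :
  open D -> (forall x, D x -> {for x, continuous f}) ->
  measurable_fun (D : set (borel (M := T))) (f : _ -> borel (M := T')).
Proof.
move=> oD cf; apply: (@measurability _ _ _ (borel (M := T')) _ _ (@open T')) => //.
move=> _ [B oB <-]; apply: open_borel.
exact: continuous_on_open_preimage.
Qed.

Lemma continuous_on_measurable (R : realType) (f : T -> R) (D : set T) :
  open D -> (forall x, D x -> {for x, continuous f}) ->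
  measurable_fun (D : set (borel (M := T))) f.
Proof.
move=> oD cf; apply: (@measurability _ _ (borel (M := T)) (measurableTypeR R) D f _
  (measurable_realfun.RGenOpens.measurableE R)).
move=> _ [_ [a [b ->] <-]]; apply: open_borel.
by apply: continuous_on_open_preimage => //; exact: interval_open.
Qed.

End borel_sets.

Section lebesgue_rV.
Context {R : realType}.
Local Notation rV n := (borel (M := 'rV[R]_n)).

Lemma measurable_coord n (i : 'I_n) :
  measurable_fun [set: rV n] (fun x : rV n => (x : 'rV[R]_n) 0 i).
Proof.
apply: continuous_on_measurable; first exact: openT.
by move=> x _; exact: coord_continuous.
Qed.

Lemma open_ratbox n (U : set 'rV[R]_n) (x : 'rV[R]_n) : open U -> U x ->
  exists a b : {ffun 'I_n -> rat},
    (forall i, ratr (a i) < x 0 i < ratr (b i)) /\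
    (forall y : 'rV[R]_n, (forall i, ratr (a i) < y 0 i < ratr (b i)) -> U y).
Proof.
move=> oU Ux.
have /nbhs_ballP[e /= e0 eU] : nbhs x U by exact: open_nbhs_nbhs.
have /choice[a aP] : forall i, exists q : rat, x 0 i - e < ratr q < x 0 i.
  move=> i.
  have xe : x 0 i - e < x 0 i by rewrite gtrBl.
  have [q qP] := rat_in_itvoo xe.
  by exists q; move: qP; rewrite in_itv.
have /choice[b bP] : forall i, exists q : rat, x 0 i < ratr q < x 0 i + e.
  move=> i.
  have xe : x 0 i < x 0 i + e by rewrite ltrDl.
  have [q qP] := rat_in_itvoo xe.
  by exists q; move: qP; rewrite in_itv.
exists [ffun i => a i], [ffun i => b i]; split=> [i|y yP].
  by rewrite !ffunE; have /andP[_ ->] := aP i; have /andP[-> _] := bP i.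
apply: eU; rewrite /ball /= /mx_ball; split=> // i j.
rewrite ord1 /ball /= ltr_distlC.
have := yP j; rewrite !ffunE => /andP[ay yb].
have /andP[xa _] := aP j; have /andP[_ bx] := bP j.
by rewrite (lt_trans xa ay) (lt_trans yb bx).
Qed.

(** The Borel sets of R^n are generated by countably many rational boxes, so a
    vector-valued map may be tested coordinate by coordinate. *)
Lemma measurable_rV d (T : measurableType d) n (D : set T) (F : T -> rV n) :
  (forall i, measurable_fun D (fun t => (F t : 'rV[R]_n) 0 i)) ->
  measurable_fun D F.
Proof.
move=> mF mD; move: (mD).
apply: (@measurability _ _ _ (rV n) _ _ (@open 'rV[R]_n)) => //.
move=> _ [U oU <-].
pose box (p : {ffun 'I_n -> rat} * {ffun 'I_n -> rat}) : set 'rV[R]_n :=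
  [set y | forall i, ratr (p.1 i) < y 0 i < ratr (p.2 i)].
have UE : U = \bigcup_(p in [set p | box p `<=` U]) box p.
  apply/seteqP; split=> [x Ux|x [p /= pU /pU//]].
  have [a [b [xab abU]]] := open_ratbox oU Ux.
  by exists (a, b) => //=.
rewrite UE preimage_bigcup setI_bigcupr.
rewrite bigcup_mkcond; apply: countable_bigcupT_measurable => // p.
case: ifP => // _.
rewrite (_ : _ `&` _ =
    D `&` \bigcap_(i in [set: 'I_n])
      (D `&` (fun t => (F t : 'rV[R]_n) 0 i) @^-1` `]ratr (p.1 i), ratr (p.2 i)[)).
  apply: measurableI => //; apply: fin_bigcap_measurable => // i _.
  exact: mF.
apply/seteqP; split=> t [Dt].
  move=> tp; split=> // i _; split => //=.
  by rewrite in_itv/=; exact: tp.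
move=> tp; split=> // i; have [_] := tp i I.
by rewrite /= in_itv.
Qed.

(** The splitting R^(m+1) = R x R^m that underlies [lebesgue_int];
    integrals and derivatives are reduced to lower dimension through it. *)
Definition rv_cons m (p : R * 'rV[R]_m) : 'rV[R]_m.+1 :=
  row_mx (p.1%:M : 'rV[R]_1) p.2 : 'rV[R]_(1 + m).

Arguments rv_cons {m}.

Definition rv_split m (x : 'rV[R]_m.+1) : R * 'rV[R]_m :=
  (x 0 0, rsubmx (x : 'rV[R]_(1 + m))).

Arguments rv_split {m}.

Lemma rv_cons0 m (p : R * 'rV[R]_m) : rv_cons p 0 0 = p.1.
Proof.
rewrite /rv_cons (_ : 0 = lshift m (0 : 'I_1)); last exact: val_inj.
by rewrite (row_mxEl (p.1%:M : 'rV[R]_1) p.2) mxE eqxx mulr1n.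
Qed.

Lemma rv_consS m (p : R * 'rV[R]_m) (j : 'I_m) :
  rv_cons p 0 (lift ord0 j) = p.2 0 j.
Proof.
rewrite /rv_cons (_ : lift ord0 j = rshift 1 j); last exact: val_inj.
by rewrite (row_mxEr (p.1%:M : 'rV[R]_1) p.2).
Qed.

Lemma rv_splitK m : cancel (@rv_split m) (@rv_cons m).
Proof.
move=> x; apply/rowP => i; case: (unliftP ord0 i) => [j|] ->.
  rewrite rv_consS /= mxE; congr (x 0 _); exact: val_inj.
by rewrite rv_cons0.
Qed.

Lemma rv_consK m : cancel (@rv_cons m) (@rv_split m).
Proof.
move=> [t y]; rewrite /rv_split rv_cons0; congr pair.
by rewrite /rv_cons row_mxKr.
Qed.

Lemma measurable_rv_cons m :
  measurable_fun setT (rv_cons : measurableTypeR R * rV m -> rV m.+1).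
Proof.
apply: measurable_rV => i; case: (unliftP ord0 i) => [j|] ->.
  under eq_fun do rewrite rv_consS.
  by apply: (measurableT_comp (measurable_coord j)); exact: measurable_snd.
by under eq_fun do rewrite rv_cons0; exact: measurable_fst.
Qed.

Lemma measurable_rv_split m :
  measurable_fun setT (rv_split : rV m.+1 -> measurableTypeR R * rV m).
Proof.
apply: measurable_fun_pair; first exact: measurable_coord.
apply: measurable_rV => j; under eq_fun do rewrite mxE.
exact: measurable_coord.
Qed.

Lemma lebesgue_intS m (h : 'rV[R]_m.+1 -> \bar R) :
  lebesgue_int h =
  (\int[lebesgue_measure]_t lebesgue_int (fun y => h (rv_cons (t, y))))%E.
Proof. by []. Qed.

Section lebesgue_cons.
Context (m : nat) (mu : {sigma_finite_measure set (rV m) -> \bar R}).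

(** The product of Lebesgue measure on R with [mu], carried to R^(m+1). *)
Definition lebesgue_cons : set (rV m.+1) -> \bar R :=
  pushforward (lebesgue_measure \x mu)%E
    (rv_cons : measurableTypeR R * rV m -> rV m.+1).

Let mrv_cons := @measurable_rv_cons m.

Let lebesgue_cons0 : lebesgue_cons set0 = 0%E.
Proof. by rewrite /lebesgue_cons /pushforward preimage_set0 measure0. Qed.

Let lebesgue_cons_ge0 A : (0 <= lebesgue_cons A)%E.
Proof. exact: measure_ge0. Qed.

Let mrv_cons_mixin := isMeasurableFun.Build _ _ _ _ _ mrv_cons.
Let mrv_cons_pack : {mfun (measurableTypeR R * rV m)%type >-> rV m.+1} :=
  HB.pack (rv_cons : measurableTypeR R * rV m -> rV m.+1) mrv_cons_mixin.

Let lebesgue_cons_sigma_additive : semi_sigma_additive lebesgue_cons.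
Proof.
exact: (@measure_semi_sigma_additive _ _ _
  (pushforward (lebesgue_measure \x mu)%E mrv_cons_pack)).
Qed.

HB.instance Definition _ := isMeasure.Build _ _ _ lebesgue_cons
  lebesgue_cons0 lebesgue_cons_ge0 lebesgue_cons_sigma_additive.

Let lebesgue_cons_sigma_finite : sigma_finite setT lebesgue_cons.
Proof.
have /sigma_finiteP[F [UF ndF Foo]] := sigma_finiteT (@lebesgue_measure R).
have /sigma_finiteP[G [UG ndG Goo]] := sigma_finiteT mu.
have mFG k : measurable ([set x | F k (rv_split x).1 /\ G k (rv_split x).2] : set (rV m.+1)).
  have [mF _] := Foo k; have [mG _] := Goo k.
  rewrite -[X in measurable X]setTI.
  by apply: (@measurable_rv_split m measurableT (F k `*` G k)); exact: measurableX.
exists (fun k => [set x | F k (rv_split x).1 /\ G k (rv_split x).2]) => [|k].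
  apply/seteqP; split=> // x _.
  have [k1 _ Fk1] : (\bigcup_i F i) (rv_split x).1 by rewrite -UF.
  have [k2 _ Gk2] : (\bigcup_i G i) (rv_split x).2 by rewrite -UG.
  exists (maxn k1 k2) => //; split.
    exact: (subsetPset _ _ (ndF _ _ (leq_maxl k1 k2))).
  exact: (subsetPset _ _ (ndG _ _ (leq_maxr k1 k2))).
have [mF Fkoo] := Foo k; have [mG Gkoo] := Goo k.
split => //.
rewrite /lebesgue_cons /pushforward.
rewrite (_ : _ @^-1` _ = F k `*` G k); last first.
  by apply/funext => p; rewrite /preimage /mkset rv_consK.
by rewrite product_measure1E// lte_mul_pinfty// ge0_fin_numE.
Qed.

HB.instance Definition _ := Measure_isSigmaFinite.Build _ _ _ lebesgue_cons
  lebesgue_cons_sigma_finite.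

Lemma ge0_integral_lebesgue_cons (h : 'rV[R]_m.+1 -> \bar R) :
  measurable_fun (setT : set (rV m.+1)) h -> (forall x, 0 <= h x)%E ->
  (\int[lebesgue_cons]_x h x =
   \int[lebesgue_measure \x mu]_p h (rv_cons p))%E.
Proof. by move=> mh h0; rewrite ge0_integral_pushforward. Qed.

End lebesgue_cons.

Fixpoint lebesgue_rV n : {sigma_finite_measure set (rV n) -> \bar R} :=
  match n with
  | 0 => (dirac (0 : rV 0) : {sigma_finite_measure set (rV 0) -> \bar R})
  | m.+1 => (lebesgue_cons (lebesgue_rV m) : {sigma_finite_measure set (rV m.+1) -> \bar R})
  end.

(** Tonelli identifies the iterated integral that defines volumes with the
    integral of a sigma-finite measure, which brings in monotone convergence and
    the comparison theorems. *)
Lemma lebesgue_intE n (h : 'rV[R]_n -> \bar R) :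
  measurable_fun (setT : set (rV n)) h -> (forall x, 0 <= h x)%E ->
  lebesgue_int h = (\int[lebesgue_rV n]_x h x)%E.
Proof.
elim: n h => [|m ih] h mh h0.
  by rewrite /= integral_dirac// diracT mul1e.
rewrite lebesgue_intS [RHS]/= ge0_integral_lebesgue_cons//.
have mhc : measurable_fun setT (h \o (rv_cons : measurableTypeR R * rV m -> rV m.+1)).
  by apply: (measurableT_comp mh); exact: measurable_rv_cons.
rewrite (@fubini_tonelli1 _ _ (measurableTypeR R) (rV m) R lebesgue_measure (lebesgue_rV m) (h \o rv_cons))//; last first.
  by move=> p; exact: h0.
apply: eq_integral => t _; rewrite ih//.
by apply: (measurableT_comp mhc); exact: measurable_fun_pair.
Qed.

End lebesgue_rV.
Arguments rv_cons {R m}.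
Arguments rv_split {R m}.

(** * Slices of functions and boxes *)

Section cont_rV.
Context {R : realType}.

Lemma continuous_rV (T : topologicalType) n (F : T -> 'rV[R]_n) (x : T) :
  (forall i, {for x, continuous (fun t => F t 0 i)}) -> {for x, continuous F}.
Proof.
move=> cF; apply/cvg_ballP => e e0.
have : \forall t \near x, forall i : 'I_n, ball (F x 0 i) e (F t 0 i).
  apply: filter_forall => i; have /cvg_ballP := cF i; exact.
apply: filterS => t H; split => // i j; rewrite ord1; exact: H.
Qed.

Lemma continuous_rv_cons m (p : R * 'rV[R]_m) : {for p, continuous rv_cons}.
Proof.
apply: continuous_rV => i; case: (unliftP ord0 i) => [j|] ->.
  rewrite (_ : (fun t => _) = (fun x : 'rV[R]_m => x 0 j) \o snd); last first.
    by apply/funext => t /=; rewrite rv_consS.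
  apply: (@continuous_comp _ _ _ snd (fun x : 'rV[R]_m => x 0 j)).
    exact: cvg_snd.
  exact: coord_continuous.
rewrite (_ : (fun t => _) = fst); first exact: cvg_fst.
by apply/funext => t /=; rewrite rv_cons0.
Qed.

Lemma continuous_rv_cons1 m t (y : 'rV[R]_m) :
  {for t, continuous (fun s => rv_cons (s, y))}.
Proof.
apply: (@continuous_comp _ _ _ (fun s => (s, y)) rv_cons).
  by apply: (@cvg_pair _ _ _ _ (nbhs t) (nbhs y)); [exact: cvg_id|exact: cvg_cst].
exact: continuous_rv_cons.
Qed.

Lemma continuous_rv_cons2 m t (y : 'rV[R]_m) :
  {for y, continuous (fun z => rv_cons (t, z))}.
Proof.
apply: (@continuous_comp _ _ _ (fun z => (t, z)) rv_cons).
  by apply: (@cvg_pair _ _ _ (nbhs y) (nbhs t) (nbhs y)); [exact: cvg_cst|exact: cvg_id].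
exact: continuous_rv_cons.
Qed.

Lemma rv_consD m (h t : R) (y : 'rV[R]_m) :
  rv_cons (h + t, y) = h *: delta_mx 0 0 + rv_cons (t, y).
Proof.
apply/rowP => i; case: (unliftP ord0 i) => [j|] ->.
  by rewrite rv_consS [RHS]mxE rv_consS !mxE/= mulr0 add0r.
by rewrite rv_cons0 [RHS]mxE rv_cons0 !mxE/= mulr1.
Qed.

Lemma rv_consDr m (h t : R) (y : 'rV[R]_m) j :
  rv_cons (t, h *: delta_mx 0 j + y) =
  h *: delta_mx 0 (lift ord0 j) + rv_cons (t, y).
Proof.
apply/rowP => i; case: (unliftP ord0 i) => [k|] ->.
  by rewrite rv_consS [RHS]mxE rv_consS !mxE/= (inj_eq lift_inj).
by rewrite rv_cons0 [RHS]mxE rv_cons0 !mxE/= mulr0 add0r.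
Qed.

Lemma derive_rv_cons0 m (u : 'rV[R]_m.+1 -> R) t y :
  (derivable u (rv_cons (t, y)) (delta_mx 0 0) <->
   derivable (fun s => u (rv_cons (s, y))) t 1) /\
  'D_(delta_mx 0 0) u (rv_cons (t, y)) =
  'D_1 (fun s => u (rv_cons (s, y))) t.
Proof.
rewrite /derivable /derive.
suff -> : (fun h : R => h^-1 *: (u (h *: delta_mx 0 0 + rv_cons (t, y)) - u (rv_cons (t, y)))) =
  (fun h : R => h^-1 *: (u (rv_cons (h *: (1 : R) + t, y)) - u (rv_cons (t, y)))) by [].
by apply/funext => h; rewrite -rv_consD [h *: (1 : R)]mulr1.
Qed.

Lemma derive_rv_consS m (u : 'rV[R]_m.+1 -> R) t y j :
  (derivable u (rv_cons (t, y)) (delta_mx 0 (lift ord0 j)) <->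
   derivable (fun z => u (rv_cons (t, z))) y (delta_mx 0 j)) /\
  'D_(delta_mx 0 (lift ord0 j)) u (rv_cons (t, y)) =
  'D_(delta_mx 0 j) (fun z => u (rv_cons (t, z))) y.
Proof.
rewrite /derivable /derive.
suff -> : (fun h : R => h^-1 *: (u (h *: delta_mx 0 (lift ord0 j) + rv_cons (t, y)) - u (rv_cons (t, y)))) =
  (fun h : R => h^-1 *: (u (rv_cons (t, h *: delta_mx 0 j + y)) - u (rv_cons (t, y)))) by [].
by apply/funext => h; rewrite -rv_consDr.
Qed.

(** Two-sided derivatives are meant, so that U is open in all uses, and
    functions on a closed box are C^1 on a neighbourhood of it. *)
Definition C1_on n (U : set 'rV[R]_n) (u : 'rV[R]_n -> R) :=
  (forall x, U x -> {for x, continuous u}) /\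
  forall i : 'I_n, (forall x, U x -> derivable u x (delta_mx 0 i)) /\
    (forall x, U x -> {for x, continuous (fun z => 'D_(delta_mx 0 i) u z)}).

Lemma C1_on_slice m (U : set 'rV[R]_m.+1) u t :
  C1_on U u ->
  C1_on [set y | U (rv_cons (t, y))] (fun z => u (rv_cons (t, z))).
Proof.
move=> [cu du]; split=> [y Uy|j].
  apply: (@continuous_comp _ _ _ (fun z => rv_cons (t, z)) u).
    exact: continuous_rv_cons2.
  exact: cu.
have [d1 d2] := du (lift ord0 j); split=> y Uy.
  by have [e1 _] := derive_rv_consS u t y j; apply: e1.1; exact: d1.
have -> : (fun z => 'D_(delta_mx 0 j) (fun z0 => u (rv_cons (t, z0))) z) =
    (fun z => 'D_(delta_mx 0 (lift ord0 j)) u (rv_cons (t, z))).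
  by apply/funext => z; rewrite (derive_rv_consS u t z j).2.
apply: (@continuous_comp _ _ _ (fun z => rv_cons (t, z)) (fun x => 'D_(delta_mx 0 (lift ord0 j)) u x)).
  exact: continuous_rv_cons2.
exact: d2.
Qed.

Lemma open_slice m (U : set 'rV[R]_m.+1) t :
  open U -> open [set y | U (rv_cons (t, y))].
Proof.
move=> oU; rewrite (_ : [set _ | _] = (fun z => rv_cons (t, z)) @^-1` U)//.
by apply: open_comp => // y _; exact: continuous_rv_cons2.
Qed.

Definition box n (a b : 'rV[R]_n) : set 'rV[R]_n :=
  [set x | forall i, a 0 i <= x 0 i <= b 0 i].

Lemma compact_box n (a b : 'rV[R]_n) : compact (box a b).
Proof.
have -> : box a b = [set x | forall i, `[a 0 i, b 0 i]%classic (x ord0 i)].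
  apply/seteqP; split=> x xab i /=; first by rewrite in_itv/=; exact: xab.
  by have := xab i; rewrite /= in_itv.
apply: (@rV_compact _ n (fun i => `[a 0 i, b 0 i]%classic)) => i.
exact: segment_compact.
Qed.

Lemma box_cons m (a b : 'rV[R]_m.+1) t y :
  box a b (rv_cons (t, y)) <->
  (a 0 0 <= t <= b 0 0) /\ box (rv_split a).2 (rv_split b).2 y.
Proof.
rewrite /box/=; split=> [ab|[ab0 ab] i].
  split; first by have := ab 0; rewrite rv_cons0.
  move=> j; have := ab (lift ord0 j); rewrite rv_consS/= !mxE.
  by rewrite (_ : rshift 1 j = lift ord0 j)//; exact: val_inj.
case: (unliftP ord0 i) => [j|] ->; last by rewrite rv_cons0.
rewrite rv_consS/=; have := ab j; rewrite !mxE.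
by rewrite (_ : rshift 1 j = lift ord0 j)//; exact: val_inj.
Qed.

Lemma closed_box n (a b : 'rV[R]_n) : closed (box a b).
Proof. by apply: compact_closed; [exact: norm_hausdorff|exact: compact_box]. Qed.

Lemma measurable_box n (a b : 'rV[R]_n) :
  measurable (box a b : set (borel (M := 'rV[R]_n))).
Proof. by apply: closed_borel; exact: closed_box. Qed.
Hint Resolve measurable_box : core.

Section integral_box.
Context m (a b : 'rV[R]_m.+1) (f : 'rV[R]_m.+1 -> \bar R).
Local Notation rV n := (borel (M := 'rV[R]_n)).
Local Notation a' := (rv_split a).2.
Local Notation b' := (rv_split b).2.
Hypothesis mf : measurable_fun (box a b : set (rV m.+1)) f.
Hypothesis f0 : forall x, box a b x -> (0 <= f x)%E.

Let g : 'rV[R]_m.+1 -> \bar R := f \_ (box a b).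

Let mg : measurable_fun (setT : set (rV m.+1)) g.
Proof.
exact: (@measurable_restrictT _ _ (rV m.+1) _ (box a b) f (measurable_box a b)).1.
Qed.

Let g0 x : (0 <= g x)%E.
Proof. by rewrite /g patchE; case: ifPn => // /set_mem; exact: f0. Qed.

Let mgc : measurable_fun setT (g \o (rv_cons : measurableTypeR R * rV m -> rV m.+1)).
Proof. by apply: (measurableT_comp mg); exact: measurable_rv_cons. Qed.

Let gE t y : g (rv_cons (t, y)) =
  ((fun s => ((fun z => f (rv_cons (s, z))) \_ (box a' b')) y)
     \_ `[a 0 0, b 0 0]%classic) t.
Proof.
rewrite /g !patchE; case: ifPn => [/set_mem/box_cons[abt aby]|nab].
  by rewrite mem_set ?mem_set//= in_itv.
case: ifPn => // /set_mem; rewrite /= in_itv/= => abt; case: ifPn => // /set_mem aby.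
by move: nab; rewrite mem_set//; apply/box_cons.
Qed.

Lemma integral_box_cons :
  (\int[lebesgue_rV m.+1]_(x in box a b) f x =
   \int[lebesgue_measure]_(t in `[a 0%R 0%R, b 0%R 0%R])
     \int[lebesgue_rV m]_(y in box a' b') f (rv_cons (t, y)))%E.
Proof.
rewrite integral_mkcond -/g ge0_integral_lebesgue_cons//.
rewrite (@fubini_tonelli1 _ _ (measurableTypeR R) (rV m) R lebesgue_measure
  (lebesgue_rV m) (g \o rv_cons))//; last by move=> p; exact: g0.
rewrite [RHS]integral_mkcond; apply: eq_integral => t _.
rewrite [RHS]patchE; case: ifPn => [tab|tab].
  rewrite [RHS]integral_mkcond; apply: eq_integral => y _ /=.
  by rewrite gE patchE tab.
by apply: integral0_eq => y _; rewrite /= gE patchE (negbTE tab).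
Qed.

(** The same by integrating over the first coordinate first, which is the order
    needed to apply one-dimensional inequalities along lines. *)
Lemma integral_box_cons_swap :
  (\int[lebesgue_rV m.+1]_(x in box a b) f x =
   \int[lebesgue_rV m]_(y in box a' b')
     \int[lebesgue_measure]_(t in `[a 0%R 0%R, b 0%R 0%R]) f (rv_cons (t, y)))%E.
Proof.
rewrite integral_mkcond -/g ge0_integral_lebesgue_cons//.
rewrite (@fubini_tonelli2 _ _ (measurableTypeR R) (rV m) R lebesgue_measure
  (lebesgue_rV m) (g \o rv_cons))//; last by move=> p; exact: g0.
rewrite [RHS]integral_mkcond; apply: eq_integral => y _.
rewrite [RHS]patchE; case: ifPn => [yab|yab].
  rewrite [RHS]integral_mkcond; apply: eq_integral => t _ /=.
  by rewrite gE !patchE yab.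
by apply: integral0_eq => t _; rewrite /= gE !patchE (negbTE yab); case: ifP.
Qed.

Lemma measurable_integral_slice :
  measurable_fun (`[a 0 0, b 0 0]%classic : set (measurableTypeR R))
    (fun t => \int[lebesgue_rV m]_(y in box a' b') f (rv_cons (t, y)))%E.
Proof.
have mF := measurable_fun_fubini_tonelli_F _ mgc (fun p => g0 (rv_cons p)).
apply: (eq_measurable_fun _ _ (measurable_funTS (mF (lebesgue_rV m)))) => t tab.
rewrite /fubini_F [RHS]integral_mkcond; apply: eq_integral => y _ /=.
by rewrite gE patchE tab.
Qed.

Lemma measurable_integral_fiber :
  measurable_fun (box a' b' : set (rV m))
    (fun y => \int[lebesgue_measure]_(t in `[a 0%R 0%R, b 0%R 0%R])
                f (rv_cons (t, y)))%E.
Proof.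
have mF := measurable_fun_fubini_tonelli_G _ mgc (fun p => g0 (rv_cons p)).
apply: (eq_measurable_fun _ _ (measurable_funTS (mF lebesgue_measure))) => y yab.
rewrite /fubini_G [RHS]integral_mkcond; apply: eq_integral => t _ /=.
by rewrite gE !patchE yab.
Qed.

End integral_box.

Lemma lebesgue_box n (a b : 'rV[R]_n) : (forall i, a 0 i < b 0 i) ->
  (0 < lebesgue_rV n (box a b) < +oo)%E.
Proof.
elim: n a b => [|m ih] a b ab.
  rewrite /= diracE mem_set ?lte01 ?ltry//; by case.
have -> : lebesgue_rV m.+1 (box a b) = (\int[lebesgue_rV m.+1]_(x in box a b) cst 1 x)%E.
  by rewrite integral_cst ?mul1e.
rewrite integral_box_cons//.
under eq_integral do rewrite integral_cst// mul1e.
have /andP[l0 loo] := ih (rv_split a).2 (rv_split b).2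
  (fun i => ltac:(by rewrite !mxE; exact: ab)).
move: l0 loo; set v := (X in (0 < X)%E); move=> l0 loo.
have lE : v = (fine v)%:E by rewrite fineK// ge0_fin_numE// ltW.
rewrite (eq_integral (fun=> (fine v)%:E)); last by move=> t _; rewrite -lE.
rewrite integral_cst//= lebesgue_measure_itv/= lte_fin ab -EFinD -EFinM lte_fin ltry andbT.
by rewrite mulr_gt0 ?subr_gt0// fine_gt0// l0 loo.
Qed.

End cont_rV.
#[export] Hint Resolve measurable_box : core.

(** * One-dimensional inequalities *)

Section dim1.
Context {R : realType}.
Implicit Types (v F : R -> R) (a b c e : R).

Lemma lebesgue_measure_cc (a b : R) : a < b ->
  lebesgue_measure (`[a, b]%classic : set R) = (b - a)%:E.
Proof. by move=> ab; rewrite lebesgue_measure_itv/= lte_fin ab -EFinB. Qed.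

Definition C1_itv a b v := forall t, a <= t <= b ->
  derivable v t 1 /\ {for t, continuous (fun s => 'D_1 v s)}.

Lemma C1_itv_cont a b v t : C1_itv a b v -> a <= t <= b -> {for t, continuous v}.
Proof.
by move=> Cv /Cv[/derivable1_diffP dv _]; exact: differentiable_continuous.
Qed.

Lemma cont_itv_within a b v : (forall t, a <= t <= b -> {for t, continuous v}) ->
  {within `[a, b], continuous v}.
Proof.
move=> cv; apply: continuous_in_subspaceT => t; rewrite inE/= in_itv/=; exact: cv.
Qed.

Lemma cont_itv_integrable a b v :
  (forall t, a <= t <= b -> {for t, continuous v}) ->
  lebesgue_measure.-integrable `[a, b] (EFin \o v).
Proof.
move=> cv; apply: continuous_compact_integrable; first exact: segment_compact.
exact: cont_itv_within.
Qed.

Lemma cont_sqr (T : topologicalType) (g : T -> R) x :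
  {for x, continuous g} -> {for x, continuous (fun t => g t ^+ 2)}.
Proof.
move=> cg; rewrite (_ : (fun _ => _) = fun t => g t * g t); last first.
  by apply/funext => t; rewrite expr2.
exact: continuousM.
Qed.

Lemma C1_integral a b F f : a < b ->
  (forall t, a <= t <= b -> is_derive t 1 F (f t)) ->
  (forall t, a <= t <= b -> {for t, continuous f}) ->
  (\int[lebesgue_measure]_(t in `[a, b]) (f t)%:E = (F b - F a)%:E)%E.
Proof.
move=> ab dF cf.
have cF t : a <= t <= b -> {for t, continuous F}.
  move=> /dF[/derivable1_diffP dv _]; exact: differentiable_continuous.
rewrite (@continuous_FTC2 _ _ F)//.
- exact: cont_itv_within.
- split.
  + move=> t; rewrite in_itv/= => /andP[/ltW a_t /ltW tb].
    by have [] := dF t; rewrite ?a_t ?tb.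
  + by apply: cvg_at_right_filter; apply: cF; rewrite lexx (ltW ab).
  + by apply: cvg_at_left_filter; apply: cF; rewrite lexx (ltW ab).
- move=> t; rewrite in_itv/= => /andP[/ltW a_t /ltW tb].
  by rewrite derive1E; have [|_ ->] := dF t; rewrite ?a_t ?tb.
Qed.

(** Integrate the derivative of (t - e) (v - c)^2, whose boundary terms cancel
    by hypothesis, and absorb the cross term: this bounds (v - c)^2 by v'^2. *)
Lemma hardy_itv a b e c v : a < b -> C1_itv a b v ->
  (b - e) * (v b - c) ^+ 2 = (a - e) * (v a - c) ^+ 2 ->
  (\int[lebesgue_measure]_(t in `[a, b]) ((v t - c) ^+ 2)%:E <=
   \int[lebesgue_measure]_(t in `[a, b]) (4 * (t - e) ^+ 2 * ('D_1 v t) ^+ 2)%:E)%E.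
Proof.
move=> ab Cv bdry.
pose F t := (t - e) * (v t - c) ^+ 2.
pose f t := (v t - c) ^+ 2 + (t - e) * (2 * (v t - c) * 'D_1 v t).
have dF t : a <= t <= b -> is_derive t 1 F (f t).
  move=> tab; have [dv _] := Cv t tab; have dv' := derivableP dv.
  rewrite /F /f; apply: is_derive_eq; rewrite /GRing.scale/=; ring.
have cv := C1_itv_cont Cv.
have cv' t : a <= t <= b -> {for t, continuous (fun s => 'D_1 v s)}.
  by move=> /Cv[].
have cfsq t : a <= t <= b -> {for t, continuous (fun t => (v t - c) ^+ 2)}.
  move=> tab; apply: cont_sqr.
  by apply: continuousB; [exact: cv|exact: cst_continuous].
have cte t : {for t, continuous (fun t : R => t - e)}.
  by apply: continuousB; [exact: cvg_id|exact: cst_continuous].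
have cf t : a <= t <= b -> {for t, continuous f}.
  move=> tab; apply: (@continuousD _ _ _ (fun t => (v t - c) ^+ 2)); first exact: cfsq.
  apply: (@continuousM _ _ (fun t : R => t - e)) => //.
  apply: (@continuousM _ _ (fun t => 2 * (v t - c))); last exact: cv'.
  apply: (@continuousM _ _ (fun=> 2)); first exact: cst_continuous.
  by apply: continuousB; [exact: cv|exact: cst_continuous].
pose w t := 4 * (t - e) ^+ 2 * ('D_1 v t) ^+ 2.
have cw t : a <= t <= b -> {for t, continuous w}.
  move=> tab; apply: (@continuousM _ _ (fun t => 4 * (t - e) ^+ 2)).
    apply: (@continuousM _ _ (fun=> 4)); first exact: cst_continuous.
    exact: cont_sqr.
  by apply: cont_sqr; exact: cv'.
have If0 : (\int[lebesgue_measure]_(t in `[a, b]) (f t)%:E = 0)%E.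
  by rewrite (C1_integral ab dF cf) /F bdry subrr.
have if_ := cont_itv_integrable cf; have iw := cont_itv_integrable cw.
have -> : (\int[lebesgue_measure]_(t in `[a, b]) (w t)%:E =
    \int[lebesgue_measure]_(t in `[a, b]) (2 * f t + w t)%:E)%E.
  under [RHS]eq_integral do rewrite EFinD EFinM.
  rewrite integralD//; last exact: integrableZl.
  by rewrite integralZl// If0 mule0 add0e.
apply: ge0_le_integral => //.
- by move=> t _; rewrite lee_fin sqr_ge0.
- exact: (measurable_int _ (cont_itv_integrable cfsq)).
- apply: (measurable_int lebesgue_measure).
  rewrite (_ : (fun _ => _) = (fun t => 2%:E * (f t)%:E + (w t)%:E))%E.
    by apply: integrableD => //; exact: integrableZl.
  by apply/funext => t; rewrite EFinD EFinM.
- move=> t _; rewrite lee_fin /f /w.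
  set x := v t - c; set y := 'D_1 v t; set z := t - e.
  (* Young's inequality for the cross term of f. *)
  rewrite -subr_ge0 (_ : _ - _ = (x + 2 * y * z) ^+ 2) ?sqr_ge0//; ring.
Qed.

(** On each side of the base point c the field t - e is taken to vanish at the
    endpoint of the interval, while v - v c vanishes at c: neither end
    contributes to [hardy_itv]. *)
Lemma poincare_itv a b c v : a < b -> C1_itv a b v -> a <= c <= b ->
  (\int[lebesgue_measure]_(t in `[a, b]) ((v t - v c) ^+ 2)%:E <=
   (8 * (b - a) ^+ 2)%:E *
   \int[lebesgue_measure]_(t in `[a, b]) ('D_1 v t ^+ 2)%:E)%E.
Proof.
move=> ab Cv /andP[ac cb].
have sub a1 b1 : a <= a1 -> b1 <= b -> C1_itv a1 b1 v.
  by move=> a1a b1b t /andP[a1t tb1]; apply: Cv; rewrite (le_trans a1a a1t) (le_trans tb1).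
have cD := fun t tab => (Cv t tab).2.
have mD a1 b1 : a <= a1 -> b1 <= b ->
    measurable_fun `[a1, b1] (fun t => ('D_1 v t ^+ 2)%:E).
  move=> /sub /[apply] C1; apply: (measurable_int lebesgue_measure).
  by apply: cont_itv_integrable => t /C1[_ ?]; exact: cont_sqr.
have mV a1 b1 : a <= a1 -> b1 <= b ->
    measurable_fun `[a1, b1] (fun t => ((v t - v c) ^+ 2)%:E).
  move=> /sub /[apply] C1; apply: (measurable_int lebesgue_measure).
  apply: cont_itv_integrable => t /(C1_itv_cont C1) cv; apply: cont_sqr.
  by apply: continuousB => //; exact: cst_continuous.
have half a1 b1 e : a <= a1 -> b1 <= b -> a <= e <= b ->
  (b1 - e) * (v b1 - v c) ^+ 2 = (a1 - e) * (v a1 - v c) ^+ 2 ->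
  (\int[lebesgue_measure]_(t in `[a1, b1]) ((v t - v c) ^+ 2)%:E <=
   (4 * (b - a) ^+ 2)%:E *
   \int[lebesgue_measure]_(t in `[a, b]) ('D_1 v t ^+ 2)%:E)%E.
  move=> aa1 b1b /andP[ae eb] bdry.
  have [a1b1|b1a1] := ltP a1 b1; last first.
    rewrite (_ : (\int[_]_(t in _) _ = 0)%E); last first.
      have [->|ne] := eqVneq a1 b1; first by rewrite set_itv1 integral_set1.
      by rewrite set_itv_ge ?integral_set0// bnd_simp -ltNge lt_neqAle eq_sym ne.
    apply: mule_ge0; first by rewrite lee_fin mulr_ge0// sqr_ge0.
    by apply: integral_ge0 => t _; rewrite lee_fin sqr_ge0.
  apply: (le_trans (hardy_itv a1b1 (sub _ _ aa1 b1b) bdry)).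
  rewrite -ge0_integralZl//; last 3 first.
  - exact: mD.
  - by move=> t _; rewrite lee_fin sqr_ge0.
  - by rewrite lee_fin mulr_ge0// sqr_ge0.
  apply: (@le_trans _ _ (\int[lebesgue_measure]_(t in `[a1, b1])
    ((4 * (b - a) ^+ 2)%:E * ('D_1 v t ^+ 2)%:E)%E)%E).
    apply: ge0_le_integral => //.
    - move=> t _; rewrite lee_fin; apply: mulr_ge0; last exact: sqr_ge0.
      by apply: mulr_ge0 => //; exact: sqr_ge0.
    - apply: (measurable_int lebesgue_measure).
      apply: cont_itv_integrable => t /andP[a1t tb1].
      apply: (@continuousM _ _ (fun t => 4 * (t - e) ^+ 2)); last first.
        by apply: cont_sqr; apply: cD; rewrite (le_trans aa1) ?(le_trans tb1).
      apply: (@continuousM _ _ (fun=> 4)); first exact: cst_continuous.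
      apply: cont_sqr.
      by apply: continuousB; [exact: cvg_id|exact: cst_continuous].
    - by apply: emeasurable_funM => //; exact: mD.
    - move=> t; rewrite /= in_itv/= => /andP[a1t tb1]; rewrite -EFinM lee_fin.
      rewrite ler_wpM2r ?sqr_ge0// ler_wpM2l//.
      have : `|t - e| <= b - a.
        have at_ := le_trans aa1 a1t; have tb := le_trans tb1 b1b.
        by rewrite ler_norml; apply/andP; split; lra.
      move=> h; rewrite -(real_normK (num_real (t - e))).
      by rewrite ler_sqr ?nnegrE ?subr_ge0 ?(ltW ab).
  apply: ge0_subset_integral => //.
  - by apply: emeasurable_funM => //; exact: mD.
  - move=> t _; rewrite -EFinM lee_fin; apply: mulr_ge0; last exact: sqr_ge0.
    by apply: mulr_ge0 => //; exact: sqr_ge0.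
  - by move=> t; rewrite /= !in_itv/= => /andP[/(le_trans aa1)-> /le_trans->].
rewrite (_ : (8 * (b - a) ^+ 2)%:E = (4 * (b - a) ^+ 2)%:E + (4 * (b - a) ^+ 2)%:E)%E; last first.
  by rewrite -EFinD; congr EFin; ring.
have c0 : 0 <= 4 * (b - a) ^+ 2 by apply: mulr_ge0 => //; exact: sqr_ge0.
rewrite ge0_muleDl ?lee_fin//.
(* Split at c, with e = a on the left part and e = b on the right part. *)
apply: (@le_trans _ _ (\int[lebesgue_measure]_(t in `[a, c]) ((v t - v c) ^+ 2)%:E +
   \int[lebesgue_measure]_(t in `[c, b]) ((v t - v c) ^+ 2)%:E)%E); last first.
  apply: leeD.
    by apply: (half _ _ a) => //; rewrite ?lexx ?(ltW ab)// !subrr mul0r expr0n/= mulr0.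
  by apply: (half _ _ b) => //; rewrite ?lexx ?(ltW ab)// !subrr mul0r expr0n/= mulr0.
rewrite (_ : `[a, b]%classic = `[a, c] `|` `]c, b]); last first.
  by rewrite -itv_bndbnd_setU// bnd_simp.
rewrite ge0_integral_setU//=.
- apply: leeD => //; apply: ge0_subset_integral => //; first exact: mV.
  - by move=> t _; rewrite lee_fin sqr_ge0.
  - exact: subset_itv_oc_cc.
- rewrite -itv_bndbnd_setU ?bnd_simp//; exact: mV.
- by move=> t _; rewrite lee_fin sqr_ge0.
- apply/disj_setPS => t; rewrite /= !in_itv/= => -[/andP[_ tc] /andP[ct _]].
  by move: (lt_le_trans ct tc); rewrite ltxx.
Qed.

End dim1.

(** * Comparison of integrals of nonnegative functions *)

Section nonneg_integral.
Context d (T : measurableType d) (R : realType) (mu : {measure set T -> \bar R}).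
Variables (D : set T) (mD : measurable D).
Implicit Types f g : T -> R.

Lemma ge0_integralZl_real f (k : R) :
  measurable_fun D f -> (forall x, D x -> 0 <= f x) -> 0 <= k ->
  (\int[mu]_(x in D) (k * f x)%:E = k%:E * \int[mu]_(x in D) (f x)%:E)%E.
Proof.
move=> mf f0 k0; under eq_integral do rewrite EFinM.
by rewrite ge0_integralZl//; exact/measurable_EFinP.
Qed.

Lemma integral_le_lin2 f g1 g2 (k1 k2 : R) :
  measurable_fun D f -> measurable_fun D g1 -> measurable_fun D g2 ->
  (forall x, D x -> 0 <= f x) -> (forall x, D x -> 0 <= g1 x) ->
  (forall x, D x -> 0 <= g2 x) -> 0 <= k1 -> 0 <= k2 ->
  (forall x, D x -> f x <= k1 * g1 x + k2 * g2 x) ->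
  (\int[mu]_(x in D) (f x)%:E <=
   k1%:E * \int[mu]_(x in D) (g1 x)%:E + k2%:E * \int[mu]_(x in D) (g2 x)%:E)%E.
Proof.
move=> mf mg1 mg2 f0 g10 g20 k10 k20 fg.
have mk g k : measurable_fun D g -> measurable_fun D (fun x => (k * g x)%:E).
  by move=> mg; exact/measurable_EFinP/measurable_funM.
have pk g k : (forall x, D x -> 0 <= g x) -> 0 <= k ->
    forall x, D x -> (0 <= (k * g x)%:E)%E.
  by move=> g0 k0 x Dx; rewrite lee_fin mulr_ge0// g0.
rewrite -!ge0_integralZl_real// -(ge0_integralD mu mD (pk _ _ g10 k10)
  (mk _ _ mg1) (pk _ _ g20 k20) (mk _ _ mg2)).
apply: ge0_le_integral => //.
- exact/measurable_EFinP.
- by apply/measurable_EFinP; apply: measurable_funD; exact: measurable_funM.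
Qed.

Lemma integral_le_lin1 f g (k : R) :
  measurable_fun D f -> measurable_fun D g ->
  (forall x, D x -> 0 <= f x) -> (forall x, D x -> 0 <= g x) -> 0 <= k ->
  (forall x, D x -> f x <= k * g x) ->
  (\int[mu]_(x in D) (f x)%:E <= k%:E * \int[mu]_(x in D) (g x)%:E)%E.
Proof.
move=> mf mg f0 g0 k0 fg.
rewrite -ge0_integralZl_real//; apply: ge0_le_integral => //.
- exact/measurable_EFinP.
- exact/measurable_EFinP/measurable_funM.
Qed.

(** Serves to select a good slice of a box. Twice the mean in place of the mean
    gives a strict contradiction, except for a function of integral zero. *)
Lemma exists_le_mean (h : T -> \bar R) :
  measurable_fun D h -> (forall x, D x -> 0 <= h x)%E ->
  (0 < mu D < +oo)%E ->
  exists2 x, D x & (mu D * h x <= 2%:E * \int[mu]_(x in D) h x)%E.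
Proof.
move=> mh h0 /andP[muD0 muDoo]; apply: contrapT => nex.
have lt x : D x -> (2%:E * \int[mu]_(x in D) h x < mu D * h x)%E.
  by move=> Dx; rewrite ltNge; apply/negP => le; apply: nex; exists x.
set K := (\int[mu]_(x in D) h x)%E in lt.
have K0 : (0 <= K)%E by exact: integral_ge0.
have Dfin : mu D \is a fin_num by rewrite ge0_fin_numE// ltW.
have [Koo|Koo] := eqVneq K +oo%E.
  have [D0|/set0P[x Dx]] := eqVneq D set0.
    by move: muD0; rewrite D0 measure0 ltxx.
  by have := lt x Dx; rewrite Koo gt0_muley ?lte_fin// ltNge leey.
have Kfin : K \is a fin_num by rewrite ge0_fin_numE// lt_neqAle Koo leey.
have [K0'|K_neq0] := eqVneq K 0%E.
  have hpos x : D x -> (0 < h x)%E.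
    move=> Dx; have := lt x Dx; rewrite K0' mule0 => mh0.
    rewrite lt_neqAle h0// andbT.
    by apply/negP => /eqP h0'; move: mh0; rewrite -h0' mule0 ltxx.
  have : ae_eq mu D h (cst 0%E).
    apply/ae_eq_integral_abs => //; rewrite -K0'; apply: eq_integral => x /[!inE] Dx.
    by rewrite gee0_abs// h0.
  move=> [N [mN N0 DN]].
  have : (mu D <= mu N)%E.
    apply: le_measure; rewrite ?inE// => x Dx; apply: DN => /= /(_ Dx) hx.
    by have := hpos x Dx; rewrite hx ltxx.
  by rewrite N0 leNgt muD0.
pose v := fine (mu D).
have vE : mu D = v%:E by rewrite fineK.
have v0 : 0 < v by rewrite /v fine_gt0// muD0.
have : (2%:E * K <= K)%E.
  have -> : (2%:E * K = \int[mu]_(x in D) cst (2%:E * K * v^-1%:E) x)%E.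
    by rewrite integral_cst// vE -muleA -EFinM mulVf ?mule1// gt_eqF.
  apply: ge0_le_integral => //.
  - by move=> x _; rewrite !mule_ge0 ?lee_fin// invr_ge0 ltW.
  - by move=> x Dx; rewrite /= lee_pdivrMr// [X in (_ <= X)%E]muleC -vE ltW// lt.
apply/negP; rewrite -ltNge -(fineK Kfin) -EFinM lte_fin.
have : 0 < fine K by rewrite fine_gt0// lt_neqAle eq_sym K_neq0 K0 ltey_eq Kfin.
lra.
Qed.

End nonneg_integral.

(** * The Poincare inequality on a Euclidean box *)

Section box_poincare.
Context {R : realType}.
Local Notation rV n := (borel (M := 'rV[R]_n)).

Definition grad2 n (u : 'rV[R]_n -> R) (x : 'rV[R]_n) : R :=
  \sum_i ('D_(delta_mx 0 i) u x) ^+ 2.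

Lemma grad2_ge0 n (u : 'rV[R]_n -> R) x : 0 <= grad2 u x.
Proof. by apply: sumr_ge0 => i _; exact: sqr_ge0. Qed.

Lemma continuous_measurable_sub n (U B : set 'rV[R]_n) (f : 'rV[R]_n -> R) :
  open U -> B `<=` U -> measurable (B : set (rV n)) ->
  (forall x, U x -> {for x, continuous f}) -> measurable_fun (B : set (rV n)) f.
Proof.
move=> oU BU mB cf; apply: (@measurable_funS _ _ (rV n) _ U) => //; first exact: open_borel.
exact: continuous_on_measurable.
Qed.

Lemma C1_on_measurable n (U B : set 'rV[R]_n) u : open U -> B `<=` U ->
  measurable (B : set (rV n)) -> C1_on U u ->
  measurable_fun (B : set (rV n)) u /\
  forall i, measurable_fun (B : set (rV n)) (fun x => 'D_(delta_mx 0 i) u x).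
Proof.
move=> oU BU mB [cu du].
split=> [|i]; first exact: (continuous_measurable_sub oU BU mB cu).
by apply: (continuous_measurable_sub oU BU mB); have [] := du i.
Qed.

Lemma C1_on_measurable_grad2 n (U B : set 'rV[R]_n) u : open U -> B `<=` U ->
  measurable (B : set (rV n)) -> C1_on U u ->
  measurable_fun (B : set (rV n)) (grad2 u).
Proof.
move=> oU BU mB Cu; have [_ mD] := C1_on_measurable oU BU mB Cu.
by apply: measurable_sum => i; exact: measurable_funX.
Qed.

(** By averaging, some slice {s} x box' carries at most twice its share of the
    energy. On that slice u is close to a constant c by induction, and u differs
    from its value on the slice by the one-dimensional inequality along the
    first coordinate, based at s. *)
Lemma box_poincare n (a b : 'rV[R]_n) : (forall i, a 0 i < b 0 i) ->
  exists2 C : R, 0 <= C & forall U u, open U -> box a b `<=` U -> C1_on U u ->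
  exists c : R, (\int[lebesgue_rV n]_(x in box a b) ((u x - c) ^+ 2)%:E <=
    C%:E * \int[lebesgue_rV n]_(x in box a b) (grad2 u x)%:E)%E.
Proof.
elim: n a b => [|m ih] a b ab.
  exists 0 => // U u _ _ _; exists (u 0); rewrite mul0e.
  rewrite (_ : (\int[_]_(x in _) _ = 0)%E)//; apply: integral0_eq => x _.
  by rewrite (_ : x = 0) ?subrr ?expr0n//; apply/rowP => -[].
pose a' := (rv_split a).2; pose b' := (rv_split b).2.
have ab' i : a' 0 i < b' 0 i by rewrite !mxE.
have [C C0 HC] := ih a' b' ab'.
pose l := b 0 0 - a 0 0; have l0 : 0 < l by rewrite subr_gt0.
exists (16 * l ^+ 2 + 4 * C); first by rewrite addr_ge0// mulr_ge0// sqr_ge0.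
move=> U u oU BU Cu.
have mB : measurable (box a b : set (rV m.+1)) by exact: measurable_box.
have [mu mDu] := C1_on_measurable oU BU mB Cu.
have mg := C1_on_measurable_grad2 oU BU mB Cu.
pose gS (x : 'rV[R]_m.+1) := \sum_(j < m) ('D_(delta_mx 0 (lift ord0 j)) u x) ^+ 2.
have gS0 x : 0 <= gS x by apply: sumr_ge0 => i _; exact: sqr_ge0.
have mgS : measurable_fun (box a b : set (rV m.+1)) gS.
  by apply: measurable_sum => i; exact: measurable_funX.
have gE x : grad2 u x = ('D_(delta_mx 0 0) u x) ^+ 2 + gS x.
  by rewrite /grad2 big_ord_recl.
have gSE t y : gS (rv_cons (t, y)) = grad2 (fun z => u (rv_cons (t, z))) y.
  by apply: eq_bigr => j _; rewrite (derive_rv_consS u t y j).2.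
pose h t := (\int[lebesgue_rV m]_(y in box a' b') (gS (rv_cons (t, y)))%:E)%E.
have /measurable_EFinP mgSE := mgS.
have gSE0 x : box a b x -> (0 <= (gS x)%:E)%E by rewrite lee_fin.
have lI : lebesgue_measure (`[a 0 0, b 0 0]%classic : set R) = l%:E by exact: lebesgue_measure_cc.
(* The good slice: the energy h s along it is at most twice the mean. *)
have [s sI hs] : exists2 s, `[a 0 0, b 0 0]%classic s &
    (lebesgue_measure `[a 0%R 0%R, b 0%R 0%R] * h s <=
      2%:E * \int[lebesgue_measure]_(t in `[a 0%R 0%R, b 0%R 0%R]) h t)%E.
  apply: (@exists_le_mean _ (measurableTypeR R) R lebesgue_measure `[a 0 0, b 0 0]%classic _ h) => //.
  - exact: (measurable_integral_slice (f := fun x => (gS x)%:E)).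
  - by move=> t _; apply: integral_ge0 => y _; rewrite lee_fin.
  - by rewrite [X in (_ < X < _)%E]lI lte_fin ltry andbT.
rewrite -(integral_box_cons mgSE)// [X in (X * _)%E]lI in hs.
have {}sI : a 0 0 <= s <= b 0 0 by move: sI; rewrite /= in_itv.
have [c Hc] := HC _ _ (open_slice (t := s) oU)
  (fun y yB => BU _ ((box_cons a b s y).2 (conj sI yB))) (C1_on_slice s Cu).
exists c.
(* The values of u on the good slice, extended constantly along lines. *)
pose w (x : 'rV[R]_m.+1) := u (rv_cons (s, (rv_split x).2)).
have mw : measurable_fun (box a b : set (rV m.+1)) w.
  apply: (@measurable_comp _ _ _ _ (rV m.+1) _ (box a b) u) => //.
    move=> _ [x xB <-]; apply/box_cons; split=> //.
    by move: xB; rewrite -[x]rv_splitK => /box_cons[_]; rewrite rv_consK.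
  apply: measurable_funTS; apply: (measurableT_comp (@measurable_rv_cons R m)).
  apply: measurable_fun_pair => //.
  by apply: (measurableT_comp measurable_snd); exact: measurable_rv_split.
have mf1 : measurable_fun (box a b : set (rV m.+1)) (fun x => (u x - w x) ^+ 2).
  by apply: measurable_funX; exact: measurable_funB.
have mf2 : measurable_fun (box a b : set (rV m.+1)) (fun x => (w x - c) ^+ 2).
  by apply: measurable_funX; exact: measurable_funB.
have mf : measurable_fun (box a b : set (rV m.+1)) (fun x => (u x - c) ^+ 2).
  by apply: measurable_funX; exact: measurable_funB.
set E := (\int[lebesgue_rV m.+1]_(x in box a b) (grad2 u x)%:E)%E.
have E0 : (0 <= E)%E by apply: integral_ge0 => x _; rewrite lee_fin grad2_ge0.
have ESle : (\int[lebesgue_rV m.+1]_(x in box a b) (gS x)%:E <= E)%E.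
  rewrite -[E]mul1e; apply: integral_le_lin1 => // x _; rewrite ?grad2_ge0//.
  by rewrite mul1r gE lerDr sqr_ge0.
have le1 : (\int[lebesgue_rV m.+1]_(x in box a b) ((u x - w x) ^+ 2)%:E <=
    (8 * l ^+ 2)%:E * E)%E.
  apply: (@le_trans _ _ ((8 * l ^+ 2)%:E *
    \int[lebesgue_rV m.+1]_(x in box a b) (('D_(delta_mx 0 0) u x) ^+ 2)%:E)%E); last first.
    apply: lee_wpmul2l; first by rewrite lee_fin mulr_ge0// sqr_ge0.
    rewrite -[E]mul1e; apply: integral_le_lin1 => //.
    - exact: measurable_funX.
    - by move=> x _; rewrite sqr_ge0.
    - by move=> x _; rewrite grad2_ge0.
    - by move=> x _; rewrite mul1r gE lerDl.
  have mD0 : measurable_fun (box a b : set (rV m.+1))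
      (fun x => (('D_(delta_mx 0 0) u x) ^+ 2)%:E).
    by apply/measurable_EFinP; exact: measurable_funX.
  rewrite (integral_box_cons_swap (f := fun x => (('D_(delta_mx 0 0) u x) ^+ 2)%:E))//; last first.
    by move=> x _; rewrite lee_fin sqr_ge0.
  rewrite (integral_box_cons_swap (f := fun x => ((u x - w x) ^+ 2)%:E))//; first last.
  - by move=> x _; rewrite lee_fin sqr_ge0.
  - exact/measurable_EFinP.
  rewrite -ge0_integralZl//; first last.
  - by rewrite lee_fin mulr_ge0// sqr_ge0.
  - by move=> y _; apply: integral_ge0 => t _; rewrite lee_fin sqr_ge0.
  - apply: (measurable_integral_fiber (f := fun x => (('D_(delta_mx 0 0) u x) ^+ 2)%:E)) => //.
    by move=> x _; rewrite lee_fin sqr_ge0.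
  apply: ge0_le_integral => //.
  - by move=> y _; apply: integral_ge0 => t _; rewrite lee_fin sqr_ge0.
  - apply: (measurable_integral_fiber (f := fun x => ((u x - w x) ^+ 2)%:E)).
      exact/measurable_EFinP.
    by move=> x _; rewrite lee_fin sqr_ge0.
  - apply: emeasurable_funM => //.
    apply: (measurable_integral_fiber (f := fun x => (('D_(delta_mx 0 0) u x) ^+ 2)%:E)) => //.
    by move=> x _; rewrite lee_fin sqr_ge0.
  - move=> y yB.
    under eq_integral do rewrite /w rv_consK/=.
    under [X in (_ * X)%E]eq_integral do rewrite (derive_rv_cons0 u _ y).2.
    apply: (poincare_itv (v := fun t => u (rv_cons (t, y)))) => // t tI.
    have UB : U (rv_cons (t, y)) by apply: BU; apply/box_cons.
    have d0 := (Cu.2 0).1 _ UB; have c0 := (Cu.2 0).2 _ UB.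
    split; first exact: (proj1 (derive_rv_cons0 u t y).1 d0).
    have -> : (fun s => 'D_1 (fun t => u (rv_cons (t, y))) s) =
        (fun s => 'D_(delta_mx 0 0) u (rv_cons (s, y))).
      by apply/funext => r; rewrite (derive_rv_cons0 u r y).2.
    apply: (@continuous_comp _ _ _ (fun s => rv_cons (s, y)) (fun x => 'D_(delta_mx 0 0) u x)).
      exact: continuous_rv_cons1.
    exact c0.
have le2 : (\int[lebesgue_rV m.+1]_(x in box a b) ((w x - c) ^+ 2)%:E <=
    (2 * C)%:E * E)%E.
  rewrite (integral_box_cons (f := fun x => ((w x - c) ^+ 2)%:E)); first last.
  - by move=> x _; rewrite lee_fin sqr_ge0.
  - exact/measurable_EFinP.
  pose V := (\int[lebesgue_rV m]_(y in box a' b') ((u (rv_cons (s, y)) - c) ^+ 2)%:E)%E.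
  rewrite (eq_integral (cst V)); last first.
    by move=> t _; apply: eq_integral => y _; rewrite /w rv_consK.
  rewrite integral_cst// [X in (_ * X <= _)%E]lI.
  have HV : (V <= C%:E * h s)%E.
    rewrite (_ : h s = \int[lebesgue_rV m]_(y in box a' b')
      (grad2 (fun z => u (rv_cons (s, z))) y)%:E)%E; first exact Hc.
    by apply: eq_integral => y _; rewrite gSE.
  apply: (@le_trans _ _ (C%:E * h s * l%:E)%E).
    by apply: lee_wpmul2r => //; rewrite lee_fin ltW.
  rewrite -muleA [(h s * _)%E]muleC (mulrC 2) EFinM -muleA lee_wpmul2l ?lee_fin//.
  by apply: (le_trans hs); rewrite lee_wpmul2l.
apply: (@le_trans _ _ (2%:E * ((8 * l ^+ 2)%:E * E) + 2%:E * ((2 * C)%:E * E))%E); last first.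
  have c1 : 0 <= 2 * (8 * l ^+ 2) by rewrite !mulr_ge0// ltW.
  have c2 : 0 <= 2 * (2 * C) by rewrite !mulr_ge0.
  rewrite !muleA -!EFinM -ge0_muleDl ?lee_fin// -EFinD.
  by have -> : 2 * (8 * l ^+ 2) + 2 * (2 * C) = 16 * l ^+ 2 + 4 * C by ring.
apply: (@le_trans _ _ (2%:E * \int[lebesgue_rV m.+1]_(x in box a b) ((u x - w x) ^+ 2)%:E +
  2%:E * \int[lebesgue_rV m.+1]_(x in box a b) ((w x - c) ^+ 2)%:E)%E); last first.
  by apply: leeD; apply: lee_wpmul2l.
apply: integral_le_lin2 => // x _; rewrite ?sqr_ge0//.
rewrite -subr_ge0 (_ : _ - _ = (u x - 2 * w x + c) ^+ 2) ?sqr_ge0//; ring.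
Qed.

End box_poincare.

(** * The divergence theorem on a box *)

Section divergence.
Context {R : realType}.
Local Notation rV n := (borel (M := 'rV[R]_n)).

(** A component of a vector field needs only its own partial derivative for the
    divergence theorem. *)
Definition C1_dir n (U : set 'rV[R]_n) i (F f : 'rV[R]_n -> R) :=
  (forall x, U x -> is_derive x (delta_mx 0 i) F (f x)) /\
  (forall x, U x -> {for x, continuous f}).

Lemma is_derive_rv_cons0 m (u : 'rV[R]_m.+1 -> R) t y du :
  is_derive (rv_cons (t, y)) (delta_mx 0 0) u du ->
  is_derive t 1 (fun s => u (rv_cons (s, y))) du.
Proof.
by move=> [d1 d2]; have [e1 e2] := derive_rv_cons0 u t y; split; [exact: e1.1|rewrite -e2].
Qed.

Lemma is_derive_rv_consS m (u : 'rV[R]_m.+1 -> R) t y j du :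
  is_derive (rv_cons (t, y)) (delta_mx 0 (lift ord0 j)) u du ->
  is_derive y (delta_mx 0 j) (fun z => u (rv_cons (t, z))) du.
Proof.
by move=> [d1 d2]; have [e1 e2] := derive_rv_consS u t y j; split; [exact: e1.1|rewrite -e2].
Qed.

(** Integration of a partial derivative of a function that vanishes on the two
    faces in question. The constant K makes the integrand nonnegative, so that
    only the iterated integrals of nonnegative functions are used. *)
Lemma integral_partial_box n (a b : 'rV[R]_n) U i F f (K : R) :
  (forall i, a 0 i < b 0 i) -> open U -> box a b `<=` U -> C1_dir U i F f ->
  (forall x, box a b x -> x 0 i = a 0 i \/ x 0 i = b 0 i -> F x = 0) ->
  0 <= K -> (forall x, box a b x -> 0 <= f x + K) ->
  (\int[lebesgue_rV n]_(x in box a b) (f x + K)%:E =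
   \int[lebesgue_rV n]_(x in box a b) K%:E)%E.
Proof.
elim: n a b U i F f => [|m ih] a b U i F f ab oU BU [dF cf] F0 K0 fK0; first by case: i {dF F0}.
have cfK x : U x -> {for x, continuous (fun x => f x + K)}.
  by move=> Ux; apply: continuousD; [exact: cf|exact: cst_continuous].
have mfK : measurable_fun (box a b : set (rV m.+1)) (fun x => (f x + K)%:E).
  apply/measurable_EFinP.
  exact: (continuous_measurable_sub oU BU (measurable_box a b) cfK).
have mK : measurable_fun (box a b : set (rV m.+1)) (fun=> K%:E).
  exact: measurable_cst.
have K0' x : box a b x -> (0 <= K%:E)%E by rewrite lee_fin.
pose a' := (rv_split a).2; pose b' := (rv_split b).2.
have ab' j : a' 0 j < b' 0 j by rewrite !mxE.
case: (unliftP ord0 i) dF F0 => [j|] -> dF F0.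
  rewrite (integral_box_cons mfK fK0) (integral_box_cons mK K0').
  apply: eq_integral => t /[!inE]/=; rewrite in_itv/= => tI.
  apply: (ih _ _ _ _ (fun y => F (rv_cons (t, y))) _ ab' (open_slice (t := t) oU)) => //.
  - by move=> y yB; apply: BU; apply/box_cons.
  - split=> y Uy.
      exact: (is_derive_rv_consS (dF _ Uy)).
    apply: (@continuous_comp _ _ _ (fun z => rv_cons (t, z)) f).
      exact: continuous_rv_cons2.
    exact: cf.
  - move=> y yB yi; apply: F0; first by apply/box_cons.
    rewrite rv_consS/=; move: yi; rewrite !mxE.
    by rewrite (_ : rshift 1 j = lift ord0 j)//; exact: val_inj.
  - by move=> y yB; apply: fK0; apply/box_cons.
rewrite (integral_box_cons_swap mfK fK0) (integral_box_cons_swap mK K0').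
apply: eq_integral => y /[!inE] yB.
have dI t : a 0 0 <= t <= b 0 0 ->
    is_derive t 1 (fun t => F (rv_cons (t, y)) + K * t) (f (rv_cons (t, y)) + K).
  move=> tI; have Ut : U (rv_cons (t, y)) by apply: BU; apply/box_cons.
  have dFt : is_derive t 1 (fun t => F (rv_cons (t, y))) (f (rv_cons (t, y))).
    exact: (is_derive_rv_cons0 (dF _ Ut)).
  by apply: is_derive_eq; rewrite /GRing.scale/= mulr1.
rewrite (C1_integral (ab 0) dI); last first.
  move=> t tI; apply: (@continuous_comp _ _ _ (fun s => rv_cons (s, y)) (fun x => f x + K)).
    exact: continuous_rv_cons1.
  by apply: cfK; apply: BU; apply/box_cons.
have aI : a 0 0 <= a 0 0 <= b 0 0 by rewrite lexx ltW.
have bI : a 0 0 <= b 0 0 <= b 0 0 by rewrite lexx ltW.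
rewrite !F0; last 4 first.
- by apply/box_cons.
- by rewrite rv_cons0; left.
- by apply/box_cons.
- by rewrite rv_cons0; right.
rewrite (integral_cst _ _ K%:E)// [X in (_ * X)%E](lebesgue_measure_cc (ab 0)) -EFinM.
by congr EFin; ring.
Qed.

(** The integral of the divergence of F vanishes, so a pointwise bound of B - D
    by this divergence compares the integrals of B and D. *)
Lemma divergence_box_le n (a b : 'rV[R]_n) U (F f : 'I_n -> 'rV[R]_n -> R) (B D : 'rV[R]_n -> R) :
  (forall i, a 0 i < b 0 i) -> open U -> box a b `<=` U ->
  (forall i, C1_dir U i (F i) (f i)) ->
  (forall i x, box a b x -> x 0 i = a 0 i \/ x 0 i = b 0 i -> F i x = 0) ->
  measurable_fun (box a b : set (rV n)) B -> measurable_fun (box a b : set (rV n)) D ->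
  (forall x, box a b x -> 0 <= B x) -> (forall x, box a b x -> 0 <= D x) ->
  (forall x, box a b x -> B x <= \sum_i f i x + D x) ->
  (\int[lebesgue_rV n]_(x in box a b) (B x)%:E <=
   \int[lebesgue_rV n]_(x in box a b) (D x)%:E)%E.
Proof.
move=> ab oU BU CF F0 mB mD B0 D0 BD.
have mbox : measurable (box a b : set (rV n)) by exact: measurable_box.
have /choice[K HK] : forall i, exists K : R,
    0 <= K /\ forall x, box a b x -> 0 <= f i x + K.
  move=> i; have [x0 _ x0min] : exists2 c, c \in box a b &
      forall t, t \in box a b -> f i c <= f i t.
    apply: EVT_min_rV; [|exact: compact_box|].
      by exists a => j; rewrite lexx ltW.
    by apply: continuous_in_subspaceT => x /set_mem/BU; exact: (CF i).2.
  exists `|f i x0|; split=> // x xB.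
  by have := x0min x (mem_set xB); have := ler_norm (- f i x0); rewrite normrN; lra.
have mf i : measurable_fun (box a b : set (rV n)) (fun x => f i x + K i).
  apply: (continuous_measurable_sub oU) => // x Ux.
  by apply: continuousD; [exact: (CF i).2|exact: cst_continuous].
pose SK := \sum_i K i.
have SK0 : 0 <= SK by apply: sumr_ge0 => i _; have [] := HK i.
have IK : (\int[lebesgue_rV n]_(x in box a b) (\sum_i (f i x + K i))%:E =
    \int[lebesgue_rV n]_(x in box a b) SK%:E)%E.
  under eq_integral do rewrite -sumEFin.
  rewrite ge0_integral_sum//; last 2 first.
  - by move=> i; exact/measurable_EFinP.
  - by move=> i x xB; rewrite lee_fin; apply: (HK i).2.
  under [RHS]eq_integral do rewrite /SK -sumEFin.
  rewrite ge0_integral_sum//; last by move=> i x xB; rewrite lee_fin (HK i).1.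
  apply: eq_bigr => i _.
  exact: (integral_partial_box ab oU BU (CF i) (F0 i) (HK i).1 (HK i).2).
have /andP[_ boxoo] := lebesgue_box ab.
have SKfin : (\int[lebesgue_rV n]_(x in box a b) SK%:E)%E \is a fin_num.
  rewrite (integral_cst _ _ SK%:E)// fin_numM//.
  by rewrite ge0_fin_numE.
rewrite -(leeD2rE _ _ SKfin) -[in leRHS]IK [in leRHS]addeC.
have mSf : measurable_fun (box a b : set (rV n)) (fun x => \sum_i (f i x + K i)).
  exact: measurable_sum.
have Sf0 x : box a b x -> 0 <= \sum_i (f i x + K i).
  by move=> xB; apply: sumr_ge0 => i _; exact: (HK i).2.
have /measurable_EFinP mBE := mB; have /measurable_EFinP mDE := mD.
have /measurable_EFinP mSfE := mSf.
have mSK : measurable_fun (box a b : set (rV n)) (fun=> SK%:E) by [].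
have SK0E x : box a b x -> (0 <= SK%:E)%E by rewrite lee_fin.
have B0E x : box a b x -> (0 <= (EFin \o B) x)%E by rewrite /= lee_fin; exact: B0.
have D0E x : box a b x -> (0 <= (EFin \o D) x)%E by rewrite /= lee_fin; exact: D0.
have Sf0E x : box a b x -> (0 <= (EFin \o (fun x => \sum_i (f i x + K i))%R) x)%E.
  by rewrite /= lee_fin; exact: Sf0.
rewrite -(ge0_integralD _ mbox B0E mBE SK0E mSK) -(ge0_integralD _ mbox Sf0E mSfE D0E mDE).
apply: ge0_le_integral => //.
- by move=> x xB; rewrite -EFinD lee_fin addr_ge0// B0.
- exact: emeasurable_funD.
- exact: emeasurable_funD.
- by move=> x xB; rewrite -!EFinD lee_fin big_split/= addrAC lerD2r BD.
Qed.

End divergence.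

(** * Radial weights of the cusp *)

Section radial.
Context {R : realType}.
Implicit Types z w : R.

(** All radial functions take the squared radius z as argument: z is smooth, and
    z + e regularizes it at the origin. *)
Definition rad_log z : R := 1 - ln (Num.sqrt z).
(** The model metric is [cusp_scale]^-2 times the Euclidean one. *)
Definition cusp_scale z : R := Num.sqrt z * rad_log z.

Lemma rad_log_ge1 z : 0 < z <= 1 -> 1 <= rad_log z.
Proof.
move=> /andP[z0 z1]; rewrite /rad_log lerBrDr gerDl.
by rewrite ln_le0// -sqrtr1 ler_wsqrtr.
Qed.

Lemma mul_1Bln_le1 z : 0 < z -> z * (1 - ln z) <= 1.
Proof.
move=> z0; rewrite mulrC -ler_pdivlMr// mul1r.
have : ln (1 + (z^-1 - 1)) <= z^-1 - 1.
  by rewrite le_ln1Dx// ltrBrDl subrr invr_gt0.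
rewrite addrC subrK lnV ?posrE//; lra.
Qed.

Lemma cusp_scale_gt0 z : 0 < z <= 1 -> 0 < cusp_scale z.
Proof.
move=> zz; rewrite mulr_gt0 ?(lt_le_trans ltr01 (rad_log_ge1 zz))//.
by rewrite sqrtr_gt0; case/andP: zz.
Qed.

Lemma cusp_scale_le1 z : 0 < z -> cusp_scale z <= 1.
Proof. by move=> z0; rewrite /cusp_scale mul_1Bln_le1// sqrtr_gt0. Qed.

(** Monotonicity, which makes the regularized weights increase to the true ones,
    comes down to t (1 - ln t) <= 1 for the ratio t of the radii. *)
Lemma cusp_scale_le z w : 0 < z -> z <= w -> w <= 1 -> cusp_scale z <= cusp_scale w.
Proof.
move=> z0 zw w1; have w0 := lt_le_trans z0 zw.
rewrite /cusp_scale /rad_log.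
have rw0 : 0 < Num.sqrt w by rewrite sqrtr_gt0.
have rz0 : 0 < Num.sqrt z by rewrite sqrtr_gt0.
set t := Num.sqrt z / Num.sqrt w.
have t0 : 0 < t by rewrite divr_gt0.
have t1 : t <= 1 by rewrite ler_pdivrMr// mul1r ler_wsqrtr.
have -> : Num.sqrt z = Num.sqrt w * t by rewrite mulrC divfK// gt_eqF.
rewrite lnM ?posrE// -mulrA ler_pM2l//.
have := mul_1Bln_le1 t0.
have : ln (Num.sqrt w) <= 0 by rewrite ln_le0// -sqrtr1 ler_wsqrtr.
nra.
Qed.

(** In dimension n = k+2 and without regularization, x times this function is
    the radial field of divergence (n-1) P^-n, with P = [cusp_scale]. *)
Definition flux k z : R := (Num.sqrt z ^+ k.+2 * rad_log z ^+ k.+1)^-1.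
(** P^-n: the volume density of the model for n the dimension, and its energy
    density for n replaced by n - 2. *)
Definition cusp_weight n z : R := (cusp_scale z ^+ n)^-1.

Lemma is_derive_flux k z : 0 < z <= 1 ->
  is_derive z 1 (flux k)
    ((2 * z)^-1 * (k.+1%:R * cusp_weight k.+2 z - k.+2%:R * flux k z)).
Proof.
move=> zz; have /andP[z0 z1] := zz.
have r0 : 0 < Num.sqrt z by rewrite sqrtr_gt0.
have L0 := lt_le_trans ltr01 (rad_log_ge1 zz).
have dr := is_derive1_sqrt z0.
have dln := is_derive1_ln r0.
have dlnr : is_derive z 1 (fun z => ln (Num.sqrt z)) ((Num.sqrt z)^-1 * (2 * Num.sqrt z)^-1) := is_derive1_comp dln dr.
have dL : is_derive z 1 rad_log (- ((Num.sqrt z)^-1 * (2 * Num.sqrt z)^-1)).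
  rewrite (_ : rad_log = cst 1 - (fun z => ln (Num.sqrt z))); last exact/funext.
  by apply: is_derive_eq; rewrite sub0r.
have dM : is_derive z 1 (fun z => Num.sqrt z ^+ k.+2 * rad_log z ^+ k.+1)
    (k.+2%:R * Num.sqrt z ^+ k.+1 * (2 * Num.sqrt z)^-1 * rad_log z ^+ k.+1
     - Num.sqrt z ^+ k.+2 * (k.+1%:R * rad_log z ^+ k * ((Num.sqrt z)^-1 * (2 * Num.sqrt z)^-1))).
  rewrite (_ : (fun _ => _) = (Num.sqrt : R -> R) ^+ k.+2 * rad_log ^+ k.+1); last first.
    by apply/funext => y; rewrite !fctE.
  apply: is_derive_eq; rewrite /GRing.scale/= !fctE; ring.
have nz : Num.sqrt z ^+ k.+2 * rad_log z ^+ k.+1 != 0.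
  by rewrite mulf_neq0// expf_neq0// gt_eqF.
apply: is_derive_eq; first exact: is_deriveV.
rewrite /GRing.scale/= /flux /cusp_weight /cusp_scale.
have -> : (2 * z)^-1 = (2 * Num.sqrt z ^+ 2)^-1 by rewrite sqr_sqrtr// ltW.
set r := Num.sqrt z; set L := rad_log z.
have rn0 : r != 0 by rewrite gt_eqF.
have Ln0 : L != 0 by rewrite gt_eqF.
have rkn0 : r ^+ k != 0 by rewrite expf_neq0.
have Lkn0 : L ^+ k != 0 by rewrite expf_neq0.
rewrite (exprMn k.+2 r) !(exprS _ k.+1) !(exprS _ k).
by field; rewrite rn0 Ln0 rkn0 Lkn0.
Qed.

End radial.

Section directional.
Context {R : realType}.

(** Chain rule for one directional derivative, without differentiability of the
    inner function in the other directions. *)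
Lemma is_derive_comp_dir (V : normedModType R) (q : V -> R) (g : R -> R) x v dq dg :
  is_derive x v q dq -> is_derive (q x) 1 g dg ->
  is_derive x v (fun y => g (q y)) (dg * dq).
Proof.
move=> [q1 q2] Dg.
pose ql (h : R) := q (h *: v + x).
have ql0 : ql 0 = q x by rewrite /ql scale0r add0r.
have Dql : is_derive (0 : R) 1 ql dq.
  split; first exact: ((derivable1P q x v).1 q1).
  rewrite -q2 /derive; 
  suff -> : (fun h : R => h^-1 *: (ql (h *: (1 : R) + 0) - ql 0)) =
    (fun h : R => h^-1 *: (q (h *: v + x) - q x)) by [].
  apply/funext => h; by rewrite /ql scale0r add0r addr0 [h *: (1 : R)]mulr1.
have Dg' : is_derive (ql 0) 1 g dg by rewrite ql0.
have [D1 D2] := is_derive1_comp Dg' Dql.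
split; first exact: ((derivable1P (fun y => g (q y)) x v).2 D1).
rewrite -D2 /derive;
suff -> : (fun h : R => h^-1 *: (g (q (h *: v + x)) - g (q x))) =
  (fun h : R => h^-1 *: ((g \o ql) (h *: (1 : R) + 0) - (g \o ql) 0)) by [].
apply/funext => h; by rewrite /= /ql scale0r add0r addr0 [h *: (1 : R)]mulr1.
Qed.

Lemma is_derive_coord n (x : 'rV[R]_n) i j :
  is_derive x (delta_mx 0 i) (fun y : 'rV[R]_n => y 0 j) (i == j)%:R.
Proof.
have -> : (i == j)%:R = (delta_mx 0 i : 'rV[R]_n) 0 j by rewrite mxE eqxx eq_sym.
have did : derivable (@id 'rV[R]_n) x (delta_mx 0 i) by exact: derivable_id.
split; first by move/derivable_mxP : did => /(_ 0 j).
by have := derive_mx did; rewrite derive_id => /matrixP/(_ 0 j); rewrite !mxE => <-.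
Qed.

Definition sqnorm n (x : 'rV[R]_n) : R := \sum_i x 0 i ^+ 2.

Lemma sqnorm_ge0 n (x : 'rV[R]_n) : 0 <= sqnorm x.
Proof. by apply: sumr_ge0 => i _; exact: sqr_ge0. Qed.

Lemma sqnormE n (v : 'rV[R]_n) : sqnorm v = (v *m v^T) 0 0.
Proof. by rewrite mxE; apply: eq_bigr => i _; rewrite mxE expr2. Qed.

Lemma sqnorm_eq0 n (v : 'rV[R]_n) : (sqnorm v == 0) = (v == 0).
Proof.
apply/eqP/eqP => [q0|->]; last by rewrite sqnormE mul0mx mxE.
apply/rowP => i; rewrite mxE; apply/eqP.
have /eqP := q0; rewrite psumr_eq0; last by move=> j _; exact: sqr_ge0.
by move=> /allP/(_ i (mem_index_enum _)); rewrite sqrf_eq0.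
Qed.

Lemma enormE n (x : 'rV[R]_n) : enorm x = Num.sqrt (sqnorm x).
Proof. by []. Qed.

Lemma is_derive_sqnorm n (x : 'rV[R]_n) i :
  is_derive x (delta_mx 0 i) (@sqnorm n) (2 * x 0 i).
Proof.
have dj j : is_derive x (delta_mx 0 i) (fun y : 'rV[R]_n => y 0 j ^+ 2) ((i == j)%:R * (2 * x 0 i)).
  have dc := is_derive_coord x i j.
  apply: is_derive_eq; rewrite /GRing.scale/=.
  case: eqP => [->|_] /=; rewrite ?mulr1 ?mulr0 ?mul1r ?mul0r ?addr0//.
  by rewrite mulrDl mul1r.
rewrite (_ : @sqnorm n = \sum_j (fun y : 'rV[R]_n => y 0 j ^+ 2)); last first.
  by apply/funext => y; rewrite fct_sumE.
apply: is_derive_eq.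
rewrite (bigD1 i)//= eqxx mul1r big1 ?addr0// => j /negbTE.
by rewrite eq_sym => ->; rewrite mul0r.
Qed.

Lemma continuous_sqnorm n (x : 'rV[R]_n) : {for x, continuous (@sqnorm n)}.
Proof.
rewrite (_ : @sqnorm n = \sum_j (fun y : 'rV[R]_n => y 0 j ^+ 2)); last first.
  by apply/funext => y; rewrite fct_sumE.
elim/big_ind: _ => [|f g cf cg|j _]; first exact: cst_continuous.
  exact: continuousD.
by apply: cont_sqr; exact: coord_continuous.
Qed.

End directional.

Section pointwise.
Context {R : realType}.

(** The divergence of the truncated field in terms of numbers: q = |x|^2,
    z = q + e, T = sum x_i^2 (1 - x_i^2 / s2), N + 1 the dimension, G the flux
    and W the weight P^-n. Since T <= z, the expression is a convex combination
    of (N + 1) G and N W, both at least W, minus an error due to the cutoff,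
    which is small compared with W when r is small compared with s2. *)
Lemma divergence_lower_bound (s2 q T z r W G N : R) :
  0 < s2 -> 0 <= q -> q <= z -> 0 < z -> 0 <= T -> T <= q -> 0 < W -> W <= G ->
  1 <= N -> z * G <= r * W ->
  W - 3 * r / s2 * W <=
  (N + 1) * G - 3 * q / s2 * G + 2 * T * ((2 * z)^-1 * (N * W - (N + 1) * G)).
Proof.
move=> s0 q0 qz z0 T0 Tq W0 WG N1 zG.
pose th := T / z.
have th0 : 0 <= th by rewrite divr_ge0// ltW.
have th1 : th <= 1 by rewrite ler_pdivrMr// mul1r (le_trans Tq).
have -> : 2 * T * ((2 * z)^-1 * (N * W - (N + 1) * G)) = th * (N * W - (N + 1) * G).
  by rewrite /th; field; rewrite gt_eqF.
have h1 : q / s2 * G <= r / s2 * W.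
  rewrite mulrAC [leRHS]mulrAC ler_pM2r ?invr_gt0//.
  by apply: le_trans zG; rewrite ler_wpM2r// (le_trans (ltW W0)).
have h2 : (1 - th) * W <= (1 - th) * ((N + 1) * G).
  by rewrite ler_wpM2l ?subr_ge0//; nra.
have h3 : th * W <= th * (N * W) by rewrite ler_wpM2l//; nra.
have -> : 3 * r / s2 * W = 3 * (r / s2 * W) by ring.
have -> : 3 * q / s2 * G = 3 * (q / s2 * G) by ring.
lra.
Qed.

(** Young's inequality, with a free weight [al]. *)
Lemma cross_term_bound n (al g : R) (Y d : 'I_n -> R) : 0 < al ->
  - (al * g ^+ 2 * (\sum_i Y i ^+ 2) + al^-1 * \sum_i d i ^+ 2) <=
  \sum_i Y i * (2 * g * d i).
Proof.
move=> al0; rewrite !mulr_sumr -big_split/= -sumrN; apply: ler_sum => i _.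
have : 0 <= al^-1 * (al * g * Y i + d i) ^+ 2.
  by rewrite mulr_ge0 ?sqr_ge0// invr_ge0 ltW.
have -> : al^-1 * (al * g * Y i + d i) ^+ 2 =
  al * g ^+ 2 * Y i ^+ 2 + al^-1 * d i ^+ 2 + Y i * (2 * g * d i).
  by field; rewrite gt_eqF.
lra.
Qed.

Lemma sqrt_sqrK (z : R) : 0 <= z -> Num.sqrt z * Num.sqrt z = z.
Proof. by move=> z0; rewrite -expr2 sqr_sqrtr. Qed.

Lemma cusp_weight_gt0 n (z : R) : 0 < z <= 1 -> 0 < cusp_weight n z.
Proof. by move=> zz; rewrite invr_gt0 exprn_gt0// cusp_scale_gt0. Qed.

Lemma fluxE k (z : R) : 0 < z <= 1 -> flux k z = rad_log z * cusp_weight k.+2 z.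
Proof.
move=> zz; rewrite /flux /cusp_weight /cusp_scale exprMn (exprS (rad_log z) k.+1) (exprS (rad_log z) k) 2!(exprS (Num.sqrt z)).
have L0 := lt_le_trans ltr01 (rad_log_ge1 zz).
have r0 : 0 < Num.sqrt z by rewrite sqrtr_gt0; case/andP: zz.
have a0 : Num.sqrt z ^+ k != 0 by rewrite expf_neq0// gt_eqF.
have b0 : rad_log z ^+ k != 0 by rewrite expf_neq0// gt_eqF.
by field; rewrite a0 b0 !gt_eqF.
Qed.

Lemma cusp_weight_le_flux k (z : R) : 0 < z <= 1 -> cusp_weight k.+2 z <= flux k z.
Proof.
move=> zz; rewrite fluxE// ler_peMl ?(ltW (cusp_weight_gt0 _ zz))//.
exact: rad_log_ge1.
Qed.

Lemma mul_flux_le k (z : R) : 0 < z <= 1 ->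
  z * flux k z <= Num.sqrt z * cusp_weight k.+2 z.
Proof.
move=> zz; have /andP[z0 _] := zz.
rewrite fluxE// -{1}(sqrt_sqrK (ltW z0)) mulrA ler_wpM2r//.
  exact: ltW (cusp_weight_gt0 _ _).
rewrite -mulrA -/(cusp_scale z) -[leRHS]mulr1 ler_wpM2l ?sqrtr_ge0//.
exact: cusp_scale_le1.
Qed.

(** Since |x|^2 <= z, this is the length of the radial field: |Y| <= P P^-n. *)
Lemma mul_flux2 k (z : R) : 0 < z <= 1 ->
  z * flux k z ^+ 2 = cusp_scale z ^+ 2 * cusp_weight k.+2 z ^+ 2.
Proof.
move=> zz; have /andP[z0 _] := zz.
rewrite fluxE// -{1}(sqrt_sqrK (ltW z0)) /cusp_scale; ring.
Qed.

(** The energy density carries two powers of P less than the volume because the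
    inverse metric is P^2 times the Euclidean one. *)
Lemma cusp_scale2_weight k (z : R) : 0 < z <= 1 ->
  cusp_scale z ^+ 2 * cusp_weight k.+2 z = cusp_weight k z.
Proof.
move=> zz; rewrite /cusp_weight !(exprS _ k.+1) (exprS _ k) expr2.
have P0 : cusp_scale z != 0 by rewrite gt_eqF// cusp_scale_gt0.
have Pk0 : cusp_scale z ^+ k != 0 by rewrite expf_neq0.
by field; rewrite P0 Pk0.
Qed.

Lemma cusp_weight_le_sqrt n (z : R) : 0 < z <= 1 ->
  cusp_weight n z <= (Num.sqrt z ^+ n)^-1.
Proof.
move=> zz; have /andP[z0 _] := zz; have r0 : 0 < Num.sqrt z by rewrite sqrtr_gt0.
rewrite lef_pV2 ?posrE ?exprn_gt0 ?cusp_scale_gt0//.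
apply: lerXn2r; rewrite ?nnegrE ?(ltW r0) ?(ltW (cusp_scale_gt0 zz))//.
by rewrite /cusp_scale ler_peMr ?(ltW r0)// rad_log_ge1.
Qed.

Lemma cusp_weight_le n (z w : R) : 0 < z -> z <= w -> w <= 1 ->
  cusp_weight n w <= cusp_weight n z.
Proof.
move=> z0 zw w1; have zz : 0 < z <= 1 by rewrite z0 (le_trans zw).
have ww : 0 < w <= 1 by rewrite (lt_le_trans z0).
rewrite lef_pV2 ?posrE ?exprn_gt0 ?cusp_scale_gt0//.
apply: lerXn2r; rewrite ?nnegrE ?(ltW (cusp_scale_gt0 zz)) ?(ltW (cusp_scale_gt0 ww))//.
exact: cusp_scale_le.
Qed.

End pointwise.

Section flux_continuity.
Context {R : realType}.

Lemma continuous_rad_log (z : R) : 0 < z -> {for z, continuous rad_log}.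
Proof.
move=> z0.
have c1 : {for z, continuous (cst 1 : R -> R)} by exact: cst_continuous.
have c2 : {for z, continuous (fun z => ln (Num.sqrt z))}.
  have r0 : 0 < Num.sqrt z by rewrite sqrtr_gt0.
  have c := continuous_comp (sqrt_continuous (x := z)) (continuous_ln r0).
  exact: c.
exact: (continuousB c1 c2).
Qed.

Lemma continuous_exprn (T : topologicalType) (f : T -> R) n x :
  {for x, continuous f} -> {for x, continuous (fun y => f y ^+ n)}.
Proof.
by move=> cf; apply: (@continuous_comp _ _ _ f (fun z => z ^+ n)) => //; exact: exprn_continuous.
Qed.

Lemma continuous_cusp_scale (z : R) : 0 < z -> {for z, continuous cusp_scale}.
Proof.
move=> z0.
have c1 : {for z, continuous (@Num.sqrt R)} by exact: sqrt_continuous.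
exact: (continuousM c1 (continuous_rad_log z0)).
Qed.

Lemma continuous_cusp_weight n (z : R) : 0 < z <= 1 ->
  {for z, continuous (cusp_weight n)}.
Proof.
move=> zz; have /andP[z0 _] := zz; rewrite /cusp_weight; apply: (@continuousV _ _ (fun z => cusp_scale z ^+ n)).
  by rewrite expf_neq0// gt_eqF// cusp_scale_gt0.
by apply: continuous_exprn; exact: continuous_cusp_scale.
Qed.

Lemma continuous_flux k (z : R) : 0 < z <= 1 -> {for z, continuous (flux k)}.
Proof.
move=> /(is_derive_flux k)[/derivable1_diffP d _]; exact: differentiable_continuous.
Qed.

End flux_continuity.

(** * The Hardy inequality at a puncture *)

Section hardy.
Context {R : realType}.
Local Notation rV n := (borel (M := 'rV[R]_n)).

Definition cbox n (s : R) : set 'rV[R]_n := box (const_mx (- s)) (const_mx s).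
Arguments cbox : clear implicits.

Lemma cboxP n s (x : 'rV[R]_n) : cbox n s x <-> forall i, `|x 0 i| <= s.
Proof.
by split=> H i; have := H i; rewrite !mxE ler_norml.
Qed.

Lemma sqnorm_cbox n s (x : 'rV[R]_n) : cbox n s x -> sqnorm x <= n%:R * s ^+ 2.
Proof.
move=> /cboxP xs; apply: (@le_trans _ _ (\sum_(i < n) s ^+ 2)).
  apply: ler_sum => i _; rewrite -(real_normK (num_real (x 0 i))).
  by apply: lerXn2r; rewrite ?nnegrE// (le_trans _ (xs i)).
by rewrite sumr_const card_ord mulr_natl.
Qed.

Section hardy_eps.
Variables (k : nat) (s a e : R).
Local Notation n := k.+2.
Hypotheses (s0 : 0 < s) (ns : n%:R * s ^+ 2 <= 4^-1) (e0 : 0 < e)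
  (ae : n%:R * a ^+ 2 + e <= (s ^+ 2 / 12) ^+ 2).
Variables (U : set 'rV[R]_n) (u : 'rV[R]_n -> R) (c : R).
Hypotheses (oU : open U) (BU : cbox n s `<=` U) (Cu : C1_on U u).

Let z (x : 'rV[R]_n) := sqnorm x + e.
(** The factor 1 - x_i^2 / s^2 makes the i-th component of the field vanish on
    the two faces of the box that are orthogonal to it, so that the divergence
    theorem has no boundary term. *)
Let cutoff (x : 'rV[R]_n) i := x 0 i * (1 - x 0 i ^+ 2 / s ^+ 2).
Let Y (x : 'rV[R]_n) i := cutoff x i * flux k (z x).
Let dflux (w : R) := (2 * w)^-1 * (k.+1%:R * cusp_weight n w - n%:R * flux k w).
Let dY (x : 'rV[R]_n) i := (1 - 3 * (x 0 i ^+ 2 / s ^+ 2)) * flux k (z x)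
  + cutoff x i * (dflux (z x) * (2 * x 0 i)).
Let V := U `&` [set x | sqnorm x + e < 1].

Let s2_le1 : s ^+ 2 <= 8^-1.
Proof.
have n2 : 2 <= n%:R :> R by rewrite ler_nat.
have := sqr_ge0 s; move: ns; nra.
Qed.

Let e_le : e <= 144^-1.
Proof.
have := ae; have : 0 <= n%:R * a ^+ 2 by rewrite mulr_ge0 ?sqr_ge0.
have := s2_le1; have := sqr_ge0 s; rewrite expr_div_n; nra.
Qed.

Let oV : open V.
Proof.
apply: openI => //.
rewrite (_ : [set x | _] = (fun x => sqnorm x + e) @^-1` [set t | t < 1])//.
apply: open_comp; last exact: open_lt.
by move=> x _; apply: continuousD; [exact: continuous_sqnorm|exact: cst_continuous].
Qed.

Let zV x : V x -> 0 < z x <= 1.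
Proof. by move=> [_ /ltW ->]; rewrite andbT ltr_wpDl// sqnorm_ge0. Qed.

Let BV : cbox n s `<=` V.
Proof.
move=> x xB; split; first exact: BU.
by have := sqnorm_cbox xB; have := ns; have := e_le; rewrite /=; lra.
Qed.

Let dzi x i : is_derive x (delta_mx 0 i) z (2 * x 0 i).
Proof.
have d := is_derive_sqnorm x i.
rewrite (_ : z = @sqnorm R n + cst e); last exact/funext.
by apply: is_derive_eq; rewrite addr0.
Qed.

Let dYP x i : V x -> is_derive x (delta_mx 0 i) (fun x => Y x i) (dY x i).
Proof.
move=> Vx; have zx := zV Vx.
have dF := is_derive_comp_dir (dzi x i) (is_derive_flux k zx).
have dc := is_derive_coord x i i.
rewrite eqxx in dc.
have dcut : is_derive x (delta_mx 0 i) (fun x => cutoff x i) (1 - 3 * (x 0 i ^+ 2 / s ^+ 2)).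
  rewrite (_ : (fun _ => _) = (fun y : 'rV[R]_n => y 0 i) - (s ^+ 2)^-1 \*: (fun y : 'rV[R]_n => y 0 i) ^+ 3).
    by apply: is_derive_eq; rewrite /GRing.scale/= mulr1 [X in 1 - X]mulrC mulrA.
  apply/funext => y; transitivity (y 0 i - s ^- 2 * y 0 i ^+ 3); last by rewrite !fctE.
  rewrite /cutoff; ring.
rewrite (_ : (fun x => Y x i) = (fun x => cutoff x i) * (fun x => flux k (z x))); last exact/funext.
apply: is_derive_eq; rewrite /GRing.scale/= /dY /dflux; ring.
Qed.

Let cz x : {for x, continuous z}.
Proof. by apply: continuousD; [exact: continuous_sqnorm|exact: cst_continuous]. Qed.

Let cW j x : V x -> {for x, continuous (fun x => cusp_weight j (z x))}.
Proof.
move=> Vx; apply: (@continuous_comp _ _ _ z (cusp_weight j)); first exact: cz.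
exact/continuous_cusp_weight/zV.
Qed.

Let cflux x : V x -> {for x, continuous (fun x => flux k (z x))}.
Proof.
move=> Vx; apply: (@continuous_comp _ _ _ z (flux k)); first exact: cz.
exact/continuous_flux/zV.
Qed.

Let ccst (b : R) (x : 'rV[R]_n) : {for x, continuous (fun=> b)}.
Proof. exact: cst_continuous. Qed.

Let ccoord (i : 'I_n) (x : 'rV[R]_n) : {for x, continuous (fun y : 'rV[R]_n => y 0 i)}.
Proof. exact: coord_continuous. Qed.

Let cDs (f g : 'rV[R]_n -> R) x : {for x, continuous f} -> {for x, continuous g} ->
  {for x, continuous (fun y => f y + g y)}.
Proof. by move=> cf cg; exact: (continuousD cf cg). Qed.

Let cBs (f g : 'rV[R]_n -> R) x : {for x, continuous f} -> {for x, continuous g} ->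
  {for x, continuous (fun y => f y - g y)}.
Proof. by move=> cf cg; exact: (continuousB cf cg). Qed.

Let cMs (f g : 'rV[R]_n -> R) x : {for x, continuous f} -> {for x, continuous g} ->
  {for x, continuous (fun y => f y * g y)}.
Proof. by move=> cf cg; exact: (continuousM cf cg). Qed.

Let cY x i : V x -> {for x, continuous (fun x => Y x i)}.
Proof.
move=> Vx; apply: cMs; last exact: cflux.
apply: cMs => //; apply: cBs => //; apply: cMs => //.
exact: cont_sqr.
Qed.

Let cdY x i : V x -> {for x, continuous (fun x => dY x i)}.
Proof.
move=> Vx; apply: cDs; apply: cMs.
- by apply: cBs => //; apply: cMs => //; apply: cMs => //; exact: cont_sqr.
- exact: cflux.
- by apply: cMs => //; apply: cBs => //; apply: cMs => //; exact: cont_sqr.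
- apply: cMs; last exact: cMs.
  apply: cMs.
    apply: (@continuousV _ _ (fun x => 2 * z x)).
      by have /andP[z0 _] := zV Vx; rewrite mulf_neq0 ?gt_eqF.
    by apply: cMs => //; exact: cz.
  by apply: cBs; apply: cMs => //; [exact: cW|exact: cflux].
Qed.

Let g x := u x - c.
Let F i x := Y x i * g x ^+ 2.
Let f i x := dY x i * g x ^+ 2 + Y x i * (2 * g x * 'D_(delta_mx 0 i) u x).

Let cg x : V x -> {for x, continuous g}.
Proof. by move=> [Ux _]; apply: cBs => //; exact: Cu.1. Qed.

Let CF i : C1_dir V i (F i) (f i).
Proof.
split=> x Vx.
  have [Ux _] := Vx.
  have du : is_derive x (delta_mx 0 i) u ('D_(delta_mx 0 i) u x).
    by apply: derivableP; exact: (Cu.2 i).1.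
  have dg : is_derive x (delta_mx 0 i) g ('D_(delta_mx 0 i) u x).
    by rewrite (_ : g = u - cst c)//; apply: is_derive_eq; rewrite subr0.
  have dYx := dYP i Vx.
  rewrite (_ : F i = (fun x => Y x i) * g ^+ 2); last by apply/funext => y; rewrite !fctE.
  apply: is_derive_eq; rewrite /GRing.scale/= !fctE /f; ring.
apply: cDs; apply: cMs; first exact: cdY.
- by apply: cont_sqr; exact: cg.
- exact: cY.
- apply: cMs; first by apply: cMs => //; exact: cg.
  by have [Ux _] := Vx; exact: (Cu.2 i).2.
Qed.

Let F_bdry i x : cbox n s x -> x 0 i = (const_mx (- s) : 'rV[R]_n) 0 i \/ x 0 i = (const_mx s : 'rV[R]_n) 0 i -> F i x = 0.
Proof.
move=> _; rewrite !mxE /F /Y /cutoff => xi.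
have -> : x 0 i ^+ 2 = s ^+ 2 by case: xi => ->; rewrite ?sqrrN.
by rewrite divff ?subrr ?mulr0 ?mul0r// sqrf_eq0 gt_eqF.
Qed.

(** Bounds the error 3 r P^-n / s^2 of the cutoff outside the radius s^2 / 12, up
    to which this error is at most a quarter of P^-n. *)
Let D0 := 3 / s ^+ 2 * ((s ^+ 2 / 12) ^+ n)^-1.

Let s2gt0 : 0 < s ^+ 2. Proof. by rewrite exprn_gt0. Qed.

Let D0_ge0 : 0 <= D0.
Proof.
by rewrite mulr_ge0 ?divr_ge0 ?invr_ge0 ?exprn_ge0 ?divr_ge0// ltW.
Qed.

Let coord2_le x i : cbox n s x -> x 0 i ^+ 2 <= s ^+ 2.
Proof.
move=> /cboxP/(_ i) xs; rewrite -(real_normK (num_real (x 0 i))).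
by apply: lerXn2r; rewrite ?nnegrE// ltW.
Qed.

Let one_sub_ge0 x i : cbox n s x -> 0 <= 1 - x 0 i ^+ 2 / s ^+ 2 <= 1.
Proof.
move=> xB; rewrite subr_ge0 ler_pdivrMr// mul1r coord2_le//=.
by rewrite gerBl divr_ge0 ?sqr_ge0// ltW.
Qed.

Let sum_dY_ge x : cbox n s x ->
  cusp_weight n (z x) - 3 * Num.sqrt (z x) / s ^+ 2 * cusp_weight n (z x) <=
  \sum_i dY x i.
Proof.
move=> xB; have zx := zV (BV xB); have /andP[z0 _] := zx.
pose T := \sum_i x 0 i ^+ 2 * (1 - x 0 i ^+ 2 / s ^+ 2).
have T0 : 0 <= T.
  apply: sumr_ge0 => i _; rewrite mulr_ge0 ?sqr_ge0//.
  by have /andP[] := one_sub_ge0 i xB.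
have Tq : T <= sqnorm x.
  apply: ler_sum => i _; rewrite ler_piMr ?sqr_ge0//.
  by have /andP[] := one_sub_ge0 i xB.
have -> : \sum_i dY x i =
    (k.+1%:R + 1) * flux k (z x) - 3 * sqnorm x / s ^+ 2 * flux k (z x)
    + 2 * T * ((2 * z x)^-1 * (k.+1%:R * cusp_weight n (z x) - (k.+1%:R + 1) * flux k (z x))).
  rewrite /dY big_split/= natr1; congr (_ + _); last first.
    rewrite -/(dflux (z x)) /T mulr_sumr mulr_suml; apply: eq_bigr => i _.
    by rewrite /cutoff; move: (dflux _) => dz; ring.
  rewrite -mulr_suml -mulrBl; congr (_ * _).
  rewrite sumrB sumr_const card_ord; congr (_ - _).
  by rewrite -mulr_sumr -mulr_suml mulrA.
apply: divergence_lower_bound => //.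
- exact: sqnorm_ge0.
- by rewrite /z lerDl ltW.
- exact: cusp_weight_gt0.
- exact: cusp_weight_le_flux.
- by rewrite ler1n.
- exact: mul_flux_le.
Qed.

Let sum_dY_ge' x : cbox n s x ->
  3 / 4 * cusp_weight n (z x) <= \sum_i dY x i + D0 * \1_(~` cbox n a) x.
Proof.
move=> xB; have zx := zV (BV xB); have /andP[z0 z1] := zx.
have W0 := cusp_weight_gt0 n zx.
have r0 : 0 < Num.sqrt (z x) by rewrite sqrtr_gt0.
apply: le_trans (lerD (sum_dY_ge xB) (lexx _)).
have [rs|sr] := leP (Num.sqrt (z x)) (s ^+ 2 / 12).
  have : 3 * Num.sqrt (z x) / s ^+ 2 <= 1 / 4.
    by rewrite ler_pdivrMr//; lra.
  move=> /(ler_wpM2r (ltW W0)).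
  have : 0 <= D0 * \1_(~` cbox n a) x by rewrite mulr_ge0// indicE ler0n.
  lra.
have -> : \1_(~` cbox n a) x = 1 :> R.
  rewrite indicE mem_set// => xa.
  have : z x <= (s ^+ 2 / 12) ^+ 2.
    by apply: le_trans ae; rewrite /z lerD2r sqnorm_cbox.
  have s12 : 0 <= s ^+ 2 / 12 by rewrite divr_ge0// ltW.
  move/ler_wsqrtr; rewrite sqrtr_sqr (ger0_norm s12) => le_rs.
  by have := le_lt_trans le_rs sr; rewrite ltxx.
rewrite mulr1.
have : 3 * Num.sqrt (z x) / s ^+ 2 * cusp_weight n (z x) <= D0.
  rewrite /D0 ler_pM ?(ltW W0)//.
  - by rewrite mulr_ge0 ?invr_ge0 ?(ltW s2gt0)// mulr_ge0// ltW.
  - rewrite ler_pM2r ?invr_gt0// -[leRHS]mulr1 ler_pM2l//.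
    by rewrite -sqrtr1 ler_wsqrtr.
  apply: (le_trans (cusp_weight_le_sqrt n zx)).
  rewrite lef_pV2 ?posrE ?exprn_gt0 ?divr_gt0//.
  by apply: lerXn2r; rewrite ?nnegrE ?divr_ge0// ltW.
lra.
Qed.

Let sum_Y2_le x : cbox n s x ->
  \sum_i Y x i ^+ 2 <= cusp_scale (z x) ^+ 2 * cusp_weight n (z x) ^+ 2.
Proof.
move=> xB; have zx := zV (BV xB).
rewrite -mul_flux2//; apply: (@le_trans _ _ (sqnorm x * flux k (z x) ^+ 2)).
  rewrite /sqnorm mulr_suml; apply: ler_sum => i _.
  rewrite /Y exprMn ler_wpM2r ?sqr_ge0// /cutoff exprMn ler_piMr ?sqr_ge0//.
  by have /andP[t0 t1] := one_sub_ge0 i xB; rewrite expr_le1.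
by rewrite ler_wpM2r ?sqr_ge0// /z lerDl ltW.
Qed.

(** Divergence theorem for Y (u - c)^2. The divergence of Y supplies 3/4 of the
    weight, and Young's inequality spends 1/4 of it on the cross term with du. *)
Lemma hardy_eps :
  (\int[lebesgue_rV n]_(x in cbox n s)
     (2^-1 * cusp_weight n (sqnorm x + e) * (u x - c) ^+ 2)%:E <=
   \int[lebesgue_rV n]_(x in cbox n s)
     (D0 * (\1_(~` cbox n a) x * (u x - c) ^+ 2) +
      4 * (cusp_weight k (sqnorm x + e) * grad2 u x))%:E)%E.
Proof.
have mB : measurable (cbox n s : set (rV n)) by exact: measurable_box.
have ss i : (const_mx (- s) : 'rV[R]_n) 0 i < (const_mx s : 'rV[R]_n) 0 i.
  by rewrite !mxE gtrN.
have mV (h : 'rV[R]_n -> R) : (forall x, V x -> {for x, continuous h}) ->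
    measurable_fun (cbox n s : set (rV n)) h.
  exact: continuous_measurable_sub.
have mg2 : measurable_fun (cbox n s : set (rV n)) (fun x => (u x - c) ^+ 2).
  by apply: mV => x Vx; apply: cont_sqr; exact: cg.
have mgrad : measurable_fun (cbox n s : set (rV n)) (grad2 u).
  exact: C1_on_measurable_grad2 oU BU mB Cu.
apply: (divergence_box_le ss oV BV CF F_bdry).
- apply: measurable_funM => //; apply: measurable_funM => //.
  by apply: mV => x Vx; exact: cW.
- apply: measurable_funD; apply: measurable_funM => //; apply: measurable_funM => //.
    apply: measurable_funTS; apply: measurable_indic; apply: measurableC.
    exact: measurable_box.
  by apply: mV => x Vx; exact: cW.
- move=> x xB; rewrite mulr_ge0 ?sqr_ge0// mulr_ge0//.
  exact: ltW (cusp_weight_gt0 _ (zV (BV xB))).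
- move=> x xB; apply: addr_ge0; apply: mulr_ge0 => //; apply: mulr_ge0.
  + by rewrite indicE.
  + exact: sqr_ge0.
  + exact: ltW (cusp_weight_gt0 _ (zV (BV xB))).
  + exact: grad2_ge0.
move=> x xB; have zx := zV (BV xB); have W0 := cusp_weight_gt0 n zx.
have P0 := cusp_scale_gt0 zx.
rewrite -/(g x) -/(z x) /f big_split/= -mulr_suml.
(* The weight for which Young's inequality costs a quarter of P^-n. *)
pose al := (4 * cusp_scale (z x) ^+ 2 * cusp_weight n (z x))^-1.
have al0 : 0 < al by rewrite invr_gt0 mulr_gt0// pmulr_rgt0// exprn_gt0.
have := cross_term_bound (g x) (Y x) (fun i => 'D_(delta_mx 0 i) u x) al0.
rewrite -/(grad2 u x).
have -> : al^-1 = 4 * cusp_weight k (z x) by rewrite invrK -mulrA cusp_scale2_weight.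
have : al * g x ^+ 2 * (\sum_i Y x i ^+ 2) <= 4^-1 * cusp_weight n (z x) * g x ^+ 2.
  apply: (@le_trans _ _ (al * g x ^+ 2 * (cusp_scale (z x) ^+ 2 * cusp_weight n (z x) ^+ 2))).
    by rewrite ler_wpM2l ?sum_Y2_le// mulr_ge0 ?sqr_ge0// ltW.
  rewrite le_eqVlt; apply/orP; left; apply/eqP; rewrite /al.
  by field; rewrite !gt_eqF.
have := ler_wpM2r (sqr_ge0 (g x)) (sum_dY_ge' xB).
lra.
Qed.

End hardy_eps.
End hardy.
Arguments cbox {R} n s.

Section hardy_box.
Context {R : realType}.
Local Notation rV n := (borel (M := 'rV[R]_n)).

Lemma measurable_origin m : measurable ([set 0] : set (rV m)).
Proof.
apply: closed_borel; apply: compact_closed; first exact: norm_hausdorff.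
exact: compact_set1.
Qed.

Lemma lebesgue_rV_pt0 m : lebesgue_rV m.+1 [set (0 : 'rV[R]_m.+1)] = 0%E.
Proof.
have -> : [set (0 : 'rV[R]_m.+1)] = box 0 0.
  apply/seteqP; split=> [_ -> i|x x0] /=; first by rewrite !mxE lexx.
  by apply/rowP => i; apply/eqP; rewrite mxE eq_le andbC; have := x0 i; rewrite !mxE.
rewrite -[LHS]mul1e -(integral_cst _ (measurable_box 0 0)) integral_box_cons//.
by rewrite !mxE set_itv1 integral_set1.
Qed.

(** The weights of the cusp are singular at the origin, which has measure zero. *)
Lemma ge0_integral_setD0 m (B : set 'rV[R]_m.+1) (f : 'rV[R]_m.+1 -> \bar R) :
  measurable (B : set (rV m.+1)) -> measurable_fun (B : set (rV m.+1)) f ->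
  (forall x, B x -> 0 <= f x)%E ->
  (\int[lebesgue_rV m.+1]_(x in B) f x <= \int[lebesgue_rV m.+1]_(x in B `\ 0%R) f x)%E.
Proof.
move=> mB mf f0.
have m0 := @measurable_origin m.+1.
have mB0 : measurable (B `\ 0 : set (rV m.+1)) by exact: measurableD.
have mBI : measurable (B `&` [set 0] : set (rV m.+1)) by exact: measurableI.
rewrite -{1}(setUIDK B [set 0]) ge0_integral_setU//; last 3 first.
- by rewrite setUIDK.
- by rewrite setUIDK.
- by apply/disj_setPS => x [[_ x0] [_ nx0]].
rewrite (null_set_integral (N := (B `&` [set 0] : set (rV m.+1)))) ?add0e//.
- apply: (measurable_funS mB _ mf); exact: subIsetl.
- apply/eqP; rewrite eq_le measure_ge0 andbT -(lebesgue_rV_pt0 m).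
  by apply: le_measure; rewrite ?inE//; exact: subIsetr.
Qed.

Lemma measurable_cusp_weight n j (B : set 'rV[R]_n) : measurable (B : set (rV n)) ->
  (forall x, B x -> 0 < sqnorm x < 1) ->
  measurable_fun (B : set (rV n)) (fun x => cusp_weight j (sqnorm x)).
Proof.
move=> mB B01; pose U := [set x : 'rV[R]_n | 0 < sqnorm x < 1].
have oU : open U.
  rewrite (_ : U = (@sqnorm R n) @^-1` `]0, 1[%classic).
    by apply: open_comp => [x _|]; [exact: continuous_sqnorm|exact: itv_open].
  by apply/seteqP; split=> x; rewrite /U /preimage/= in_itv.
apply: (continuous_measurable_sub oU B01 mB) => x /andP[x0 x1].
apply: (@continuous_comp _ _ _ (@sqnorm R n) (cusp_weight j)).
  exact: continuous_sqnorm.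
by apply: continuous_cusp_weight; rewrite x0 ltW.
Qed.

(** Limit of [hardy_eps]: on the left by monotone convergence, on the right
    because the regularized weight is below the true one. The constant C does
    not depend on u and c. *)
Lemma hardy_box k (s : R) : 0 < s -> k.+2%:R * s ^+ 2 <= 4^-1 ->
  exists2 a : R, 0 < a < s & exists2 C : R, 0 <= C &
  forall U u (c : R), open U -> cbox k.+2 s `<=` U -> C1_on U u ->
  (\int[lebesgue_rV k.+2]_(x in cbox k.+2 s `\ 0%R)
      (cusp_weight k.+2 (sqnorm x) * (u x - c) ^+ 2)%:E <=
   C%:E * (\int[lebesgue_rV k.+2]_(x in cbox k.+2 s `\ 0%R)
             (cusp_weight k (sqnorm x) * grad2 u x)%:E +
           \int[lebesgue_rV k.+2]_(x in cbox k.+2 s `\` cbox k.+2 a)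
             ((u x - c) ^+ 2)%:E))%E.
Proof.
move=> s0; set n := k.+2 => ns.
have n2 : 2 <= n%:R :> R by rewrite ler_nat.
have s2_8 : s ^+ 2 <= 8^-1 by have := ler_wpM2r (sqr_ge0 s) n2; move: ns; lra.
have s_1 : s <= 1.
  by rewrite -(@ler_pXn2r _ 2) ?nnegrE ?(ltW s0)// expr1n; lra.
have s4 : 0 < (s ^+ 2 / 12) ^+ 2 by rewrite exprn_gt0// divr_gt0// exprn_gt0.
(* So small that cbox n a lies within the radius where the cutoff is harmless,
   with room for the regularization. *)
pose a := s ^+ 2 / (24 * n%:R).
have a0 : 0 < a by rewrite divr_gt0 ?exprn_gt0// mulr_gt0// (lt_le_trans _ n2).
have a_s : a < s.
  by rewrite ltr_pdivrMr ?mulr_gt0 ?(lt_le_trans _ n2)//; nra.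
have na2 : n%:R * a ^+ 2 <= (s ^+ 2 / 12) ^+ 2 / 2.
  have -> : n%:R * a ^+ 2 = (s ^+ 2 / 12) ^+ 2 / (4 * n%:R).
    by rewrite /a; field; rewrite gt_eqF// (lt_le_trans _ n2).
  rewrite ler_wpM2l ?(ltW s4)// lef_pV2 ?posrE//; lra.
exists a; first by rewrite a0.
pose D0 := 3 / s ^+ 2 * ((s ^+ 2 / 12) ^+ n)^-1.
have D0_ge0 : 0 <= D0.
  by rewrite mulr_ge0 ?divr_ge0 ?invr_ge0 ?exprn_ge0 ?divr_ge0// ltW// exprn_gt0.
exists (2 * D0 + 8); first by rewrite addr_ge0// mulr_ge0.
move=> U u c oU BU Cu.
have mB : measurable (cbox n s : set (rV n)) by exact: measurable_box.
have mBa : measurable (cbox n a : set (rV n)) by exact: measurable_box.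
have m0 := @measurable_origin n.
have mB0 : measurable (cbox n s `\ 0 : set (rV n)) by exact: measurableD.
have B0 x : (cbox n s `\ 0) x -> 0 < sqnorm x <= 4^-1.
  move=> [xB /eqP x0]; rewrite (le_trans (sqnorm_cbox xB))// andbT.
  by rewrite lt_neqAle sqnorm_ge0 andbT eq_sym sqnorm_eq0.
pose g x := u x - c.
pose e j := (s ^+ 2 / 12) ^+ 2 / 2 / j.+1%:R.
have e0 j : 0 < e j by rewrite !divr_gt0.
have e_le j : e j <= (s ^+ 2 / 12) ^+ 2 / 2.
  by rewrite ler_pdivrMr// ler_peMr ?ler1n// divr_ge0// ltW.
have ae j : n%:R * a ^+ 2 + e j <= (s ^+ 2 / 12) ^+ 2.
  by have := e_le j; move: na2; lra.
have e_4 j : e j <= 4^-1.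
  apply: (le_trans (e_le j)); have := s2_8; have := sqr_ge0 s; rewrite expr_div_n; nra.
have zB j x : cbox n s x -> 0 < sqnorm x + e j <= 1.
  move=> xB; rewrite ltr_wpDl ?sqnorm_ge0//=.
  by have := sqnorm_cbox xB; have := e_4 j; have := ns; lra.
have mg2 : measurable_fun (cbox n s : set (rV n)) (fun x => g x ^+ 2).
  have [mu _] := C1_on_measurable oU BU mB Cu.
  by apply: measurable_funX; exact: measurable_funB.
have mgrad : measurable_fun (cbox n s : set (rV n)) (grad2 u).
  exact: C1_on_measurable_grad2 oU BU mB Cu.
have sub0 : cbox n s `\ 0 `<=` cbox n s by exact: subDsetl.
have mS (h : 'rV[R]_n -> R) : measurable_fun (cbox n s : set (rV n)) h ->
    measurable_fun (cbox n s `\ 0 : set (rV n)) h.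
  by move=> mh; exact: (measurable_funS mB sub0 mh).
have mW i j : measurable_fun (cbox n s : set (rV n)) (fun x => cusp_weight i (sqnorm x + e j)).
  apply: (@continuous_measurable_sub _ _ [set x | sqnorm x + e j < 1]) => //.
  - rewrite (_ : [set x | _] = (fun x => sqnorm x + e j) @^-1` [set t | t < 1])//.
    apply: open_comp; last exact: open_lt.
    by move=> x _; apply: continuousD; [exact: continuous_sqnorm|exact: cst_continuous].
  - move=> x xB /=; have := sqnorm_cbox xB; have := e_4 j; have := ns; lra.
  - move=> x /= x1; apply: (@continuous_comp _ _ _ (fun x => sqnorm x + e j) (cusp_weight i)).
      by apply: continuousD; [exact: continuous_sqnorm|exact: cst_continuous].
    by apply: continuous_cusp_weight; rewrite (ltW x1) ltr_wpDl ?sqnorm_ge0.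
have mW0 i : measurable_fun (cbox n s `\ 0 : set (rV n)) (fun x => cusp_weight i (sqnorm x)).
  by apply: measurable_cusp_weight => // x /B0/andP[q0 q1]; rewrite q0; lra.
have W0 i x : (cbox n s `\ 0) x -> 0 <= cusp_weight i (sqnorm x).
  by move=> /B0/andP[q0 q1]; apply: ltW; apply: cusp_weight_gt0; rewrite q0; lra.
have We0 i j x : cbox n s x -> 0 <= cusp_weight i (sqnorm x + e j).
  by move=> /(zB j) zx; apply: ltW; exact: cusp_weight_gt0.
set I1 := (\int[lebesgue_rV n]_(x in cbox n s `\ 0%R) (cusp_weight k (sqnorm x) * grad2 u x)%:E)%E.
set I2 := (\int[lebesgue_rV n]_(x in cbox n s `\` cbox n a) ((u x - c) ^+ 2)%:E)%E.
have I20 : (0 <= I2)%E by apply: integral_ge0 => x _; rewrite lee_fin sqr_ge0.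
have I10 : (0 <= I1)%E.
  by apply: integral_ge0 => x xB; rewrite lee_fin mulr_ge0 ?grad2_ge0// W0.
(* The bound of hardy_eps, made independent of the regularization. *)
have le_j j : (\int[lebesgue_rV n]_(x in cbox n s `\ 0%R)
    (2^-1 * cusp_weight n (sqnorm x + e j) * g x ^+ 2)%:E <= D0%:E * I2 + 4%:E * I1)%E.
  have mh : measurable_fun (cbox n s : set (rV n)) (fun x => 2^-1 * cusp_weight n (sqnorm x + e j) * g x ^+ 2).
    by apply: measurable_funM => //; apply: measurable_funM.
  apply: (@le_trans _ _ (\int[lebesgue_rV n]_(x in cbox n s)
    (2^-1 * cusp_weight n (sqnorm x + e j) * g x ^+ 2)%:E)%E).
    apply: ge0_subset_integral => //; first exact/measurable_EFinP.
    by move=> x xB; rewrite lee_fin mulr_ge0 ?sqr_ge0// mulr_ge0// We0.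
  apply: (le_trans (hardy_eps s0 ns (e0 j) (ae j) c oU BU Cu)).
  have mind : measurable_fun (cbox n s : set (rV n)) (fun x => \1_(~` cbox n a) x * g x ^+ 2).
    apply: measurable_funM => //; apply: measurable_funTS; apply: measurable_indic.
    exact: measurableC.
  have mwg : measurable_fun (cbox n s : set (rV n)) (fun x => cusp_weight k (sqnorm x + e j) * grad2 u x).
    exact: measurable_funM.
  have mD : measurable_fun (cbox n s : set (rV n)) (fun x =>
      D0 * (\1_(~` cbox n a) x * g x ^+ 2) + 4 * (cusp_weight k (sqnorm x + e j) * grad2 u x)).
    by apply: measurable_funD; exact: measurable_funM.
  have ind0 x : cbox n s x -> 0 <= \1_(~` cbox n a) x * g x ^+ 2.
    by move=> xB; rewrite mulr_ge0 ?sqr_ge0// indicE.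
  have wg0 x : cbox n s x -> 0 <= cusp_weight k (sqnorm x + e j) * grad2 u x.
    by move=> xB; rewrite mulr_ge0 ?grad2_ge0// We0.
  have D_ge0 x : cbox n s x ->
      0 <= D0 * (\1_(~` cbox n a) x * g x ^+ 2) + 4 * (cusp_weight k (sqnorm x + e j) * grad2 u x).
    by move=> xB; apply: addr_ge0; apply: mulr_ge0; rewrite ?ind0 ?wg0.
  have := integral_le_lin2 (lebesgue_rV n) mB mD mind mwg D_ge0 ind0 wg0 D0_ge0
    (ler0n _ 4) (fun x _ => lexx _).
  move/le_trans; apply.
  apply: leeD; (apply: lee_wpmul2l; first by rewrite lee_fin).
    rewrite /I2 setDE integral_mkcondr le_eqVlt; apply/orP; left; apply/eqP.
    apply: eq_integral => x _; rewrite patchE indicE.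
    by case: ifP => xa; rewrite ?mul1r ?mul0r.
  apply: (@le_trans _ _ (\int[lebesgue_rV n]_(x in cbox n s `\ 0%R)
    (cusp_weight k (sqnorm x + e j) * grad2 u x)%:E)%E).
    by apply: ge0_integral_setD0 => //; exact/measurable_EFinP.
  apply: ge0_le_integral => //.
  - by move=> x [xB _]; rewrite lee_fin mulr_ge0 ?grad2_ge0// We0.
  - by apply/measurable_EFinP; exact: mS.
  - by apply/measurable_EFinP; apply: measurable_funM => //; exact: mS.
  - move=> x xB; rewrite lee_fin ler_wpM2r ?grad2_ge0//.
    have /andP[q0 q1] := B0 x xB; have /andP[z0 z1] := zB j x xB.1.
    by apply: cusp_weight_le => //; rewrite lerDl ltW.
have e_nincr i j : (i <= j)%N -> e j <= e i.
  move=> ij; rewrite ler_wpM2l ?divr_ge0 ?(ltW s4)// lef_pV2 ?posrE//.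
  by rewrite ler_nat.
have e_cvg : e j @[j --> \oo] --> (0 : R).
  rewrite -(mulr0 ((s ^+ 2 / 12) ^+ 2 / 2)); apply: cvgMr; exact: cvg_harmonic.
pose G j x := (2^-1 * cusp_weight n (sqnorm x + e j) * g x ^+ 2)%:E.
have Glim x : (cbox n s `\ 0) x ->
    limn (G ^~ x) = (2^-1 * (cusp_weight n (sqnorm x) * g x ^+ 2))%:E.
  move=> xB; have /andP[q0 q1] := B0 x xB; rewrite mulrA.
  apply/cvg_lim => //; apply: cvg_EFin; first exact: nearW.
  apply: cvgMl; apply: cvgMr.
  apply: (@cvg_comp _ _ _ (fun j => sqnorm x + e j) (cusp_weight n) _ (nbhs (sqnorm x))).
    have : sqnorm x + e j @[j --> \oo] --> sqnorm x + 0 by apply: cvgD => //; exact: cvg_cst.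
    by rewrite addr0.
  by apply: continuous_cusp_weight; rewrite q0; lra.
have mG j : measurable_fun (cbox n s `\ 0 : set (rV n)) (G j).
  apply/measurable_EFinP; apply: mS.
  by apply: measurable_funM => //; apply: measurable_funM.
have G0 j x : (cbox n s `\ 0) x -> (0 <= G j x)%E.
  by move=> [xB _]; rewrite lee_fin mulr_ge0 ?sqr_ge0// mulr_ge0// We0.
have ndG x : (cbox n s `\ 0) x -> {homo G ^~ x : i j / (i <= j)%N >-> (i <= j)%E}.
  move=> [xB _] i j ij; rewrite lee_fin ler_wpM2r ?sqr_ge0// ler_wpM2l//.
  have /andP[zi0 zi1] := zB i x xB; have /andP[zj0 zj1] := zB j x xB.
  by apply: cusp_weight_le => //; rewrite lerD2l e_nincr.
have key : (\int[lebesgue_rV n]_(x in cbox n s `\ 0%R)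
    (2^-1 * (cusp_weight n (sqnorm x) * g x ^+ 2))%:E <= D0%:E * I2 + 4%:E * I1)%E.
  pose Ginf (x : 'rV[R]_n) := limn (G ^~ x).
  rewrite (@eq_integral _ (rV n) _ _ _ Ginf); last by move=> x /[!inE] xB; rewrite /Ginf Glim.
  rewrite monotone_convergence//; apply: lime_le; last by apply: nearW => j; exact: le_j.
  apply: ereal_nondecreasing_is_cvgn => i j ij.
  by apply: ge0_le_integral => // x xB; [exact: G0|exact: ndG].
have mWg : measurable_fun (cbox n s `\ 0 : set (rV n)) (fun x => cusp_weight n (sqnorm x) * g x ^+ 2).
  by apply: measurable_funM => //; exact: mS.
rewrite ge0_integralZl_real// in key; last first.
  by move=> x xB; rewrite mulr_ge0 ?sqr_ge0// W0.
have -> : (\int[lebesgue_rV n]_(x in cbox n s `\ 0%R) (cusp_weight n (sqnorm x) * (u x - c) ^+ 2)%:E =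
   2%:E * (2^-1%:E * \int[lebesgue_rV n]_(x in cbox n s `\ 0%R) (cusp_weight n (sqnorm x) * g x ^+ 2)%:E))%E.
  by rewrite muleA -EFinM divff ?mul1e.
apply: (le_trans (lee_wpmul2l _ key)) => //.
rewrite ge0_muleDr ?mule_ge0// [leRHS]ge0_muleDr// [leRHS]addeC.
by apply: leeD; rewrite muleA -EFinM; apply: lee_wpmul2r => //; rewrite lee_fin; lra.
Qed.

End hardy_box.

(** * Quadratic forms *)

Section quadratic_forms.
Context {R : realType}.

Definition qform n (G : 'M[R]_n) (v : 'rV[R]_n) : R := (v *m G *m v^T) 0 0.

Lemma sqnorm_row_mx n (t : 'rV[R]_1) (w : 'rV[R]_n) :
  sqnorm (row_mx t w) = t 0 0 ^+ 2 + sqnorm w.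
Proof.
rewrite !sqnormE tr_row_mx mul_row_col mxE; congr (_ + _).
by rewrite mxE big_ord1 mxE expr2.
Qed.

(** The Schur complement of the first diagonal entry. *)
Definition schur n (G : 'M[R]_(1 + n)) : 'M[R]_n :=
  drsubmx G - (G 0 0)^-1 *: (dlsubmx G *m ursubmx G).

Lemma ulsubmx00 n (G : 'M[R]_(1 + n)) : ulsubmx G = (G 0 0)%:M.
Proof.
apply/matrixP => i j; rewrite !ord1 !mxE eqxx mulr1n.
by congr (G _ _); exact: val_inj.
Qed.

Lemma det_schur n (G : 'M[R]_(1 + n)) : G 0 0 != 0 -> \det G = G 0 0 * \det (schur G).
Proof.
move=> a0; set a := G 0 0.
have GE : G = block_mx 1%:M 0 (a^-1 *: dlsubmx G) 1%:M *m block_mx a%:M (ursubmx G) 0 (schur G).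
  rewrite mulmx_block !mul1mx !mul0mx !addr0 mul_mx_scalar scalerA mulfV// scale1r.
  by rewrite -scalemxAl /schur addrC subrK -ulsubmx00 submxK.
rewrite [in LHS]GE det_mulmx det_lblock det_ublock !det1 !mul1r.
by rewrite det_scalar1.
Qed.

(** Minimizing the quadratic form over the first coordinate gives the form of the
    Schur complement; this is why bounds on a form pass to its complement. *)
Lemma qform_schur n (G : 'M[R]_(1 + n)) (w : 'rV[R]_n) : G 0 0 != 0 ->
  qform (schur G) w =
  qform G (row_mx (- (G 0 0)^-1 *: (w *m dlsubmx G)) w).
Proof.
move=> a0; set a := G 0 0; set t := _ *: _.
rewrite /qform -[in RHS](submxK G) mul_row_block tr_row_mx mul_row_col ulsubmx00 -/a.
have -> : t *m a%:M + w *m dlsubmx G = 0.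
  by rewrite mul_mx_scalar /t scalerA mulrN mulfV// scaleN1r addNr.
rewrite mul0mx add0r /schur /t mulmxBr -scalemxAr -scalemxAl mulmxA scaleNr.
by rewrite addrC.
Qed.

Lemma qform_schur_le n (G : 'M[R]_(1 + n)) (w : 'rV[R]_n) : G^T = G -> 0 < G 0 0 ->
  qform (schur G) w <= qform G (row_mx 0 w).
Proof.
move=> sG a0.
have bT : ursubmx G = (dlsubmx G)^T by rewrite trmx_dlsub sG.
rewrite /qform -[in leRHS](submxK G) mul_row_block tr_row_mx mul_row_col !mul0mx !add0r.
rewrite trmx0 mulmx0 add0r /schur mulmxBr mulmxBl mxE gerDl mxE oppr_le0.
rewrite -scalemxAr -scalemxAl mxE mulr_ge0 ?invr_ge0 ?(ltW a0)//.
have -> : w *m (dlsubmx G *m ursubmx G) *m w^T = (w *m dlsubmx G) *m (w *m dlsubmx G)^T.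
  by rewrite bT trmx_mul !mulmxA.
by rewrite -sqnormE sqnorm_ge0.
Qed.

Lemma qform_delta n (G : 'M[R]_n.+1) : qform G (delta_mx 0 0) = G 0 0.
Proof. by rewrite /qform -rowE trmx_delta -colE !mxE. Qed.

Lemma sqnorm_delta n (i : 'I_n) : sqnorm (delta_mx 0 i : 'rV[R]_n) = 1.
Proof.
rewrite /sqnorm (bigD1 i)//= mxE !eqxx expr1n big1 ?addr0// => j /negbTE ji.
by rewrite mxE ji andbF expr0n.
Qed.

Lemma tr_schur n (G : 'M[R]_(1 + n)) : G^T = G -> (schur G)^T = schur G.
Proof.
move=> sG; have bT : ursubmx G = (dlsubmx G)^T by rewrite trmx_dlsub sG.
by rewrite /schur linearB linearZ/= trmx_mul bT trmxK trmx_drsub sG.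
Qed.

(** Induction on the dimension with the Schur complement in place of eigenvalues:
    the form of the complement satisfies the same two bounds. *)
Lemma det_bounds n (G : 'M[R]_n) (l L : R) : G^T = G -> 0 < l ->
  (forall v, l * sqnorm v <= qform G v <= L * sqnorm v) ->
  l ^+ n <= \det G <= L ^+ n.
Proof.
elim: n G => [|n ih] G sG l0 Hb; first by rewrite det_mx00 !expr0 lexx.
have /andP[lG GL] := Hb (delta_mx 0 0).
rewrite qform_delta sqnorm_delta !mulr1 in lG GL.
have a0 : 0 < G 0 0 by exact: lt_le_trans lG.
pose G' : 'M[R]_(1 + n) := G.
have hS v : l * sqnorm v <= qform (schur G') v <= L * sqnorm v.
  apply/andP; split.
    rewrite qform_schur ?gt_eqF//.
    have /andP[+ _] := Hb (row_mx (- (G 0 0)^-1 *: (v *m dlsubmx G')) v : 'rV[R]_(1 + n)).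
    apply: le_trans; rewrite ler_wpM2l ?(ltW l0)// sqnorm_row_mx lerDr; exact: sqr_ge0.
  apply: (le_trans (qform_schur_le _ (sG : G'^T = G') a0)).
  have /andP[_ +] := Hb (row_mx 0 v : 'rV[R]_(1 + n)).
  by rewrite sqnorm_row_mx mxE expr0n add0r.
have /andP[lS SL] := ih _ (tr_schur (sG : G'^T = G')) l0 hS.
have S0 : 0 < \det (schur (G : 'M[R]_(1 + n))) by rewrite (lt_le_trans _ lS)// exprn_gt0.
rewrite (det_schur (G := (G : 'M[R]_(1 + n)))) ?gt_eqF// !exprS.
by rewrite !ler_pM ?exprn_ge0// ltW.
Qed.

Lemma det_gt0 n (G : 'M[R]_n) : G^T = G -> (forall v, v != 0 -> 0 < qform G v) ->
  0 < \det G.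
Proof.
elim: n G => [|n ih] G sG Hb; first by rewrite det_mx00.
have a0 : 0 < G 0 0.
  rewrite -qform_delta; apply: Hb; rewrite -sqnorm_eq0 sqnorm_delta; exact: oner_neq0.
rewrite (det_schur (G := (G : 'M[R]_(1 + n)))) ?gt_eqF// mulr_gt0// ih//.
  exact: tr_schur.
move=> v v0; rewrite qform_schur ?gt_eqF//; apply: Hb.
rewrite -sqnorm_eq0 sqnorm_row_mx gt_eqF// ltr_wpDl ?sqr_ge0//.
by rewrite lt_neqAle sqnorm_ge0 eq_sym sqnorm_eq0 v0.
Qed.

Lemma qform_le_sum n (G : 'M[R]_n) (v : 'rV[R]_n) :
  qform G v <= (\sum_i \sum_j `|G i j|) * sqnorm v.
Proof.
have -> : qform G v = \sum_j \sum_i v 0 i * G i j * v 0 j.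
  rewrite /qform mxE; apply: eq_bigr => j _.
  by rewrite [v^T _ _]mxE mxE mulr_suml.
rewrite exchange_big mulr_suml; apply: ler_sum => i _.
rewrite mulr_suml; apply: ler_sum => j _.
have le_sq l : v 0 l ^+ 2 <= sqnorm v.
  by rewrite /sqnorm (bigD1 l)//= lerDl sumr_ge0// => m _; exact: sqr_ge0.
have h : `|v 0 i * v 0 j| <= sqnorm v.
  rewrite normrM; have := le_sq i; have := le_sq j.
  rewrite -(real_normK (num_real (v 0 i))) -(real_normK (num_real (v 0 j))).
  by have := sqr_ge0 (`|v 0 i| - `|v 0 j|); nra.
rewrite mulrAC; apply: (le_trans (ler_norm _)).
by rewrite normrM mulrC ler_wpM2l.
Qed.

Lemma qform_cauchy_schwarz n (G : 'M[R]_n) (v w : 'rV[R]_n) : G^T = G ->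
  (forall u, 0 <= qform G u) ->
  ((v *m G *m w^T) 0 0) ^+ 2 <= qform G v * qform G w.
Proof.
move=> sG G0.
set b := (v *m G *m w^T) 0 0.
have sym : (w *m G *m v^T) 0 0 = b.
  have -> : w *m G *m v^T = (v *m G *m w^T)^T by rewrite !trmx_mul trmxK sG mulmxA.
  by rewrite mxE.
have E t r : qform G (t *: v - r *: w) = t ^+ 2 * qform G v - 2 * t * r * b + r ^+ 2 * qform G w.
  have trE : (t *: v - r *: w)^T = t *: v^T - r *: w^T.
    by apply/matrixP => i j; rewrite !mxE.
  rewrite /qform trE !mulmxBl !mulmxBr -!scalemxAl -!scalemxAr.
  move: sym; rewrite /b.
  move: (v *m G *m v^T) (v *m G *m w^T) (w *m G *m v^T) (w *m G *m w^T) => A B C D CB.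
  rewrite !mxE CB; ring.
have [v0|v_neq0] := eqVneq (qform G v) 0.
  have [->|b0] := eqVneq b 0; first by rewrite expr0n mulr_ge0.
  have := G0 (((qform G w + 1) / (2 * b)) *: v - 1 *: w); rewrite E v0 mulr0 add0r.
  have -> : 2 * ((qform G w + 1) / (2 * b)) * 1 * b = qform G w + 1 by field.
  by lra.
have v_gt0 : 0 < qform G v by rewrite lt_neqAle eq_sym v_neq0 G0.
have := G0 (b *: v - qform G v *: w); rewrite E.
have -> : b ^+ 2 * qform G v - 2 * b * qform G v * b + qform G v ^+ 2 * qform G w =
  qform G v * (qform G v * qform G w - b ^+ 2) by ring.
by rewrite pmulr_rge0// subr_ge0.
Qed.

End quadratic_forms.

(** * Differentiability of C^1 functions *)

Section taylor.
Context {R : realType}.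

Lemma ler_rV_norm n (h : 'rV[R]_n) i : `|h 0 i| <= `|h|.
Proof. by rewrite [leRHS]/Num.Def.normr/= mx_normrE; exact: (le_bigmax _ (fun ij => `|h ij.1 ij.2|) (0, i)). Qed.

Lemma ler_rv_split_norm m (h : 'rV[R]_m.+1) : `|(rv_split h).2| <= `|h|.
Proof.
rewrite [leLHS]/Num.Def.normr/= mx_normrE; apply/bigmax_leP; split=> //= -[i j] _ /=.
by rewrite ord1 mxE ler_rV_norm.
Qed.

Lemma mvt_between (f df : R -> R) (t s : R) :
  (forall r, `|r - t| <= `|s| -> is_derive r 1 f (df r)) ->
  exists2 r, `|r - t| <= `|s| & f (t + s) - f t = df r * s.
Proof.
move=> dfP.
have cf r : `|r - t| <= `|s| -> {for r, continuous f}.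
  by move=> /dfP[/derivable1_diffP d _]; exact: differentiable_continuous.
have [s0|s0] := leP 0 s.
  have itv r : t <= r <= t + s -> `|r - t| <= `|s|.
    by move=> /andP[tr rt]; rewrite !ger0_norm ?subr_ge0//; lra.
  have tts : t <= t + s by rewrite lerDl.
  have dP r : r \in `]t, (t + s)[ -> is_derive r 1 f (df r).
    by rewrite in_itv/= => /andP[/ltW tr /ltW rt]; apply: dfP; apply: itv; rewrite tr.
  have cP : {within `[t, (t + s)], continuous f}.
    by apply: cont_itv_within => r /itv; exact: cf.
  have [r] := MVT_segment tts dP cP.
  rewrite in_itv/= => /itv rs ->; exists r => //; congr (_ * _); ring.
have itv r : t + s <= r <= t -> `|r - t| <= `|s|.
  by move=> /andP[tr rt]; rewrite !ler0_norm ?(ltW s0)// ?subr_le0//; lra.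
have tts : t + s <= t by rewrite gerDl ltW.
have dP r : r \in `](t + s), t[ -> is_derive r 1 f (df r).
  by rewrite in_itv/= => /andP[/ltW tr /ltW rt]; apply: dfP; apply: itv; rewrite tr.
have cP : {within `[(t + s), t], continuous f}.
  by apply: cont_itv_within => r /itv; exact: cf.
have [r] := MVT_segment tts dP cP.
rewrite in_itv/= => /itv rs H; exists r => //.
by rewrite -opprB H; ring.
Qed.

(** Induction on the dimension: the mean value theorem accounts for the move in
    the first coordinate, with a derivative taken at a nearby point, and the
    induction hypothesis for the move inside the slice. *)
Lemma C1_taylor n (U : set 'rV[R]_n) u x (e : R) : open U -> C1_on U u -> U x -> 0 < e ->
  exists2 d : R, 0 < d & forall h : 'rV[R]_n, `|h| < d ->
    `|u (x + h) - u x - \sum_i h 0 i * 'D_(delta_mx 0 i) u x| <= e * `|h|.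
Proof.
elim: n U u x e => [|m ih] U u x e oU Cu Ux e0.
  exists 1 => // h _; rewrite big_ord0 subr0 (_ : h = 0) ?addr0 ?subrr ?normr0 ?mulr0//.
  by apply/rowP => -[].
rewrite -(rv_splitK x) in Ux *; case: (rv_split x) Ux => t y Ux.
have e20 : 0 < e / 2 by rewrite divr_gt0.
have [d1 d10 H1] := ih _ _ y _ (open_slice (t := t) oU) (C1_on_slice t Cu) Ux e20.
have [_ cD] := Cu.2 0.
have : nbhs (rv_cons (t, y)) (U `&` [set z | `|'D_(delta_mx 0 0) u (rv_cons (t, y)) - 'D_(delta_mx 0 0) u z| < e / 2]).
  apply: filterI; first exact: open_nbhs_nbhs.
  have /cvgrPdist_lt := cD _ Ux; exact.
move=> /nbhs_ballP[d2 /= d20 H2].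
exists (Num.min d1 d2); first by rewrite lt_min d10.
move=> h; rewrite lt_min => /andP[hd1 hd2].
have kh := ler_rv_split_norm h; have sh := ler_rV_norm h 0.
rewrite -(rv_splitK h) in hd1 hd2 kh sh *; case: (rv_split h) hd1 hd2 kh sh => s k.
set H := rv_cons (s, k); rewrite rv_consK rv_cons0 /= => hd1 hd2 kh sh.
have xhE : rv_cons (t, y) + H = rv_cons (t + s, y + k).
  apply/rowP => i; rewrite mxE; case: (unliftP ord0 i) => [j|] ->.
    by rewrite !rv_consS/= mxE.
  by rewrite !rv_cons0.
have inball r : `|r - t| <= `|s| -> ball (rv_cons (t, y)) d2 (rv_cons (r, y + k)).
  move=> rt; split=> // i j; rewrite ord1; case: (unliftP ord0 j) => [l|] -> /=.
    rewrite !rv_consS/= mxE /ball/= opprD addrA subrr sub0r normrN.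
    by rewrite (le_lt_trans (ler_rV_norm k l))// (le_lt_trans kh).
  by rewrite !rv_cons0 /ball/= distrC (le_lt_trans rt)// (le_lt_trans sh).
have [r|r rt uE] := @mvt_between (fun r => u (rv_cons (r, y + k)))
    (fun r => 'D_(delta_mx 0 0) u (rv_cons (r, y + k))) t s.
  move=> /inball/H2[Ur _]; apply: is_derive_rv_cons0.
  by apply: derivableP; exact: (Cu.2 0).1.
have [_ /= Dr] := H2 _ (inball r rt).
rewrite xhE big_ord_recl rv_cons0/=.
have := H1 k (le_lt_trans kh hd1).
have -> : \sum_(i < m) k 0 i * 'D_(delta_mx 0 i) (fun z => u (rv_cons (t, z))) y =
    \sum_(i < m) H 0 (lift ord0 i) * 'D_(delta_mx 0 (lift ord0 i)) u (rv_cons (t, y)).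
  by apply: eq_bigr => i _; rewrite rv_consS (derive_rv_consS u t y i).2.
set S := \sum_(i < m) _; set D := 'D_(delta_mx 0 0) u (rv_cons (t, y)) => Hk.
have -> : u (rv_cons (t + s, y + k)) - u (rv_cons (t, y)) - (s * D + S) =
   (u (rv_cons (t, y + k)) - u (rv_cons (t, y)) - S) - s * (D - 'D_(delta_mx 0 0) u (rv_cons (r, y + k))).
  have -> : u (rv_cons (t + s, y + k)) = u (rv_cons (t, y + k)) + 'D_(delta_mx 0 0) u (rv_cons (r, y + k)) * s.
    by rewrite -uE/=; ring.
  ring.
apply: (le_trans (ler_normB _ _)).
rewrite [e in leRHS](splitr e) mulrDl lerD//.
  by apply: (le_trans Hk); rewrite ler_wpM2l// ltW.
by rewrite normrM mulrC ler_pM// ltW.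
Qed.

Definition dlin n (u : 'rV[R]_n -> R) (x h : 'rV[R]_n) : R :=
  \sum_i h 0 i * 'D_(delta_mx 0 i) u x.

Lemma dlin_is_linear n (u : 'rV[R]_n -> R) x : linear (dlin u x).
Proof.
move=> a h k; rewrite /dlin scaler_sumr -big_split/=; apply: eq_bigr => i _.
by rewrite !mxE /GRing.scale/= mulrDl mulrA.
Qed.

(** Continuous partial derivatives give a total derivative, hence the chain rule,
    on which all changes of charts depend. *)
Lemma C1_differentiable n (U : set 'rV[R]_n) u x : open U -> C1_on U u -> U x ->
  differentiable u x /\ forall v, 'D_v u x = dlin u x v.
Proof.
move=> oU Cu Ux.
pose dM := GRing.isLinear.Build _ _ _ _ (dlin u x) (dlin_is_linear u x).
pose df : {linear 'rV[R]_n -> R} := HB.pack (dlin u x) dM.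
have cdf : continuous df.
  move=> h; rewrite (_ : (df : _ -> _) = \sum_i (fun h : 'rV[R]_n => h 0 i * 'D_(delta_mx 0 i) u x)); last first.
    by apply/funext => k; rewrite fct_sumE.
  elim/big_ind: _ => [|f g cf cg|i _]; first exact: cst_continuous.
    exact: continuousD.
  apply: (@continuousM _ _ (fun h : 'rV[R]_n => h 0 i)); first exact: coord_continuous.
  exact: cst_continuous.
have taylor : u \o shift x = cst (u x) + df +o_ (0 : 'rV[R]_n) id.
  apply/eqaddoP => e e0; have [d d0 Hd] := C1_taylor oU Cu Ux e0.
  apply/nbhs_ballP; exists d => // h; rewrite -ball_normE/= sub0r normrN => hd.
  have -> : (u \o shift x - (cst (u x) + df)) h = u (x + h) - u x - dlin u x h.
    by transitivity (u (h + x) - (u x + dlin u x h)) => //; rewrite [h + x]addrC opprD addrA.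
  exact: Hd.
have dE : 'd u x = df :> (_ -> _) by exact: diff_unique.
have du : differentiable u x.
  by apply/diff_locallyP; rewrite dE.
split=> // v; rewrite deriveE// dE//.
Qed.

End taylor.

(** * Charts, metrics and gradients *)

Lemma smooth_C1 (R : realType) n (U : set 'rV[R]_n) f : smooth U f -> C1_on U f.
Proof.
move=> /(_ 1%N)[cf df]; split=> // i; have [d [c _]] := df i; split=> //.
Qed.

Lemma differentiable_rV (R : realType) n m (F : 'rV[R]_n -> 'rV[R]_m) x :
  (forall j, differentiable (fun y => F y 0 j) x) -> differentiable F x.
Proof.
move=> dF; rewrite (_ : F = \sum_j (fun y => F y 0 j *: (delta_mx 0 j : 'rV[R]_m))); last first.
  apply/funext => y; rewrite fct_sumE [LHS]row_sum_delta//.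
by apply: differentiable_sum => j; exact: differentiableZl.
Qed.

Section charts.
Context {R : realType} {n : nat} {M : ptopologicalType}.
Variable S : smooth_manifold R n M.
Implicit Types (a b : chart R n M) (p q : M).

Lemma chart_mapP a p : chart_dom a p -> chart_img a (chart_map a p).
Proof. by move=> ap; exists p. Qed.

Lemma chart_invP a x : chart_img a x ->
  chart_dom a (chart_inv a x) /\ chart_map a (chart_inv a x) = x.
Proof. by move=> [p ap <-]; rewrite chart_mapK. Qed.

Lemma chart_image_setI a (W : set M) :
  chart_map a @` (chart_dom a `&` W) = chart_img a `&` chart_inv a @^-1` W.
Proof.
apply/seteqP; split=> [_ [p [ap Wp] <-]|x [/chart_invP[ax xE] Wx]].
  by split; [exact: chart_mapP|rewrite /preimage/= chart_mapK].
by exists (chart_inv a x).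
Qed.

Lemma open_chart_image a (W : set M) : open W -> open (chart_map a @` (chart_dom a `&` W)).
Proof.
move=> oW; rewrite chart_image_setI; apply: continuous_on_open_preimage => //.
  exact: chart_img_open.
by move=> x; exact: chart_inv_cont.
Qed.

Lemma chart_atP p : atlas S (chart_at S p) /\ chart_dom (chart_at S p) p.
Proof. by rewrite /chart_at; case: cid. Qed.

Let tr a b := chart_map b \o chart_inv a.
Let ov a b := chart_map a @` (chart_dom a `&` chart_dom b).

Let open_ov a b : open (ov a b).
Proof. exact/open_chart_image/chart_dom_open. Qed.

Let ov_p a b p : chart_dom a p -> chart_dom b p -> ov a b (chart_map a p).
Proof. by move=> ap bp; exists p. Qed.

Let trE a b p : chart_dom a p -> tr a b (chart_map a p) = chart_map b p.
Proof. by move=> ap; rewrite /tr/= chart_mapK. Qed.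

Lemma transition_differentiable a b x : atlas S a -> atlas S b -> ov a b x ->
  differentiable (tr a b) x.
Proof.
move=> Sa Sb x_ov; apply: differentiable_rV => j.
have sm := smooth_C1 (atlas_smooth Sa Sb j).
by have [d _] := C1_differentiable (@open_ov a b) sm x_ov.
Qed.

Lemma diff_change_frame a b p v : atlas S a -> atlas S b ->
  chart_dom a p -> chart_dom b p ->
  'd (tr a b) (chart_map a p) v = v *m change_frame a b p.
Proof. by move=> Sa Sb ap bp; rewrite /change_frame /jacobian mul_rV_lin1. Qed.

(** Chain rule for the two transition maps, which are inverse to each other near
    the point. *)
Lemma change_frameK a b p : atlas S a -> atlas S b ->
  chart_dom a p -> chart_dom b p ->
  change_frame a b p *m change_frame b a p = 1%:M.
Proof.
move=> Sa Sb ap bp; apply/row_matrixP => i; rewrite !rowE mulmx1 mulmxA.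
have dF := transition_differentiable Sa Sb (ov_p ap bp).
have dG : differentiable (tr b a) (tr a b (chart_map a p)).
  by rewrite trE//; exact: transition_differentiable Sb Sa (ov_p bp ap).
have e := diff_comp dF dG.
have E1 := diff_change_frame (delta_mx 0 i) Sa Sb ap bp.
have E2 := diff_change_frame (delta_mx 0 i *m change_frame a b p) Sb Sa bp ap.
transitivity ('d (tr b a \o tr a b) (chart_map a p) (delta_mx 0 i)).
  by rewrite e; symmetry; apply: etrans E2; rewrite -E1 -(@trE a b p ap).
rewrite -deriveE; last exact: differentiable_comp.
rewrite (@near_eq_derive _ _ _ (tr b a \o tr a b) id)//.
- exact: derive_id.
- have : nbhs (chart_map a p) (ov a b) by apply: open_nbhs_nbhs; split; [exact: open_ov|exact: ov_p].
  by apply: filterS => _ [q [aq bq] <-] /=; rewrite trE// /tr/= chart_mapK.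
Qed.

Definition chart_grad (u : M -> R) a p : 'rV[R]_n :=
  \row_i 'D_(delta_mx 0 i) (u \o chart_inv a) (chart_map a p).

Lemma sqnorm_chart_grad u a p : sqnorm (chart_grad u a p) = \sum_i ('D_(delta_mx 0 i) (u \o chart_inv a) (chart_map a p)) ^+ 2.
Proof. by apply: eq_bigr => i _; rewrite mxE. Qed.

(** Covectors transform by the transposed frame change. *)
Lemma chart_gradE u a p : smooth_fun S u -> atlas S a -> chart_dom a p ->
  chart_grad u a p = differential S u p *m (change_frame a (chart_at S p) p)^T.
Proof.
move=> su Sa ap; have [Sc cp] := chart_atP p; set c := chart_at S p in Sc cp *.
have dF := transition_differentiable Sa Sc (ov_p ap cp).
have [dG DG] := C1_differentiable (@chart_img_open _ _ _ c) (smooth_C1 (su c Sc)) (chart_mapP cp).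
apply/rowP => i; rewrite mxE.
have -> : 'D_(delta_mx 0 i) (u \o chart_inv a) (chart_map a p) =
    'D_(delta_mx 0 i) ((u \o chart_inv c) \o tr a c) (chart_map a p).
  apply: near_eq_derive.
  have : nbhs (chart_map a p) (ov a c) by apply: open_nbhs_nbhs; split; [exact: open_ov|exact: ov_p].
    by apply: filterS => _ [q [aq cq] <-] /=; rewrite /tr/= !chart_mapK.
have dG' : differentiable (u \o chart_inv c) (tr a c (chart_map a p)) by rewrite trE.
rewrite deriveE; last exact: differentiable_comp.
rewrite (diff_comp dF dG') [LHS]/= (diff_change_frame _ Sa Sc ap cp) (@trE a c p ap).
rewrite -(deriveE _ dG) DG /dlin mxE.
by apply: eq_bigr => j _; rewrite -rowE !mxE mulrC.
Qed.

End charts.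

Section continuous_matrices.
Context {R : realType} {T : topologicalType}.

(** Continuity at a point only depends on the germ of the function there. *)
Lemma continuous_near (f h : T -> R) x : (\forall y \near x, f y = h y) ->
  {for x, continuous f} -> {for x, continuous h}.
Proof.
move=> fh; have e := nbhs_singleton fh.
by rewrite /prop_for /continuous_at e; apply: cvg_trans; exact: near_eq_cvg.
Qed.

Lemma continuous_ext (f h : T -> R) x : (forall y, f y = h y) ->
  {for x, continuous f} -> {for x, continuous h}.
Proof. by move=> /funext ->. Qed.

Lemma continuous_sum (I : Type) (r : seq I) (P : pred I) (f : I -> T -> R) x :
  (forall i, P i -> {for x, continuous (f i)}) ->
  {for x, continuous (fun y => \sum_(i <- r | P i) f i y)}.
Proof.
move=> cf; rewrite (_ : (fun _ => _) = \sum_(i <- r | P i) f i); last first.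
  by apply/funext => y; rewrite fct_sumE.
by elim/big_ind: _ => [|g h cg ch|i /cf//]; [exact: cst_continuous|exact: continuousD].
Qed.

Lemma continuous_prod (I : Type) (r : seq I) (P : pred I) (f : I -> T -> R) x :
  (forall i, P i -> {for x, continuous (f i)}) ->
  {for x, continuous (fun y => \prod_(i <- r | P i) f i y)}.
Proof.
move=> cf; elim: r => [|i r ih].
  apply: (@continuous_ext (cst 1)) => [y|]; first by rewrite big_nil.
  exact: cst_continuous.
case: (boolP (P i)) => Pi; last first.
  by apply: continuous_ext ih => y; rewrite big_cons (negbTE Pi).
by apply: continuous_ext (continuousM (cf i Pi) ih) => y; rewrite big_cons Pi.
Qed.

Lemma continuous_det n (A : T -> 'M[R]_n) x :
  (forall i j, {for x, continuous (fun y => A y i j)}) ->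
  {for x, continuous (fun y => \det (A y))}.
Proof.
move=> cA; apply: continuous_sum => s _.
have c1 : {for x, continuous (cst ((-1) ^+ (perm.odd_perm s) : R) : T -> R)} by exact: cst_continuous.
have c2 : {for x, continuous (fun y => \prod_i A y i (s i))}.
  by apply: continuous_prod => i _; exact: cA.
by apply: continuous_ext (continuousM c1 c2).
Qed.

Lemma continuous_invmx n (A : T -> 'M[R]_n) x i j :
  (forall i j, {for x, continuous (fun y => A y i j)}) -> \det (A x) != 0 ->
  {for x, continuous (fun y => (invmx (A y)) i j)}.
Proof.
move=> cA dA.
have cdet := continuous_det cA.
pose F y : R := (\det (A y))^-1 * (\adj (A y)) i j.
have c1 : {for x, continuous F}.
  have ca : {for x, continuous (fun y => (\adj (A y)) i j : R)}.
    rewrite (_ : (fun _ => _) = (fun y => (-1) ^+ (j + i) * \det (row' j (col' i (A y))))); last first.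
      by apply/funext => y; rewrite mxE.
    have c0 : {for x, continuous (cst ((-1) ^+ (j + i) : R) : T -> R)} by exact: cst_continuous.
    have cm : {for x, continuous (fun y => \det (row' j (col' i (A y))) : R)}.
      apply: continuous_det => i' j'.
      by apply: continuous_ext (cA (lift j i') (lift i j')) => y; rewrite !mxE.
    by apply: continuous_ext (continuousM c0 cm).
  by apply: continuous_ext (continuousM (continuousV (s := fun y => \det (A y)) dA cdet) ca).
have nbA : \forall y \near x, F y = (invmx (A y)) i j.
  have nb : nbhs (\det (A x)) [set t : R | t != 0].
    apply: open_nbhs_nbhs; split; last exact: dA.
    exact: (@open_neq R 0).
  have H : \forall y \near x, \det (A y) != 0 := cdet _ nb.
  apply: filterS H => y dy.
  by rewrite /F /invmx unitmxE unitfE dy [RHS]mxE.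
exact: continuous_near nbA c1.
Qed.

End continuous_matrices.

Section metric.
Context {R : realType} {n : nat} {M : ptopologicalType}.
Variable S : smooth_manifold R n M.
Variables (O : set M) (g : M -> 'M[R]_n).
Hypotheses (oO : open O) (gR : riemannian_metric S O g).
Implicit Types (a b : chart R n M) (p q : M) (X : M -> 'rV[R]_n) (u : M -> R).

Lemma tangent_norm2_components a X p : atlas S a -> chart_dom a p ->
  tangent_norm2 g p (X p) = qform (gram S g a p) (components S a X p).
Proof.
move=> Sa ap; have [Sc cp] := chart_atP S p.
have KJ := change_frameK Sc Sa cp ap.
rewrite /tangent_norm2 /qform /components /gram; congr (_ _ _).
move: KJ; move: (change_frame (chart_at S p) a p) (change_frame a (chart_at S p) p) => K J KJ.
transitivity ((X p *m (K *m J)) *m g p *m (X p *m (K *m J))^T); first by rewrite KJ mulmx1.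
by rewrite !trmx_mul !mulmxA.
Qed.

Lemma gram_sym a p : O p -> (gram S g a p)^T = gram S g a p.
Proof. by move=> Op; rewrite /gram !trmx_mul trmxK (gR.1 p Op).1 mulmxA. Qed.

Lemma qform_gram a p v : qform (gram S g a p) v = qform (g p) (v *m change_frame a (chart_at S p) p).
Proof. by rewrite /qform /gram trmx_mul !mulmxA. Qed.

Lemma qform_metric_gt0 p v : O p -> v != 0 -> 0 < qform (g p) v.
Proof. by move=> /(gR.1)[_]; exact. Qed.

Lemma qform_metric_ge0 p v : O p -> 0 <= qform (g p) v.
Proof.
move=> Op; have [->|v0] := eqVneq v 0; first by rewrite /qform !mul0mx mxE.
by apply: ltW; exact: qform_metric_gt0.
Qed.

Lemma tangent_norm2_ge0 p v : O p -> 0 <= tangent_norm2 g p v.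
Proof. exact: qform_metric_ge0. Qed.

Lemma gram_gt0 a p v : atlas S a -> chart_dom a p -> O p -> v != 0 ->
  0 < qform (gram S g a p) v.
Proof.
move=> Sa ap Op v0; have [Sc cp] := chart_atP S p.
have JK := change_frameK Sa Sc ap cp.
rewrite qform_gram; apply: qform_metric_gt0 => //; apply: contra v0 => /eqP vJ.
by rewrite -[v]mulmx1 -JK mulmxA vJ mul0mx.
Qed.

Lemma det_gram_gt0 a p : atlas S a -> chart_dom a p -> O p -> 0 < \det (gram S g a p).
Proof. by move=> Sa ap Op; apply: det_gt0 => [|v]; [exact: gram_sym|exact: gram_gt0]. Qed.

Lemma metric_unit p : O p -> g p \in unitmx.
Proof.
move=> Op; rewrite unitmxE unitfE gt_eqF//; apply: det_gt0; first exact: (gR.1 p Op).1.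
by move=> v; exact: qform_metric_gt0.
Qed.

(** The gradient in an arbitrary chart is the chart differential raised by the
    inverse Gram matrix; this is what makes it a measurable field. *)
Lemma components_gradient a u p : smooth_fun S u -> atlas S a -> chart_dom a p -> O p ->
  components S a (gradient S g u) p = chart_grad u a p *m invmx (gram S g a p).
Proof.
move=> su Sa ap Op; have [Sc cp] := chart_atP S p.
have KJ := change_frameK Sc Sa cp ap; have JK := change_frameK Sa Sc ap cp.
have gU := metric_unit Op.
have GU : gram S g a p \in unitmx by rewrite unitmxE unitfE gt_eqF// det_gram_gt0.
apply: (can_inj (mulmxK GU)); rewrite mulmxKV// /components /gradient.
rewrite (chart_gradE su Sa ap) /gram.
move: KJ JK; move: (change_frame (chart_at S p) a p) (change_frame a (chart_at S p) p) => K J KJ JK.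
by rewrite !mulmxA -(mulmxA _ K) KJ mulmx1 mulmxKV.
Qed.

(** If d is the Euclidean gradient in the chart, |d|^2 is the differential of u
    applied to d, that is the scalar product of d with the gradient of the
    metric; the Cauchy-Schwarz inequality of the metric and the bound of its
    form by L conclude. *)
Lemma chart_grad_le a u p L : smooth_fun S u -> atlas S a -> chart_dom a p -> O p ->
  0 <= L -> (forall v, qform (gram S g a p) v <= L * sqnorm v) ->
  sqnorm (chart_grad u a p) <= L * tangent_norm2 g p (gradient S g u p).
Proof.
move=> su Sa ap Op L0 HL.
set d := chart_grad u a p; set w := gradient S g u p.
have [sg _] := gR.1 p Op.
set J := change_frame a (chart_at S p) p.
have dE : sqnorm d = ((d *m J) *m g p *m w^T) 0 0.
  have gw : g p *m w^T = (differential S u p)^T.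
    by rewrite -{1}sg -trmx_mul /w /gradient mulmxKV// metric_unit.
  have dT : d^T = J *m (differential S u p)^T.
    by rewrite /d (chart_gradE su Sa ap) trmx_mul trmxK.
  by rewrite sqnormE dT -(mulmxA (d *m J)) gw mulmxA.
have := qform_cauchy_schwarz (d *m J) w sg (fun v => qform_metric_ge0 v Op).
rewrite -dE -qform_gram => CS.
have [d0|d_neq0] := eqVneq (sqnorm d) 0.
  by rewrite d0 mulr_ge0// tangent_norm2_ge0.
have d_gt0 : 0 < sqnorm d by rewrite lt_neqAle eq_sym d_neq0 sqnorm_ge0.
rewrite -(ler_pM2l d_gt0) -expr2; apply: (le_trans CS).
by rewrite mulrA [sqnorm d * L]mulrC ler_wpM2r// tangent_norm2_ge0.
Qed.

Let V a := chart_map a @` (chart_dom a `&` O).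

Lemma continuous_gram a x i j : atlas S a -> V a x ->
  {for x, continuous (fun x => gram S g a (chart_inv a x) i j)}.
Proof. by move=> Sa Vx; have [c _] := gR.2 a Sa i j 0%N; exact: c. Qed.

Lemma continuous_on_chart a (h : 'rV[R]_n -> R) p :
  {for chart_map a p, continuous h} -> chart_dom a p ->
  {for p, continuous (h \o chart_map a)}.
Proof. by move=> ch ap; apply: continuous_comp => //; exact: chart_map_cont. Qed.

(** Vector fields are only given chart by chart, so measurability on the manifold
    is transported from continuity in coordinates. *)
Lemma measurable_on_chart a (f : M -> R) : atlas S a ->
  (forall x, V a x -> {for x, continuous (f \o chart_inv a)}) ->
  measurable_fun (chart_dom a `&` O : set (borel (M := M))) f.
Proof.
move=> Sa cf.
have oD : open (chart_dom a `&` O) by apply: openI => //; exact: chart_dom_open.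
pose h p := (f \o chart_inv a) (chart_map a p).
have mh : measurable_fun (chart_dom a `&` O : set (borel (M := M))) h.
  apply: continuous_on_measurable => // p [ap Op].
  by apply: continuous_on_chart => //; apply: cf; exists p.
apply: eq_measurable_fun mh => p /[!inE] -[ap _].
by rewrite /h /= chart_mapK.
Qed.

Lemma gradient_measurable_field u : smooth_fun S u ->
  measurable_field S O (gradient S g u).
Proof.
move=> su a i Sa; apply: measurable_on_chart => // x Vx.
have oV : open (V a) by exact: open_chart_image.
have [p [ap Op] xE] := Vx.
have c1 : {for x, continuous (fun y => (\row_i 'D_(delta_mx 0 i) (u \o chart_inv a) y *m invmx (gram S g a (chart_inv a y))) 0 i)}.
  pose dj j y := 'D_(delta_mx 0 j) (u \o chart_inv a) y.
  apply: (@continuous_ext _ _ (fun y => \sum_j dj j y * (invmx (gram S g a (chart_inv a y))) j i)).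
    by move=> y; rewrite mxE; apply: eq_bigr => j _; rewrite mxE.
  apply: continuous_sum => j _.
  have cD : {for x, continuous (dj j)}.
    have [_ dc] := smooth_C1 (su a Sa); have [_] := dc j; apply.
    by rewrite -xE; exact: chart_mapP.
  have ci : {for x, continuous (fun y => (invmx (gram S g a (chart_inv a y))) j i)}.
    apply: continuous_invmx => [k l|]; first exact: continuous_gram.
    by rewrite gt_eqF// -xE chart_mapK// det_gram_gt0.
  by apply: continuous_ext (continuousM cD ci).
have nV : nbhs x (V a) by exact: open_nbhs_nbhs.
have e : \forall y \near x, (\row_i 'D_(delta_mx 0 i) (u \o chart_inv a) y *m invmx (gram S g a (chart_inv a y))) 0 i
    = ((fun q => components S a (gradient S g u) q 0 i) \o chart_inv a) y.
  apply: filterS nV => _ [q [aq Oq] <-] /=.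
  by rewrite chart_mapK// components_gradient.
exact: continuous_near e c1.
Qed.

Lemma measurable_qform_field a X : atlas S a -> measurable_field S O X ->
  measurable_fun (chart_dom a `&` O : set (borel (M := M))) (fun p => tangent_norm2 g p (X p)).
Proof.
move=> Sa mX.
pose h p := \sum_j \sum_i components S a X p 0 i * gram S g a p i j * components S a X p 0 j.
suff mh : measurable_fun (chart_dom a `&` O : set (borel (M := M))) h.
  apply: eq_measurable_fun mh => p /[!inE] -[ap Op].
  rewrite (tangent_norm2_components _ Sa ap) /qform [RHS]mxE.
  by apply: eq_bigr => j _; rewrite [X in _ = _ * X]mxE [X in X * _]mxE mulr_suml.
apply: measurable_sum => j; apply: measurable_sum => i.
apply: measurable_funM; last exact: mX.
apply: measurable_funM; first exact: mX.
apply: measurable_on_chart => // x Vx; exact: continuous_gram.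
Qed.

End metric.

(** * Integration in a chart *)

Section density_transfer.
Local Open Scope ereal_scope.
Context d1 d2 (T1 : measurableType d1) (T2 : measurableType d2) (R : realType).
Variables (nu : {measure set T1 -> \bar R}) (mu : {measure set T2 -> \bar R}).
Variables (A : set T1) (B : set T2) (phi : T2 -> T1) (w : T2 -> R).
Hypotheses (mA : measurable A) (mB : measurable B) (mphi : measurable_fun B phi)
  (BA : forall x, B x -> A (phi x)) (mw : measurable_fun B w)
  (w0 : forall x, B x -> (0 <= w x)%R)
  (nuE : forall C, measurable C ->
    nu (A `&` C) = \int[mu]_(x in B `&` phi @^-1` C) (w x)%:E).

Import HBNNSimple.

(** Change of variables from its special case for indicator functions: simple
    functions by linearity, then monotone convergence. *)
Lemma ge0_integral_density_transfer (f : T1 -> \bar R) :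
  measurable_fun A f -> (forall p, A p -> 0 <= f p) ->
  \int[nu]_(p in A) f p = \int[mu]_(x in B) (f (phi x) * (w x)%:E).
Proof.
move=> mf f0.
pose h := nnsfun_approx mA mf.
have mwE : measurable_fun B (EFin \o w) by exact/measurable_EFinP.
have mcomp (u : T1 -> \bar R) : measurable_fun A u -> measurable_fun B (u \o phi).
  by move=> mu'; apply: (measurable_comp mA _ mu' mphi) => _ [x Bx <-]; exact: BA.
have hphi k : measurable_fun B (fun x => (h k (phi x))%:E).
  by apply: (mcomp (EFin \o h k)); apply/measurable_EFinP; exact: measurable_funTS.
have -> : \int[nu]_(p in A) f p = limn (fun k => \int[nu]_(p in A) (h k p)%:E).
  rewrite -monotone_convergence//.
  - by apply: eq_integral => p /[!inE] Ap; apply/esym/cvg_lim => //; exact: cvg_nnsfun_approx.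
  - by move=> k; apply/measurable_EFinP; exact: measurable_funTS.
  - by move=> k p Ap; rewrite lee_fin.
  - by move=> p Ap i j ij; rewrite lee_fin; exact/lefP/nd_nnsfun_approx.
have -> : \int[mu]_(x in B) (f (phi x) * (w x)%:E) =
    limn (fun k => \int[mu]_(x in B) ((h k (phi x))%:E * (w x)%:E)).
  rewrite -monotone_convergence//.
  - apply: eq_integral => x /[!inE] Bx; apply/esym/cvg_lim => //; apply: cvgeZr => //.
    by apply: cvg_nnsfun_approx => //; exact: BA.
  - by move=> k; apply: emeasurable_funM.
  - by move=> k x Bx; rewrite mule_ge0 ?lee_fin// w0.
  - move=> x Bx i j ij; rewrite lee_wpmul2r ?lee_fin ?w0//.
    exact/lefP/nd_nnsfun_approx.
suff hk k : \int[nu]_(p in A) (h k p)%:E = \int[mu]_(x in B) ((h k (phi x))%:E * (w x)%:E).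
  by congr (limn _); apply/funext => k; exact: hk.
have mpre r : measurable (h k @^-1` [set r]) by [].
have mBpre r : measurable (B `&` phi @^-1` (h k @^-1` [set r])) by exact: mphi.
transitivity (\int[nu]_(p in A) (\sum_(y \in range (h k)) (y * \1_(h k @^-1` [set y]) p)%:E)).
  by apply: eq_integral => p _; rewrite fsumEFin// -fimfunE.
rewrite ge0_integral_fsum//; last 2 first.
- by move=> r; apply/measurable_EFinP; apply: measurable_funM.
- by move=> r p Ap; exact: nnfun_muleindic_ge0.
transitivity (\int[mu]_(x in B) (\sum_(y \in range (h k))
    ((y * \1_(h k @^-1` [set y]) (phi x))%:E * (w x)%:E))); last first.
  apply: eq_integral => x /[!inE] Bx.
  rewrite -ge0_mule_fsuml => [|y]; last exact: nnfun_muleindic_ge0.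
  by rewrite fsumEFin// -(fimfunE _ (phi x)).
rewrite ge0_integral_fsum//; last 2 first.
- move=> r; apply: emeasurable_funM => //.
  apply: (mcomp (fun p => (r * \1_(h k @^-1` [set r]) p)%:E)).
  by apply/measurable_EFinP; apply: measurable_funM.
- by move=> r x Bx; rewrite mule_ge0 ?lee_fin ?w0//; exact: nnfun_muleindic_ge0.
apply: eq_fsbigr => r /[!inE] rh.
have r0 : (0 <= r)%R by move: rh => [p _ <-].
rewrite integralZl_indic_nnsfun// integral_indic// setIC nuE//.
rewrite integral_mkcondr.
rewrite (eq_integral (fun x => (\1_(h k @^-1` [set r]) (phi x) * w x)%:E)); last first.
  move=> x _; rewrite patchE indicE -[X in (if X then _ else _) = _]/(x \in phi @^-1` (h k @^-1` [set r])).
  have -> : (phi x \in h k @^-1` [set r]) = (x \in phi @^-1` (h k @^-1` [set r])).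
    by apply/idP/idP => /set_mem H; exact/mem_set.
  by case: (x \in _); rewrite ?mul1r ?mul0r.
rewrite -ge0_integralZl//.
- by apply: eq_integral => x _; rewrite -!EFinM mulrA.
- apply/measurable_EFinP; apply: measurable_funM => //; apply/measurable_EFinP.
  apply: (mcomp (fun p => (\1_(h k @^-1` [set r]) p)%:E)).
  by apply/measurable_EFinP.
- by move=> x Bx; rewrite lee_fin mulr_ge0 ?w0// indicE.
Qed.

End density_transfer.

Section chart_integral.
Context {R : realType} {n : nat} {M : ptopologicalType}.
Variable S : smooth_manifold R n M.
Variables (O : set M) (g : M -> 'M[R]_n) (vol : {measure set (borel (M := M)) -> \bar R}).
Hypotheses (oO : open O) (gR : riemannian_metric S O g)
  (volE : volume_element S O g vol).
Local Notation rV := (borel (M := 'rV[R]_n)).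
Local Notation BM := (borel (M := M)).

Definition density (a : chart R n M) (x : 'rV[R]_n) : R :=
  Num.sqrt (\det (gram S g a (chart_inv a x))).

Variable a : chart R n M.
Hypothesis Sa : atlas S a.

Let V := chart_map a @` (chart_dom a `&` O).
Let oV : open V. Proof. exact: open_chart_image. Qed.

Let cinv x : V x -> {for x, continuous (chart_inv a)}.
Proof. by move=> [p [ap _] <-]; apply: chart_inv_cont; exists p. Qed.

Lemma continuous_density x : V x -> {for x, continuous (density a)}.
Proof.
move=> Vx.
have c : {for x, continuous (fun x => \det (gram S g a (chart_inv a x)))}.
  by apply: continuous_det => i j; apply: (continuous_gram gR).
exact: (continuous_comp c (@sqrt_continuous R _)).
Qed.

Lemma density_gt0 x : V x -> 0 < density a x.
Proof.
by move=> [p [ap Op] <-]; rewrite sqrtr_gt0 chart_mapK// (det_gram_gt0 gR).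
Qed.

Section image.
Variable A : set M.
Hypotheses (mA : measurable (A : set BM)) (AD : A `<=` chart_dom a `&` O).

Let AV : chart_map a @` A `<=` V.
Proof. by move=> _ [p Ap <-]; exists p => //; exact: AD. Qed.

Lemma chart_imageE : chart_map a @` A = V `&` chart_inv a @^-1` A.
Proof.
apply/seteqP; split=> [x [p Ap <-]|x [[p [ap Op] <-] Apx]].
  by split; [apply: AV; exists p|rewrite /preimage/= chart_mapK//; have [] := AD Ap].
by exists (chart_inv a (chart_map a p)) => //; rewrite chart_mapK.
Qed.

Lemma measurable_chart_inv : measurable_fun (V : set rV) (chart_inv a : rV -> BM).
Proof. exact: continuous_on_borel. Qed.

Lemma measurable_chart_image : measurable (chart_map a @` A : set rV).
Proof.
by rewrite chart_imageE; apply: measurable_chart_inv => //; exact: open_borel.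
Qed.

Lemma measurable_density : measurable_fun (chart_map a @` A : set rV) (density a).
Proof.
apply: (continuous_measurable_sub oV AV measurable_chart_image) => x.
exact: continuous_density.
Qed.

Lemma vol_chart : vol A = (\int[lebesgue_rV n]_(x in chart_map a @` A) (density a x)%:E)%E.
Proof.
rewrite (volE Sa mA AD) integral_mkcond.
have hE : (fun x : 'rV[R]_n => (\1_(chart_map a @` A) x *
    Num.sqrt (\det (gram S g a (chart_inv a x))))%:E) =
    ((fun x => (density a x)%:E) \_ (chart_map a @` A)).
  apply/funext => x; rewrite patchE indicE.
  by case: ifP => _; rewrite ?mul1r ?mul0r.
rewrite hE lebesgue_intE//.
- have mimg := measurable_chart_image.
  apply/(@measurable_restrictT _ _ rV _ _ _ mimg).
  by apply/measurable_EFinP; exact: measurable_density.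
- by move=> x; rewrite patchE; case: ifP => // _; rewrite lee_fin sqrtr_ge0.
Qed.

End image.

Lemma ge0_integral_chart (A : set M) (f : M -> \bar R) :
  measurable (A : set BM) -> A `<=` chart_dom a `&` O ->
  measurable_fun (A : set BM) f -> (forall p, A p -> 0 <= f p)%E ->
  (\int[vol]_(p in A) f p =
   \int[lebesgue_rV n]_(x in chart_map a @` A) (f (chart_inv a x) * (density a x)%:E))%E.
Proof.
move=> mA AD mf f0.
apply: (@ge0_integral_density_transfer _ _ BM rV) => //.
- exact: measurable_chart_image.
- apply: (@measurable_funS _ _ rV BM V) => //; first exact: open_borel.
  + by move=> _ [p Ap <-]; exists p => //; exact: AD.
  + exact: measurable_chart_inv.
- by move=> _ [p Ap <-]; rewrite chart_mapK//; have [] := AD _ Ap.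
- exact: measurable_density.
- by move=> x _; exact: sqrtr_ge0.
- move=> C mC; rewrite vol_chart//; last 2 first.
  + exact: measurableI.
  + by move=> p [Ap _]; exact: AD.
  congr (integral _ _ _); apply/seteqP; split=> [_ [p [Ap Cp] <-]|x [[p Ap <-] Cp]].
    by split; [exists p|rewrite /preimage/= chart_mapK//; have [] := AD _ Ap].
  exists p => //; split=> //; move: Cp; rewrite /preimage/= chart_mapK//.
  by have [] := AD _ Ap.
Qed.

End chart_integral.

(** * Poincare sets and gluing *)

Section poincare_sets.
Context {R : realType} {n : nat} {M : ptopologicalType}.
Variable S : smooth_manifold R n M.
Variables (O : set M) (g : M -> 'M[R]_n) (vol : {measure set (borel (M := M)) -> \bar R}).
Hypotheses (oO : open O) (gR : riemannian_metric S O g)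
  (cM : compact [set: M]).
Local Notation rV := (borel (M := 'rV[R]_n)).
Local Notation BM := (borel (M := M)).

Lemma smooth_fun_continuous u p : smooth_fun S u -> {for p, continuous u}.
Proof.
move=> su; have [Sc cp] := chart_atP S p; set c := chart_at S p in Sc cp.
apply: (@continuous_near _ _ ((u \o chart_inv c) \o chart_map c)).
  have : nbhs p (chart_dom c) by apply: open_nbhs_nbhs; split=> //; exact: chart_dom_open.
  by apply: filterS => q cq /=; rewrite chart_mapK.
apply: continuous_on_chart => //.
have [+ _] := smooth_C1 (su c Sc); apply; exact: chart_mapP.
Qed.

Lemma measurable_smooth_fun u (A : set M) : smooth_fun S u -> measurable_fun (A : set BM) u.
Proof.
move=> su; apply: measurable_funTS; apply: continuous_on_measurable; first exact: openT.
by move=> p _; exact: smooth_fun_continuous.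
Qed.

(** Measurability is known on each chart domain; compactness of M covers it by
    finitely many of them. *)
Lemma measurable_tangent_norm2 X : measurable_field S O X ->
  measurable_fun (O : set BM) (fun p => tangent_norm2 g p (X p)).
Proof.
move=> mX.
have [D' _ covM] : finite_subset_cover [set: M] (fun q => chart_dom (chart_at S q)) [set: M].
  have cM' : cover_compact [set: M] by rewrite -compact_cover.
  apply: cM' => [q _|q _]; first exact: chart_dom_open.
  by exists q => //; have [] := chart_atP S q.
have OE : O = \bigcup_(q in [set` D']) (chart_dom (chart_at S q) `&` O).
  apply/seteqP; split=> [p Op|p [q _ []]//].
  by have [q Dq qp] := covM p I; exists q.
move=> mO Y mY; rewrite OE setI_bigcupl.
apply: fin_bigcup_measurable => // q Dq.
have [Sq _] := chart_atP S q.
apply: (measurable_qform_field oO gR Sq mX) => //.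
by apply: open_borel; apply: openI => //; exact: chart_dom_open.
Qed.

Definition energy u : \bar R :=
  (\int[vol]_(p in O) (tangent_norm2 g p (gradient S g u p))%:E)%E.

Lemma measurable_energy u : smooth_fun S u ->
  measurable_fun (O : set BM) (fun p => tangent_norm2 g p (gradient S g u p)).
Proof. by move=> su; apply: measurable_tangent_norm2; exact: (gradient_measurable_field oO gR). Qed.

Lemma energy_ge0 u : (0 <= energy u)%E.
Proof. by apply: integral_ge0 => p Op; rewrite lee_fin (tangent_norm2_ge0 gR). Qed.

(** The energy is taken over all of O rather than over V, so that gluing needs no
    bookkeeping of where the energy lies. *)
Definition poincare_set (V : set M) :=
  [/\ measurable (V : set BM), V `<=` O, (vol V < +oo)%E &
    exists2 C : R, 0 <= C & forall u, smooth_fun S u -> exists c : R,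
      (\int[vol]_(p in V) ((u p - c) ^+ 2)%:E <= C%:E * energy u)%E].

Lemma measurable_osc u c (A : set M) : smooth_fun S u ->
  measurable_fun (A : set BM) (fun p => (u p - c) ^+ 2).
Proof.
by move=> su; apply: measurable_funX; apply: measurable_funB => //; exact: measurable_smooth_fun.
Qed.

Lemma vol_le (A B : set M) : measurable (A : set BM) -> measurable (B : set BM) ->
  A `<=` B -> (vol A <= vol B)%E.
Proof. by move=> mA mB AB; apply: le_measure => //; exact/mem_set. Qed.

Lemma poincare_set_sub V W : poincare_set V -> measurable (W : set BM) -> W `<=` V ->
  poincare_set W.
Proof.
move=> [mV VO Voo [C C0 HC]] mW WV; split => //.
- exact: subset_trans VO.
- exact: le_lt_trans (vol_le mW mV WV) Voo.
exists C => // u su; have [c Hc] := HC u su; exists c.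
apply: le_trans Hc; apply: ge0_subset_integral => //.
- by apply/measurable_EFinP; exact: measurable_osc.
- by move=> p _; rewrite lee_fin sqr_ge0.
Qed.

(** If c and d are the constants of u on V and W, then (c - d)^2 times the volume
    of the overlap is bounded by the energy; hence c serves for W as well. *)
Lemma poincare_set_union V W : poincare_set V -> poincare_set W ->
  (0 < vol (V `&` W))%E -> poincare_set (V `|` W).
Proof.
move=> [mV VO Voo [C C0 HC]] [mW WO Woo [D D0 HD]] VW0.
have mVW : measurable (V `&` W : set BM) by exact: measurableI.
have VWoo : (vol (V `&` W) < +oo)%E.
  exact: le_lt_trans (vol_le mVW mV (@subIsetl _ _ _)) Voo.
have mU : measurable (V `|` W : set BM) by exact: measurableU.
have UE : V `|` W = V `|` (W `\` V).
  apply/seteqP; split=> p; last by case=> [|[]]; [left|right].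
  by case=> [|Wp]; [left|have [Vp|nVp] := pselect (V p); [left|right]].
have mWV : measurable (W `\` V : set BM) by exact: measurableD.
split=> //.
- by move=> p []; [exact: VO|exact: WO].
- apply: le_lt_trans (measureU2 _ mV mW) _; exact: lte_add_pinfty.
pose v := fine (vol (V `&` W)); pose w := fine (vol W).
have vE : vol (V `&` W) = v%:E by rewrite fineK// ge0_fin_numE.
have wE : vol W = w%:E by rewrite fineK// ge0_fin_numE.
have v0 : 0 < v by rewrite -lte_fin -vE.
have w0 : 0 <= w by rewrite -lee_fin -wE.
exists (C + 2 * D + 2 * w * (v^-1 * (2 * (C + D)))).
  by rewrite !addr_ge0// !mulr_ge0 ?invr_ge0 ?(ltW v0)// addr_ge0.
move=> u su; have [c Hc] := HC u su; have [d Hd] := HD u su; exists c.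
have E0 := energy_ge0 u.
have mo e (A : set M) : measurable_fun (A : set BM) (fun p => (u p - e) ^+ 2) by exact: measurable_osc.
have moE e (A : set M) : measurable_fun (A : set BM) (fun p => ((u p - e) ^+ 2)%:E).
  exact/measurable_EFinP.
have sub (A B : set M) e : measurable (A : set BM) -> measurable (B : set BM) -> A `<=` B ->
    (\int[vol]_(p in A) ((u p - e) ^+ 2)%:E <= \int[vol]_(p in B) ((u p - e) ^+ 2)%:E)%E.
  by move=> mA mB AB; apply: ge0_subset_integral => // p _; rewrite lee_fin sqr_ge0.
(* The two constants are close because V and W overlap. *)
have cd : (((c - d) ^+ 2)%:E <= (v^-1 * (2 * (C + D)))%:E * energy u)%E.
  have : ((((c - d) ^+ 2) * v)%:E <= (2 * (C + D))%:E * energy u)%E.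
    rewrite EFinM -vE -(integral_cst vol mVW) /=.
    have le1 : (\int[vol]_(p in V `&` W) ((cst ((c - d) ^+ 2)) p)%:E <=
        2%:E * \int[vol]_(p in V `&` W) ((u p - c) ^+ 2)%:E +
        2%:E * \int[vol]_(p in V `&` W) ((u p - d) ^+ 2)%:E)%E.
      apply: integral_le_lin2 => //; try by move=> p _; exact: sqr_ge0.
      move=> p _ /=; rewrite -subr_ge0 (_ : _ - _ = (2 * u p - c - d) ^+ 2) ?sqr_ge0//; ring.
    apply: (le_trans le1); rewrite mulrDr (EFinD (2 * C)) ge0_muleDl; last 2 first.
    - by rewrite lee_fin mulr_ge0.
    - by rewrite lee_fin mulr_ge0.
    rewrite !EFinM -!muleA; apply: leeD; apply: lee_wpmul2l => //.
      by apply: le_trans Hc; apply: sub => //; exact: subIsetl.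
    by apply: le_trans Hd; apply: sub => //; exact: subIsetr.
  move=> le1; rewrite (EFinM v^-1) -muleA lee_pdivlMl//.
  by rewrite -EFinM mulrC.
rewrite UE ge0_integral_setU//; last 2 first.
- by move=> p _; rewrite lee_fin sqr_ge0.
- by apply/disj_setPS => p [Vp [_ nVp]].
have w'0 : 0 <= 2 * w * (v^-1 * (2 * (C + D))).
  by rewrite !mulr_ge0 ?invr_ge0 ?(ltW v0)// addr_ge0.
rewrite -(addrA C) (EFinD C) ge0_muleDl ?lee_fin//; last by rewrite addr_ge0// mulr_ge0.
apply: leeD => //.
rewrite (EFinD (2 * D)) ge0_muleDl ?lee_fin//; last by rewrite mulr_ge0.
apply: (@le_trans _ _ (\int[vol]_(p in W) ((u p - c) ^+ 2)%:E)%E).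
  by apply: sub => //; exact: subDsetl.
have le2 : (\int[vol]_(p in W) ((u p - c) ^+ 2)%:E <=
    2%:E * \int[vol]_(p in W) ((u p - d) ^+ 2)%:E +
    2%:E * \int[vol]_(p in W) ((cst ((c - d) ^+ 2)) p)%:E)%E.
  apply: integral_le_lin2 => //; try by move=> p _; exact: sqr_ge0.
  move=> p _ /=; rewrite -subr_ge0 (_ : _ - _ = (u p - 2 * d + c) ^+ 2) ?sqr_ge0//; ring.
apply: (le_trans le2); apply: leeD.
  by rewrite EFinM -muleA; apply: lee_wpmul2l.
rewrite (integral_cst vol mW ((c - d) ^+ 2)%:E) wE (EFinM (2 * w)) -muleA.
rewrite (_ : 2%:E * (_ * w%:E) = (2 * w)%:E * ((c - d) ^+ 2)%:E)%E.
  by apply: lee_wpmul2l => //; rewrite lee_fin mulr_ge0.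
by rewrite -!EFinM mulrA mulrAC.
Qed.

End poincare_sets.

(** * Coordinate boxes *)

Section chart_estimates.
Context {R : realType} {n : nat} {M : ptopologicalType}.
Variable S : smooth_manifold R n M.
Variables (O : set M) (g : M -> 'M[R]_n) (vol : {measure set (borel (M := M)) -> \bar R}).
Hypotheses (oO : open O) (gR : riemannian_metric S O g)
  (volE : volume_element S O g vol) (cM : compact [set: M]).
Local Notation rV := (borel (M := 'rV[R]_n)).
Local Notation BM := (borel (M := M)).
Variable a : chart R n M.
Hypothesis Sa : atlas S a.
Local Notation V := (chart_map a @` (chart_dom a `&` O)).
Local Notation energy := (energy S O g vol).
Local Notation poincare_set := (poincare_set S O g vol).

(** Points of the chart domain with coordinates in B. The inverse map of the chart
    is arbitrary outside its image, so a preimage is used instead of an image. *)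
Definition chart_pull (B : set 'rV[R]_n) : set M := chart_dom a `&` chart_map a @^-1` B.

Lemma chart_pull_sub B : B `<=` V -> chart_pull B `<=` chart_dom a `&` O.
Proof.
move=> BV p [ap /BV[q [aq Oq] qp]]; split=> //.
by rewrite -(chart_mapK ap) -qp chart_mapK.
Qed.

Lemma image_chart_pull B : B `<=` V -> chart_map a @` chart_pull B = B.
Proof.
move=> BV; apply/seteqP; split=> [_ [p [_ Bp] <-]//|x Bx].
by have [p [ap _] px] := BV x Bx; exists p => //; split=> //; rewrite /preimage/= px.
Qed.

Lemma measurable_chart_pull B : measurable (B : set rV) -> measurable (chart_pull B : set BM).
Proof.
move=> mB; have oD := @chart_dom_open _ _ _ a.
have mm : measurable_fun (chart_dom a : set BM) (chart_map a : _ -> rV).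
  by apply: continuous_on_borel => // p; exact: chart_map_cont.
by apply: mm => //; exact: open_borel.
Qed.

Section pull.
Variable B : set 'rV[R]_n.
Hypotheses (mB : measurable (B : set rV)) (BV : B `<=` V).

Let VI : V `<=` chart_img a.
Proof. by move=> _ [p [ap _] <-]; exists p. Qed.

Let mA := measurable_chart_pull mB.

Let domB x : B x -> chart_dom a (chart_inv a x) /\ O (chart_inv a x).
Proof. by move=> /BV[p [ap Op] <-]; rewrite chart_mapK. Qed.

Let invB x : B x -> chart_map a (chart_inv a x) = x.
Proof. by move=> /BV[p [ap Op] <-]; rewrite chart_mapK. Qed.

Lemma measurable_density_on : measurable_fun (B : set rV) (density S g a).
Proof.
rewrite -{1}(image_chart_pull BV).
exact: (measurable_density oO gR Sa mA (chart_pull_sub BV)).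
Qed.

Lemma integral_chart_pull (f : M -> \bar R) :
  measurable_fun (chart_pull B : set BM) f -> (forall p, chart_pull B p -> 0 <= f p)%E ->
  (\int[vol]_(p in chart_pull B) f p =
   \int[lebesgue_rV n]_(x in B) (f (chart_inv a x) * (density S g a x)%:E))%E.
Proof.
move=> mf f0; rewrite (ge0_integral_chart oO gR volE Sa mA (chart_pull_sub BV) mf f0).
by rewrite image_chart_pull.
Qed.

Lemma smooth_fun_chart u : smooth_fun S u -> C1_on (chart_img a) (u \o chart_inv a).
Proof. by move=> su; exact: smooth_C1 (su a Sa). Qed.

(** The weighted Euclidean energy of u in the chart is bounded by the energy of
    the metric as soon as the weight, times an upper bound l of the form of
    the metric, is bounded by the volume density. The bound l may depend on the
    point: it blows up at a puncture, where w compensates it. *)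
Lemma energy_chart_ge u (w : 'rV[R]_n -> R) L : smooth_fun S u ->
  measurable_fun (B : set rV) w -> (forall x, B x -> 0 <= w x) -> 0 <= L ->
  (forall x, B x -> exists l, [/\ 0 <= l,
     forall v, qform (gram S g a (chart_inv a x)) v <= l * sqnorm v &
     w x * l <= L * density S g a x]) ->
  (\int[lebesgue_rV n]_(x in B) (w x * grad2 (u \o chart_inv a) x)%:E <= L%:E * energy u)%E.
Proof.
move=> su mw w0 L0 HL.
pose f p := tangent_norm2 g p (gradient S g u p).
have mfO : measurable_fun (O : set BM) f by exact: measurable_energy.
have AO : chart_pull B `<=` O by move=> p /(chart_pull_sub BV)[].
have mf : measurable_fun (chart_pull B : set BM) f.
  by apply: measurable_funS mfO => //; exact: open_borel.
have f0 p : O p -> 0 <= f p by move=> Op; exact: tangent_norm2_ge0 gR _ _ Op.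
apply: (@le_trans _ _ (L%:E * \int[vol]_(p in chart_pull B) (f p)%:E)%E); last first.
  apply: lee_wpmul2l => //; apply: ge0_subset_integral => //; first exact: open_borel.
  exact/measurable_EFinP.
rewrite integral_chart_pull; last 2 first.
- exact/measurable_EFinP.
- by move=> p Ap; rewrite lee_fin f0//; exact: AO.
under [X in (_ <= _ * X)%E]eq_integral do rewrite -EFinM.
have mfi : measurable_fun (B : set rV) (fun x => f (chart_inv a x)).
  apply: (@measurable_comp _ _ _ rV BM _ (chart_pull B)) => //.
  - by move=> _ [x Bx <-]; split; [have [] := domB Bx|rewrite /preimage/= invB].
  - apply: (@measurable_funS _ _ rV BM V) => //; first by apply: open_borel; exact: open_chart_image.
    exact: measurable_chart_inv.
apply: integral_le_lin1 => //.
- apply: measurable_funM => //.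
  apply: (C1_on_measurable_grad2 (@chart_img_open _ _ _ a)) => //; first exact: subset_trans VI.
  exact: smooth_fun_chart.
- apply: measurable_funM => //; exact: measurable_density_on.
- by move=> x Bx; rewrite mulr_ge0 ?grad2_ge0 ?w0.
- by move=> x Bx; rewrite mulr_ge0 ?sqrtr_ge0// f0//; have [] := domB Bx.
move=> x Bx; have [l [l0 Hl wl]] := HL x Bx; have [ax Ox] := domB Bx.
have := chart_grad_le gR su Sa ax Ox l0 Hl.
rewrite sqnorm_chart_grad invB// -/(f _) => le1.
apply: (le_trans (ler_wpM2l (w0 _ Bx) le1)).
by rewrite mulrA [f _ * _]mulrC mulrA ler_wpM2r// f0.
Qed.

Lemma osc_chart_le u c (w : 'rV[R]_n -> R) K : smooth_fun S u ->
  measurable_fun (B : set rV) w -> (forall x, B x -> 0 <= w x) -> 0 <= K ->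
  (forall x, B x -> density S g a x <= K * w x) ->
  (\int[vol]_(p in chart_pull B) ((u p - c) ^+ 2)%:E <=
   K%:E * \int[lebesgue_rV n]_(x in B) (w x * ((u \o chart_inv a) x - c) ^+ 2)%:E)%E.
Proof.
move=> su mw w0 K0 HK.
rewrite integral_chart_pull; last 2 first.
- apply/measurable_EFinP; exact: (measurable_osc c su).
- by move=> p _; rewrite lee_fin sqr_ge0.
under eq_integral do rewrite -EFinM.
have mu : measurable_fun (B : set rV) (fun x => ((u \o chart_inv a) x - c) ^+ 2).
  have [mu _] := C1_on_measurable (@chart_img_open _ _ _ a) (subset_trans BV VI) mB (smooth_fun_chart su).
  by apply: measurable_funX; apply: measurable_funB.
apply: integral_le_lin1 => //.
- by apply: measurable_funM => //; exact: measurable_density_on.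
- exact: measurable_funM.
- by move=> x _; rewrite mulr_ge0 ?sqr_ge0 ?sqrtr_ge0.
- by move=> x Bx; rewrite mulr_ge0 ?sqr_ge0 ?w0.
move=> x Bx; rewrite mulrC mulrA ler_wpM2r ?sqr_ge0//; exact: HK.
Qed.

Lemma vol_pull : vol (chart_pull B) = (\int[lebesgue_rV n]_(x in B) (density S g a x)%:E)%E.
Proof. by rewrite (vol_chart oO gR volE Sa mA (chart_pull_sub BV)) image_chart_pull. Qed.

End pull.

Section box.
Variables (al be : 'rV[R]_n).
Hypotheses (ab : forall i, al 0 i < be 0 i) (BV : box al be `<=` V).

Let ne : box al be !=set0.
Proof. by exists al => i; rewrite lexx ltW. Qed.

Let bnd (h : 'rV[R]_n -> R) : (forall x, V x -> {for x, continuous h}) ->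
  exists K : R, forall y, box al be y -> h y <= K.
Proof.
move=> ch; have [|x xab Hx] := compact_EVT_max ne (@compact_box _ _ al be) (f := h).
  by apply: continuous_in_subspaceT => x /set_mem /BV; exact: ch.
by exists (h x) => y yab; apply: Hx; exact: mem_set.
Qed.

Lemma density_box_lower : exists2 k : R, 0 < k & forall x, box al be x -> k <= density S g a x.
Proof.
have [|x xab Hx] := compact_EVT_min ne (@compact_box _ _ al be) (f := density S g a).
  by apply: continuous_in_subspaceT => x /set_mem /BV; exact: (continuous_density gR).
exists (density S g a x); first exact: (density_gt0 gR Sa) (BV (set_mem xab)).
by move=> y yab; apply: Hx; exact: mem_set.
Qed.

Lemma vol_box_gt0 : (0 < vol (chart_pull (box al be)))%E.
Proof.
have [k k0 Hk] := density_box_lower.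
have /andP[l0 _] := @lebesgue_box R n _ _ ab.
rewrite vol_pull//.
apply: (@lt_le_trans _ _ (\int[lebesgue_rV n]_(x in box al be) (cst k x)%:E)%E).
  by rewrite (integral_cst (lebesgue_rV n) (measurable_box al be) k%:E) mule_gt0// lte_fin.
rewrite -[leRHS]mul1e; apply: integral_le_lin1 => //.
- exact: measurable_density_on.
- by move=> x _; rewrite /cst ltW.
- by move=> x _; exact: sqrtr_ge0.
- by move=> x xab; rewrite mul1r Hk.
Qed.

(** On a compact box the volume density and the entries of the metric are bounded
    and the density is bounded below, so that the Euclidean inequality
    transfers. *)
Lemma poincare_box : poincare_set (chart_pull (box al be)).
Proof.
have [k k0 Hk] := density_box_lower.
have [K HK] := bnd (fun x => continuous_density gR Sa (x := x)).
have cG x : V x -> {for x, continuous (fun x => \sum_i \sum_j `|gram S g a (chart_inv a x) i j|)}.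
  move=> Vx; apply: continuous_sum => i _; apply: continuous_sum => j _.
  apply: (@continuous_comp _ _ _ (fun x => gram S g a (chart_inv a x) i j) Num.norm).
    by have m := @continuous_gram _ _ _ _ _ _ gR _ x i j Sa Vx; exact: m.
  exact: norm_continuous.
have [L HL] := bnd cG.
have [C C0 HC] := box_poincare ab.
have al_in : box al be al by move=> i; rewrite lexx ltW.
have K0 : 0 <= K by apply: le_trans (HK _ al_in); exact: sqrtr_ge0.
have L0 : 0 <= L by apply: le_trans (HL _ al_in); do 2 apply: sumr_ge0 => ? _.
have /andP[_ loo] := @lebesgue_box R n _ _ ab.
split.
- exact: measurable_chart_pull.
- by move=> p /(chart_pull_sub BV)[].
- rewrite vol_pull//.
  apply: (@le_lt_trans _ _ (K%:E * \int[lebesgue_rV n]_(x in box al be) (cst 1 x)%:E)%E).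
    apply: integral_le_lin1 => //.
    + exact: measurable_density_on.
    + by move=> x _; exact: sqrtr_ge0.
    + by move=> x xab; rewrite mulr1 HK.
  by rewrite (integral_cst (lebesgue_rV n) (measurable_box al be) 1%:E) mul1e lte_mul_pinfty.
exists (K * (C * (k^-1 * L))); first by rewrite !mulr_ge0// invr_ge0 ltW.
move=> u su.
have VI : V `<=` chart_img a by move=> _ [p [ap _] <-]; exists p.
have [c Hc] := HC _ _ (@chart_img_open _ _ _ a) (subset_trans BV VI) (smooth_fun_chart su).
exists c.
have := @osc_chart_le _ (measurable_box al be) BV u c (cst 1) K su (measurable_cst _) (fun _ _ => ler01) K0.
move=> /(_ _)/wrap[|le1]; first by move=> x xab; rewrite /cst mulr1 HK.
apply: (le_trans le1); rewrite EFinM -muleA; apply: lee_wpmul2l => //.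
under eq_integral do rewrite /cst mul1r.
apply: (le_trans Hc); rewrite EFinM -muleA; apply: lee_wpmul2l => //.
have := @energy_chart_ge _ (measurable_box al be) BV u (cst 1) (k^-1 * L) su (measurable_cst _) (fun _ _ => ler01).
rewrite mulr_ge0 ?invr_ge0 ?(ltW k0)// => /(_ isT)/(_ _)/wrap[|le2].
  move=> x xab; exists L; split=> // [v|].
    by apply: (le_trans (qform_le_sum _ _)); rewrite ler_wpM2r ?sqnorm_ge0//; exact: HL.
  by rewrite /cst mul1r mulrAC ler_peMl// mulrC ler_pdivlMr// mul1r Hk.
apply: le_trans le2; rewrite le_eqVlt; apply/orP; left; apply/eqP.
by apply: eq_integral => x _; rewrite /cst mul1r.
Qed.

End box.
End chart_estimates.

(** * Cusps *)

Section cusp.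
Context {R : realType} {k : nat} {M : ptopologicalType}.
Local Notation n := k.+2.
Variable S : smooth_manifold R n M.
Variables (O : set M) (g : M -> 'M[R]_n) (vol : {measure set (borel (M := M)) -> \bar R}).
Hypotheses (oO : open O) (gR : riemannian_metric S O g)
  (volE : volume_element S O g vol) (cM : compact [set: M]).
Local Notation rV := (borel (M := 'rV[R]_n)).
Local Notation BM := (borel (M := M)).
Variables (a : chart R n M) (p0 : M) (c : R).
Hypotheses (Sa : atlas S a) (a0 : chart_map a p0 = 0)
  (imga : chart_img a = [set x | enorm x < 1])
  (aO : forall p, chart_dom a p -> (O p <-> p <> p0)) (c1 : 1 <= c)
  (Hc : forall p v, chart_dom a p -> O p ->
     c^-1 * ((cusp_scale (sqnorm (chart_map a p)) ^+ 2)^-1 * sqnorm v) <=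
     qform (gram S g a p) v <=
     c * ((cusp_scale (sqnorm (chart_map a p)) ^+ 2)^-1 * sqnorm v)).
Local Notation V := (chart_map a @` (chart_dom a `&` O)).
Local Notation energy := (energy S O g vol).
Local Notation poincare_set := (poincare_set S O g vol).
Local Notation pull := (chart_pull a).
Local Notation dens := (density S g a).

Let c0 : 0 < c. Proof. exact: lt_le_trans c1. Qed.

Let imgP (x : 'rV[R]_n) : sqnorm x < 1 -> chart_img a x.
Proof. by move=> x1; rewrite imga /= enormE -sqrtr1 ltr_sqrt. Qed.

Lemma punctured_ball_sub (x : 'rV[R]_n) : 0 < sqnorm x < 1 -> V x.
Proof.
move=> /andP[x0 x1]; have [p ap px] := imgP x1; exists p => //; split=> //.
by apply/(aO ap) => pp0; move: x0; rewrite -px pp0 a0 sqnormE mul0mx mxE ltxx.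
Qed.

Let K := Num.sqrt c ^+ n.

Let K_gt0 : 0 < K. Proof. by rewrite exprn_gt0// sqrtr_gt0. Qed.

(** The form lies between c^-1 P^-2 and c P^-2 times the Euclidean one, so its
    determinant lies between the n-th powers of these numbers. *)
Lemma density_cusp (x : 'rV[R]_n) : 0 < sqnorm x < 1 ->
  K^-1 * cusp_weight n (sqnorm x) <= dens x <= K * cusp_weight n (sqnorm x).
Proof.
move=> x01; have [p [ap Op] px] := punctured_ball_sub x01.
have xx : 0 < sqnorm x <= 1 by case/andP: x01 => -> /ltW.
rewrite /density /cusp_weight -px chart_mapK//; rewrite -px in xx.
have P0 := cusp_scale_gt0 xx; have := fun v => Hc v ap Op.
move: (cusp_scale (sqnorm (chart_map a p))) P0 => P P0 H.
have cP0 : 0 < c^-1 / P ^+ 2 by rewrite divr_gt0 ?invr_gt0// exprn_gt0.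
have /andP[d1 d2] : (c^-1 / P ^+ 2) ^+ n <= \det (gram S g a p) <= (c / P ^+ 2) ^+ n.
  by apply: det_bounds => // [|v]; [exact: (gram_sym gR)|rewrite -!mulrA; exact: H].
have sq b : 0 < b -> Num.sqrt ((b / P ^+ 2) ^+ n) = Num.sqrt b ^+ n / P ^+ n.
  move=> b0; rewrite -expr_div_n.
  rewrite (_ : (b / P ^+ 2) ^+ n = ((Num.sqrt b / P) ^+ n) ^+ 2).
    by rewrite sqrtr_sqr ger0_norm// exprn_ge0// divr_ge0 ?sqrtr_ge0// ltW.
  by rewrite [RHS]exprAC [in RHS]expr_div_n sqr_sqrtr// ltW.
have Kc : K^-1 = Num.sqrt c^-1 ^+ n by rewrite sqrtrV ?ltW// exprVn.
rewrite Kc -!sq ?invr_gt0//.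
have D0 : 0 <= \det (gram S g a p) by apply: le_trans d1; rewrite exprn_ge0// ltW.
by rewrite !ler_wsqrtr.
Qed.

Lemma chart_pullU A B : pull (A `|` B) = pull A `|` pull B.
Proof. by rewrite /chart_pull preimage_setU setIUr. Qed.

Section slabs.
Variables (s b : R).
Hypotheses (s0 : 0 < s) (ns : n%:R * s ^+ 2 <= 4^-1) (b0 : 0 < b) (bs : b < s).
Implicit Types (i j l : 'I_n) (e : bool).

Lemma cbox_punctured_sub x : cbox n s x -> x != 0 -> V x.
Proof.
move=> xs x0; apply: punctured_ball_sub; rewrite lt_neqAle eq_sym sqnorm_eq0 x0 sqnorm_ge0/=.
by have := le_trans (sqnorm_cbox xs) ns; lra.
Qed.

(** The slab (i, e) consists of the points of the box whose i-th coordinate is at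
    least b, for e true, or at most -b. *)
Definition slab_lo i e : 'rV[R]_n := \row_j if (j == i) && e then b else - s.
Definition slab_hi i e : 'rV[R]_n := \row_j if (j == i) && ~~ e then - b else s.
Definition slab (ie : 'I_n * bool) := box (slab_lo ie.1 ie.2) (slab_hi ie.1 ie.2).

Lemma slab_lt i e l : slab_lo i e 0 l < slab_hi i e 0 l.
Proof. by rewrite !mxE; case: e; case: (l == i) => /=; move: s0 b0 bs; lra. Qed.

Lemma slab_cbox ie : slab ie `<=` cbox n s.
Proof.
move=> x + j; move=> /(_ j); rewrite !mxE.
by case: ie => i [] /=; case: (j == i) => /= /andP[]; move: s0 b0 bs; lra.
Qed.

Lemma slab_neq0 ie x : slab ie x -> x != 0.
Proof.
case: ie => i e /(_ i); apply: contraPneq => ->; rewrite !mxE eqxx /= => /andP[].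
by case: (e) => /=; move: b0 s0; lra.
Qed.

Lemma slab_sub ie : slab ie `<=` V.
Proof. by move=> x xi; apply: cbox_punctured_sub; [exact: slab_cbox xi|exact: slab_neq0 xi]. Qed.

Lemma measurable_slab ie : measurable (pull (slab ie) : set BM).
Proof. exact: (measurable_chart_pull a (measurable_box (slab_lo ie.1 ie.2) (slab_hi ie.1 ie.2))). Qed.
Hint Resolve measurable_slab : core.

(** The two opposite slabs of one direction are disjoint; that slabs in different
    directions meet is why the dimension has to be at least 2. *)
Lemma slab_overlap i e j e' : i != j ->
  (0 < vol (pull (slab (i, e)) `&` pull (slab (j, e'))))%E.
Proof.
move=> ij.
pose lo : 'rV[R]_n := \row_l if ((l == i) && e) || ((l == j) && e') then b else - s.
pose hi : 'rV[R]_n := \row_l if ((l == i) && ~~ e) || ((l == j) && ~~ e') then - b else s.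
have lohi l : lo 0 l < hi 0 l.
  rewrite !mxE; have [->|li] := eqVneq l i; rewrite ?(negbTE ij).
    by case: (e) => /=; move: s0 b0 bs; lra.
  by case: (l == j); case: (e') => /=; move: s0 b0 bs; lra.
have H1 : box lo hi `<=` slab (i, e).
  move=> x H l; have := H l; rewrite !mxE.
  by case: (l == i); case: (l == j); case: (e); case: (e') => //= /andP[]; move: s0 b0 bs; lra.
have H2 : box lo hi `<=` slab (j, e').
  move=> x H l; have := H l; rewrite !mxE.
  by case: (l == i); case: (l == j); case: (e); case: (e') => //= /andP[]; move: s0 b0 bs; lra.
apply: lt_le_trans (vol_box_gt0 oO gR volE Sa lohi (subset_trans H1 (@slab_sub _))) _.
apply: vol_le; first exact: (measurable_chart_pull a (measurable_box lo hi)).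
  exact: measurableI.
by move=> x [ax Hx]; split; split=> //; [exact: H1|exact: H2].
Qed.

Lemma poincare_slab ie : poincare_set (pull (slab ie)).
Proof. by apply: poincare_box => //; [exact: slab_lt|exact: slab_sub]. Qed.

(** The positive slabs of the first two directions form the seed: every slab meets
    the one whose direction is not its own. *)
Lemma poincare_slabs (r : seq ('I_n * bool)) :
  poincare_set (pull (slab (ord0, true) `|` slab (lift ord0 ord0, true) `|`
                      \big[setU/set0]_(ie <- r) slab ie)).
Proof.
pose i0 : 'I_n := ord0; pose i1 : 'I_n := lift ord0 ord0.
elim: r => [|[j e] r ih].
  rewrite big_nil setU0 chart_pullU.
  by apply: poincare_set_union => //; [exact: poincare_slab|exact: poincare_slab|exact: slab_overlap].
set T := (X in pull X) in ih.
rewrite (_ : _ `|` _ = T `|` slab (j, e)); last first.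
  by rewrite /T big_cons (setUC (slab (j, e))) setUA.
rewrite chart_pullU.
apply: poincare_set_union => //; first exact: poincare_slab.
have [i ij Ti] : exists2 i, i != j & slab (i, true) `<=` T.
  have [->|j0] := eqVneq j i0; first by exists i1 => //; move=> x ?; left; right.
  by exists i0; [rewrite eq_sym|move=> x ?; left; left].
apply: lt_le_trans (slab_overlap true e ij) _; apply: vol_le.
- exact: measurableI.
- by apply: measurableI; [case: ih|].
by move=> p [[ap sp] [_ sp']]; split; split=> //; exact: Ti.
Qed.

(** A point outside the small box has a coordinate of size larger than b. *)
Lemma poincare_annulus : poincare_set (pull (cbox n s `\` cbox n b)).
Proof.
apply: poincare_set_sub (poincare_slabs (enum [set: 'I_n * bool]%SET)) _ _.
  exact: (measurable_chart_pull a (measurableD (measurable_box _ _) (measurable_box _ _))).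
move=> p [ap [xs xb]]; split=> //; right; rewrite -bigcup_seq.
have [i xi] : exists i, b < `|chart_map a p 0 i|.
  apply: contrapT => H; apply: xb; apply/cboxP => i.
  by rewrite leNgt; apply/negP => xi; apply: H; exists i.
exists (i, 0 <= chart_map a p 0 i); first by rewrite /= mem_enum inE.
move: xs => /cboxP xs j; have := xs j; rewrite !mxE ler_norml => /andP[x1 x2].
move: xi; case: (leP 0 (chart_map a p 0 i)) => xi; case: eqVneq => [->|_] /=; rewrite ?x1 ?x2//.
- by rewrite ger0_norm// => /ltW ->; have := xs i; rewrite ler_norml => /andP[].
- by rewrite ltr0_norm// ltrNr => /ltW ->; have := xs i; rewrite ler_norml => /andP[->].
Qed.

End slabs.

Lemma C1_on_cst (r : R) : C1_on setT (cst r : 'rV[R]_n -> R).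
Proof.
split=> [x _|i]; first exact: cst_continuous.
split=> [x _|x _]; first exact: derivable_cst.
apply: (@continuous_ext _ _ (cst 0)) => [y|]; first by rewrite derive_cst.
exact: cst_continuous.
Qed.

(** The constant that the annulus assigns to u is inserted into the Hardy
    inequality. The latter for u = 1 and c = 0 has no energy term and bounds the
    volume of the cusp. *)
Lemma poincare_cusp : exists2 s, 0 < s & poincare_set (pull (cbox n s `\ 0)).
Proof.
have n0 : 0 < n%:R :> R by [].
have n1 : 1 <= n%:R :> R by rewrite ler1n.
pose s : R := (2 * n%:R)^-1.
have s0 : 0 < s by rewrite invr_gt0 mulr_gt0.
have ns : n%:R * s ^+ 2 <= 4^-1.
  have sn : n%:R * s = 2^-1 by rewrite /s invfM mulrCA mulfV ?mulr1// gt_eqF.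
  rewrite expr2 mulrA sn (_ : 4 = 2 * 2)// ?invfM; last by ring.
  by rewrite ler_pM2l// lef_pV2 ?posrE ?mulr_gt0// ler_peMr.
have [b /andP[b0 bs] [C C0 HC]] := hardy_box s0 ns.
exists s => //; set B := cbox n s `\ 0.
have mB : measurable (B : set rV).
  by apply: measurableD; [exact: measurable_box|exact: measurable_origin].
have B01 x : B x -> 0 < sqnorm x < 1.
  move=> [xs /eqP x0]; rewrite lt_neqAle eq_sym sqnorm_eq0 x0 sqnorm_ge0/=.
  by have := le_trans (sqnorm_cbox xs) ns; lra.
have BV : B `<=` V by move=> x /B01; exact: punctured_ball_sub.
have mA : measurable (cbox n s `\` cbox n b : set rV) by apply: measurableD; exact: measurable_box.
have AB : cbox n s `\` cbox n b `<=` B.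
  move=> x [xs xb]; split=> // x0; apply: xb; rewrite x0; apply/cboxP => i.
  by rewrite mxE normr0 ltW.
have AV := subset_trans AB BV.
have W0 j x : B x -> 0 <= cusp_weight j (sqnorm x).
  by move=> /B01/andP[x0 x1]; rewrite ltW// cusp_weight_gt0// x0 ltW.
have mW j := measurable_cusp_weight j mB B01.
have dW x : B x -> dens x <= K * cusp_weight n (sqnorm x).
  by move=> /B01/density_cusp/andP[].
split.
- exact: measurable_chart_pull.
- by move=> p /(chart_pull_sub BV)[].
- rewrite (vol_pull oO gR volE Sa mB BV).
  apply: (@le_lt_trans _ _ (K%:E * \int[lebesgue_rV n]_(x in B) (cusp_weight n (sqnorm x))%:E)%E).
    apply: integral_le_lin1 => //.
    + exact: (measurable_density_on oO gR Sa mB BV).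
    + by move=> x _; exact: sqrtr_ge0.
    + exact: W0.
    + exact: ltW.
  rewrite lte_mul_pinfty ?lee_fin ?(ltW K_gt0)//.
  have := HC setT (cst 1) 0 openT (@subsetT _ _) (C1_on_cst 1).
  rewrite -/B (eq_integral (fun x : rV => (cusp_weight n (sqnorm (x : 'rV[R]_n)))%:E)); last first.
    by move=> x _; rewrite /cst subr0 expr1n mulr1.
  move=> /le_lt_trans; apply.
  rewrite (eq_integral (cst 0%E : rV -> \bar R)); last first.
    by move=> x _; rewrite /grad2 big1 ?mulr0// => i _; rewrite derive_cst expr0n.
  rewrite integral0 add0e lte_mul_pinfty//.
  rewrite (eq_integral (cst 1%E : rV -> \bar R)); last by move=> x _; rewrite /cst subr0 expr1n.
  rewrite (integral_cst (lebesgue_rV n) mA 1%E) mul1e.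
  have /andP[_ loo] : (0 < lebesgue_rV n (cbox n s) < +oo)%E.
    by apply: lebesgue_box => i; rewrite !mxE; move: s0; lra.
  by apply: le_lt_trans loo; apply: le_measure; [exact/mem_set|apply/mem_set; exact: (measurable_box (const_mx (- s)) (const_mx s))|exact: subDsetl].
have [_ _ _ [D D0 HD]] := poincare_annulus s0 ns b0 bs.
have cK0 : 0 <= c * K by rewrite mulr_ge0 ?(ltW c0)// ltW.
have KD0 : 0 <= K * D by rewrite mulr_ge0// ltW.
exists (K * (C * (c * K + K * D))); first by apply: mulr_ge0; [exact: ltW|apply: mulr_ge0 => //; exact: addr_ge0].
move=> u su; have [e He] := HD u su; exists e.
have Cu := smooth_fun_chart Sa su.
have sI : cbox n s `<=` chart_img a.
  by move=> x xs; apply: imgP; have := le_trans (sqnorm_cbox xs) ns; lra.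
have Hu := HC _ _ e (@chart_img_open _ _ _ a) sI Cu.
have le1 := osc_chart_le oO gR volE Sa mB BV e su (mW n) (W0 n) (ltW K_gt0) dW.
apply: (le_trans le1); rewrite (EFinM K) -muleA; apply: lee_wpmul2l => //; first by rewrite lee_fin ltW.
apply: (le_trans Hu); rewrite (EFinM C) -muleA; apply: lee_wpmul2l => //.
rewrite (EFinD (c * K)) ge0_muleDl ?lee_fin//; apply: leeD.
  apply: (energy_chart_ge oO gR volE cM Sa mB BV su (mW k) (W0 k) cK0) => x Bx.
  have /B01/andP[x0 x1] := Bx; have xx : 0 < sqnorm x <= 1 by rewrite x0 ltW.
  have P0 := cusp_scale_gt0 xx.
  have [p [ap Op] px] := BV x Bx.
  exists (c * (cusp_scale (sqnorm x) ^+ 2)^-1); split.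
  + by rewrite mulr_ge0 ?(ltW c0)// invr_ge0 sqr_ge0.
  + by move=> v; rewrite -px chart_mapK// -mulrA; have /andP[] := Hc v ap Op.
  have /density_cusp/andP[dl _] := B01 x Bx.
  rewrite -(cusp_scale2_weight k xx) mulrCA (mulrC (_ ^+ 2)) mulfK ?expf_neq0 ?gt_eqF//.
  by rewrite -(mulrA c) ler_wpM2l ?(ltW c0)// -ler_pdivrMl.
apply: (@le_trans _ _ (K%:E * \int[vol]_(p in pull (cbox n s `\` cbox n b)) ((u p - e) ^+ 2)%:E)%E).
  rewrite (integral_chart_pull oO gR volE Sa mA AV); last 2 first.
  - by apply/measurable_EFinP; exact: (measurable_osc e su).
  - by move=> p _; rewrite lee_fin sqr_ge0.
  under [X in (_ <= _ * X)%E]eq_integral do rewrite -EFinM.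
  have mu : measurable_fun (cbox n s `\` cbox n b : set rV) (fun x => ((u \o chart_inv a) x - e) ^+ 2).
    have [mu _] := C1_on_measurable (@chart_img_open _ _ _ a) (subset_trans (@subDsetl _ _ _) sI) mA Cu.
    by apply: measurable_funX; apply: measurable_funB.
  apply: integral_le_lin1 => //.
  + by apply: measurable_funM => //; exact: (measurable_density_on oO gR Sa mA AV).
  + by move=> x _; exact: sqr_ge0.
  + by move=> x _; rewrite mulr_ge0 ?sqr_ge0 ?sqrtr_ge0.
  + exact: ltW.
  move=> x Ax; have /B01 x01 := AB x Ax; have /density_cusp/andP[dl _] := x01.
  have /andP[x0 x1] := x01.
  have w1 : 1 <= cusp_weight n (sqnorm x).
    by rewrite invr_ge1 ?unitfE ?gt_eqF ?exprn_gt0 ?exprn_ile1 ?cusp_scale_le1 ?ltW ?cusp_scale_gt0 ?x0 ?ltW.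
  rewrite mulrCA ler_peMr ?sqr_ge0//.
  by apply: le_trans w1 _; rewrite -ler_pdivrMl.
by rewrite (EFinM K) -muleA; apply: lee_wpmul2l => //; rewrite lee_fin ltW.
Qed.

End cusp.

(** * From local to global *)

Lemma nbhs_box (R : realType) n (x : 'rV[R]_n) (A : set 'rV[R]_n) : nbhs x A ->
  exists2 e : R, 0 < e & box (x - const_mx e) (x + const_mx e) `<=` A /\
    nbhs x (box (x - const_mx e) (x + const_mx e)).
Proof.
move=> /nbhs_ballP[e /= e0 eA].
have he : 0 < e / 2 by rewrite divr_gt0.
exists (e / 2) => //; split=> [y H|].
  apply: eA; split=> // i j; rewrite ord1 /ball/=; have := H j; rewrite !mxE ltr_distlC.
  by move: e0; lra.
apply/nbhs_ballP; exists (e / 2) => //= y [_ H] j; have := H 0 j; rewrite /ball/= !mxE ltr_distlC.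
by move=> /andP[]; rewrite /const_mx; lra.
Qed.

Section global.
Context {R : realType} {n : nat} {M : ptopologicalType}.
Variable S : smooth_manifold R n M.
Variables (O : set M) (g : M -> 'M[R]_n) (vol : {measure set (borel (M := M)) -> \bar R}).
Hypotheses (oO : open O) (gR : riemannian_metric S O g)
  (volE : volume_element S O g vol) (cM : compact [set: M]).
Local Notation rV := (borel (M := 'rV[R]_n)).
Local Notation BM := (borel (M := M)).
Local Notation energy := (energy S O g vol).
Local Notation poincare_set := (poincare_set S O g vol).

Lemma vol_open_gt0 U : open U -> U !=set0 -> U `<=` O -> (0 < vol U)%E.
Proof.
move=> oU [p Up] UO; have [Sc cp] := chart_atP S p; set c := chart_at S p in Sc cp.
have : nbhs (chart_map c p) (chart_map c @` (chart_dom c `&` U)).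
  by apply: open_nbhs_nbhs; split; [exact: open_chart_image|exists p].
move=> /nbhs_box[e e0 [BU _]]; set al := _ - _ in BU; set be := _ + _ in BU.
have ab i : al 0 i < be 0 i by rewrite !mxE; move: e0; lra.
have BV : box al be `<=` chart_map c @` (chart_dom c `&` O).
  by move=> x /BU[q [cq Uq] <-]; exists q => //; split=> //; exact: UO.
apply: lt_le_trans (vol_box_gt0 oO gR volE Sc ab BV) _; apply: vol_le.
- exact: (measurable_chart_pull c (measurable_box al be)).
- exact: open_borel.
by move=> q [cq /BU[q' [cq' Uq'] qq']]; rewrite -(chart_mapK cq) -qq' chart_mapK.
Qed.

(** Neighbourhoods in M, which is compact and connected, are used to organize
    Poincare sets, which live in O. *)
Definition good (W : set M) := open W /\ poincare_set (W `&` O).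

Lemma good_chart_pull a (B D : set 'rV[R]_n) : poincare_set (chart_pull a D) ->
  (chart_pull a B `&` O `<=` chart_pull a D) -> good (chart_pull a (interior B)).
Proof.
move=> HD BD.
have oW : open (chart_pull a (interior B)).
  apply: continuous_on_open_preimage; [exact: chart_dom_open| |exact: open_interior].
  by move=> p; exact: chart_map_cont.
split=> //; apply: poincare_set_sub HD _ _.
  by apply: open_borel; exact: openI.
by move=> p [[ap /interior_subset Bp] Op]; apply: BD.
Qed.

Lemma good_interior p : O p -> exists2 W, good W & W p.
Proof.
move=> Op; have [Sc cp] := chart_atP S p; set c := chart_at S p in Sc cp.
have : nbhs (chart_map c p) (chart_map c @` (chart_dom c `&` O)).
  by apply: open_nbhs_nbhs; split; [exact: open_chart_image|exists p].
move=> /nbhs_box[e e0 []]; set al := _ - _; set be := _ + _ => BV nB.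
have ab i : al 0 i < be 0 i by rewrite !mxE; move: e0; lra.
exists (chart_pull c (interior (box al be))); last by [].
apply: good_chart_pull (poincare_box oO gR volE cM Sc ab BV) _ => q [] //.
Qed.

Hypotheses (connM : connected [set: M])
  (denseO : forall U, open U -> U !=set0 -> (U `&` O) !=set0)
  (goodM : forall p, exists2 W, good W & W p).

(** Overlapping open sets of M still overlap inside O, by density, and a nonempty
    open set has positive volume. *)
Lemma good_union W W' : good W -> good W' -> (W `&` W') !=set0 -> good (W `|` W').
Proof.
move=> [oW HW] [oW' HW'] WW'; split; first exact: openU.
rewrite setIUl; apply: poincare_set_union => //.
have oI : open (W `&` W') by exact: openI.
rewrite (_ : _ `&` _ = (W `&` W') `&` O); last by rewrite setIACA setIid.
by apply: vol_open_gt0; [exact: openI|exact: denseO|exact: subIsetr].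
Qed.

(** The points joined to the base point by a good set form a set that is open and
    closed, by [good_union]. *)
Lemma good_connect q : exists2 W, good W & W point /\ W q.
Proof.
pose D := [set q | exists2 W, good W & W point /\ W q].
suff DT : D = setT by have : D q by rewrite DT.
have D0 : D !=set0 by exists point; have [W gW Wp] := goodM point; exists W.
apply: connM => //.
  exists D; last by rewrite setTI.
  rewrite openE => r [W gW [Wp Wr]]; apply: (@filterS _ _ _ W) => [r' Wr'|]; first by exists W.
  by apply: open_nbhs_nbhs; split=> //; case: gW.
exists D; last by rewrite setTI.
rewrite -openC openE => r nDr; have [W gW Wr] := goodM r.
apply: (@filterS _ _ _ W) => [r' Wr' [W' gW' [W'p W'r']]|].
  apply: nDr; exists (W' `|` W); last by split; [left|right].
  by apply: good_union => //; exists r'.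
by apply: open_nbhs_nbhs; split=> //; case: gW.
Qed.

(** Good sets through the base point cover M, finitely many suffice, and they can
    be united one after the other since they share the base point. *)
Lemma poincare_global : poincare_set O.
Proof.
have H q : {W | good W & W point /\ W q} by exact/cid2/good_connect.
pose F q := s2val (H q).
have gF q : good (F q) by exact: s2valP.
have [Fp Fq] : (forall q, F q point) /\ (forall q, F q q).
  by split=> q; have [] := s2valP' (H q).
have cM' : cover_compact [set: M] by rewrite -compact_cover.
have [D _ covM] : finite_subset_cover [set: M] F [set: M].
  apply: cM' => [q _|q _]; first by have [] := gF q.
  by exists q.
have : good (F point `|` \big[setU/set0]_(q <- enum_fset D) F q).
  elim: (enum_fset D) => [|q r ih]; first by rewrite big_nil setU0.
  rewrite big_cons setUCA; apply: good_union => //.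
  by exists point; split=> //; left.
rewrite -bigcup_seq => -[_]; rewrite (_ : _ `|` _ = setT) ?setTI//.
by apply/seteqP; split=> // q _; right; exact: covM.
Qed.

End global.

(** * Functions of mean zero and the H^1 closure *)

Section mean_zero.
Context d (T : measurableType d) (R : realType).
Variables (mu : {measure set T -> \bar R}) (D : set T) (mD : measurable D).

Lemma ge0_integrable (f : T -> R) : measurable_fun D f -> (forall x, D x -> 0 <= f x) ->
  (\int[mu]_(x in D) (f x)%:E < +oo)%E -> mu.-integrable D (EFin \o f).
Proof.
move=> mf f0 foo; apply/integrableP; split; first exact/measurable_EFinP.
rewrite (eq_integral (fun x => (f x)%:E))// => x /set_mem Dx /=.
by rewrite ger0_norm// f0.
Qed.

(** The cross term of (f - c)^2 integrates to zero. If the right-hand side is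
    finite then f is square integrable, the volume being finite; otherwise there
    is nothing to prove. *)
Lemma mean_zero_min (f : T -> R) (c : R) : measurable_fun D f -> (mu D < +oo)%E ->
  (\int[mu]_(x in D) (f x)%:E = 0)%E ->
  (\int[mu]_(x in D) (f x ^+ 2)%:E <= \int[mu]_(x in D) ((f x - c) ^+ 2)%:E)%E.
Proof.
move=> mf Doo f0.
have [foo|] := ltP (\int[mu]_(x in D) ((f x - c) ^+ 2)%:E)%E +oo%E; last first.
  by rewrite leye_eq => /eqP ->; exact: leey.
have mh : measurable_fun D (fun x => (f x - c) ^+ 2).
  by apply: measurable_funX; apply: measurable_funB.
have mf2 : measurable_fun D (fun x => f x ^+ 2) by exact: measurable_funX.
have ih : mu.-integrable D (EFin \o (fun x => (f x - c) ^+ 2)).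
  by apply: ge0_integrable => // x _; exact: sqr_ge0.
have i1 (r : R) : 0 <= r -> mu.-integrable D (EFin \o cst r).
  move=> r0; apply: ge0_integrable => //.
  by rewrite (integral_cst mu mD r%:E) lte_mul_pinfty.
have if2 : mu.-integrable D (EFin \o (fun x => f x ^+ 2)).
  have i2 : mu.-integrable D (fun x => 2%:E * ((f x - c) ^+ 2)%:E)%E.
    exact: integrableZl.
  have c20 : 0 <= 2 * c ^+ 2 by rewrite mulr_ge0// sqr_ge0.
  have i3 := integrableD mD i2 (i1 _ c20).
  apply: (le_integrable mD _ _ i3); first exact/measurable_EFinP.
  move=> x _; rewrite /cst/= lee_fin !ger0_norm ?sqr_ge0//; last first.
    by rewrite addr_ge0// mulr_ge0// sqr_ge0.
  rewrite -subr_ge0 (_ : _ - _ = (f x - 2 * c) ^+ 2) ?sqr_ge0//; ring.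
have if1 : mu.-integrable D (EFin \o f).
  have i3 := integrableD mD if2 (i1 1 ler01).
  apply: (le_integrable mD _ _ i3); first exact/measurable_EFinP.
  move=> x _; rewrite /cst/= lee_fin [leRHS]ger0_norm ?addr_ge0 ?sqr_ge0//.
  by rewrite ler_norml; apply/andP; split; have := sqr_ge0 (f x + 1); have := sqr_ge0 (f x - 1); nra.
have icf : mu.-integrable D (fun x => (2 * c)%:E * (f x)%:E)%E by exact: integrableZl.
apply: (@le_trans _ _ (\int[mu]_(x in D) (((f x - c) ^+ 2)%:E + (2 * c)%:E * (f x)%:E))%E).
  apply: le_integral => //; first exact: integrableD.
  move=> x _ /=; rewrite -EFinM -EFinD lee_fin -subr_ge0 (_ : _ - _ = c ^+ 2) ?sqr_ge0//; ring.
by rewrite integralD// integralZl// [X in (_ + _ * X)%E]f0 mule0 adde0.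
Qed.

End mean_zero.

Lemma poweR_half_lt (R : realType) (A : \bar R) (e : R) : (0 <= A)%E -> 0 < e ->
  (A `^ 2^-1 < e%:E)%E -> (A <= (e ^+ 2)%:E)%E.
Proof.
move=> A0 e0 Ae; rewrite leNgt; apply/negP => eA; move: Ae; apply/negP; rewrite -leNgt.
have -> : e%:E = ((e ^+ 2)%:E `^ 2^-1)%E.
  by rewrite poweR_EFin powR12_sqrt ?sqr_ge0// sqrtr_sqr ger0_norm ?ltW.
apply: gt0_ler_poweR => //; last exact: ltW.
- by rewrite in_itv/= leey andbT lee_fin sqr_ge0.
- by rewrite in_itv/= leey andbT.
Qed.

Section closure.
Context {R : realType} {n : nat} {M : ptopologicalType}.
Variable S : smooth_manifold R n M.
Variables (O : set M) (g : M -> 'M[R]_n) (vol : {measure set (borel (M := M)) -> \bar R}).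
Hypotheses (oO : open O) (gR : riemannian_metric S O g)
  (cM : compact [set: M]).
Local Notation BM := (borel (M := M)).

Lemma measurable_fieldB X Y : measurable_field S O X -> measurable_field S O Y ->
  measurable_field S O (fun p => X p - Y p).
Proof.
move=> mX mY a i Sa; rewrite (_ : (fun p => _) =
    (fun p => components S a X p 0 i - components S a Y p 0 i)).
  by apply: measurable_funB; [exact: mX|exact: mY].
by apply/funext => p; rewrite /components mulmxBl !mxE.
Qed.

(** The difference of the two sides is the squared norm of 2 w - v. *)
Lemma tangent_norm2_le p v w : O p ->
  tangent_norm2 g p v <= 2 * tangent_norm2 g p w + 2 * tangent_norm2 g p (w - v).
Proof.
move=> Op; have := tangent_norm2_ge0 gR (w + (w - v)) Op.
pose B (x y : 'rV[R]_n) : R := (x *m g p *m y^T) 0 0; have BE x : tangent_norm2 g p x = B x x by [].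
have BDl x y z : B (x + y) z = B x z + B y z by rewrite /B !mulmxDl mxE.
have BDr x y z : B x (y + z) = B x y + B x z by rewrite /B linearD/= mulmxDr mxE.
have BNl x y : B (- x) y = - B x y by rewrite /B !mulNmx mxE.
have BNr x y : B x (- y) = - B x y by rewrite /B linearN/= mulmxN mxE.
rewrite !BE !(BDl, BDr, BNl, BNr); lra.
Qed.

(** With u close to f in H^1 within d and c the constant of u, the square of f is
    at most that of f - c, which is controlled by f - u and u - c; the energy of
    u is at most twice that of f plus 2 d^2. Let d tend to 0. *)
Lemma poincare_H1 : poincare_set S O g vol O ->
  exists2 lambda1 : R, 0 < lambda1 & forall f X, H1 S O g vol f X ->
    (\int[vol]_(p in O) (f p)%:E = 0)%E ->
    (\int[vol]_(p in O) (f p ^+ 2)%:E <=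
     lambda1^-1%:E * \int[vol]_(p in O) (tangent_norm g p (X p) ^+ 2)%:E)%E.
Proof.
move=> [_ _ Ooo [C C0 HC]]; exists ((4 * C + 1)^-1); first by rewrite invr_gt0; lra.
move=> f X [mf mX [u [su cu]]] f0; rewrite invrK.
have mO : measurable (O : set BM) by exact: open_borel.
have tnE v p : O p -> tangent_norm g p v ^+ 2 = tangent_norm2 g p v.
  by move=> Op; rewrite sqr_sqrtr// (tangent_norm2_ge0 gR).
have EE : (\int[vol]_(p in O) (tangent_norm g p (X p) ^+ 2)%:E =
    \int[vol]_(p in O) (tangent_norm2 g p (X p))%:E)%E.
  by apply: eq_integral => p /set_mem Op; rewrite tnE.
rewrite EE; set E := (\int[vol]_(p in O) (tangent_norm2 g p (X p))%:E)%E.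
have E0 : (0 <= E)%E by apply: integral_ge0 => p Op; rewrite lee_fin (tangent_norm2_ge0 gR).
apply: (@le_trans _ _ ((4 * C)%:E * E)%E); last first.
  by apply: lee_wpmul2r => //; rewrite lee_fin lerDl.
apply/lee_addgt0Pr => e e0.
pose K := 2 + 4 * C.
have K0 : 0 < K by rewrite /K; lra.
(* The error made by u_j is at most K d^2 = e. *)
pose d := Num.sqrt (e / K).
have d0 : 0 < d by rewrite sqrtr_gt0 divr_gt0.
have dE : d ^+ 2 = e / K by rewrite sqr_sqrtr// ltW// divr_gt0.
pose h j p := f p - u j p; pose Y j p := X p - gradient S g (u j) p.
have [j Hj] : exists j, (H1norm O g vol (h j) (Y j) < d%:E)%E.
  have n0 : nbhs 0%E [set y : \bar R | (y < d%:E)%E].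
    by apply: open_nbhs_nbhs; split; [exact: open_ereal_lt_ereal|rewrite /= lte_fin].
  by have [N _ HN] := cu _ n0; exists N; apply: HN; exact: leqnn.
have mdX : measurable_field S O (fun p => X p - gradient S g (u j) p).
  by apply: measurable_fieldB => //; exact: (gradient_measurable_field oO gR).
have mtX := measurable_tangent_norm2 oO gR cM mX.
have mtd := measurable_tangent_norm2 oO gR cM mdX.
have mu A : measurable_fun (A : set BM) (u j) by exact: measurable_smooth_fun.
have Hf : (\int[vol]_(p in O) ((f p - u j p) ^+ 2)%:E <= (d ^+ 2)%:E)%E.
  apply: poweR_half_lt => //; first by apply: integral_ge0 => p _; rewrite lee_fin sqr_ge0.
  apply: le_lt_trans Hj; rewrite /H1norm /L2norm.
  rewrite (eq_integral (fun p : BM => (`|h j p| ^+ 2)%:E)) ?leeDr ?poweR_ge0//.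
  by move=> p _; rewrite real_normK ?num_real.
have HX : (\int[vol]_(p in O) (tangent_norm2 g p (X p - gradient S g (u j) p))%:E <= (d ^+ 2)%:E)%E.
  apply: poweR_half_lt => //; first by apply: integral_ge0 => p Op; rewrite lee_fin (tangent_norm2_ge0 gR).
  apply: le_lt_trans Hj; rewrite /H1norm /L2norm.
  rewrite (eq_integral (fun p : BM => (`|tangent_norm g p (Y j p)| ^+ 2)%:E)) ?leeDl ?poweR_ge0//.
  by move=> p /set_mem Op; rewrite real_normK ?num_real// tnE.
have [c Hc] := HC _ (su j).
apply: (le_trans (mean_zero_min mO c mf Ooo f0)).
have le1 : (\int[vol]_(p in O) ((f p - c) ^+ 2)%:E <=
    2%:E * \int[vol]_(p in O) ((f p - u j p) ^+ 2)%:E +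
    2%:E * \int[vol]_(p in O) ((u j p - c) ^+ 2)%:E)%E.
  apply: integral_le_lin2 => //; try by move=> p _; exact: sqr_ge0.
  - by apply: measurable_funX; apply: measurable_funB.
  - by apply: measurable_funX; apply: measurable_funB.
  - by apply: measurable_funX; apply: measurable_funB.
  move=> p _ /=; rewrite -subr_ge0 (_ : _ - _ = (f p - 2 * u j p + c) ^+ 2) ?sqr_ge0//; ring.
have le2 : (energy S O g vol (u j) <= 2%:E * E + 2%:E * (d ^+ 2)%:E)%E.
  apply: (@le_trans _ _ (2%:E * E + 2%:E * \int[vol]_(p in O) (tangent_norm2 g p (X p - gradient S g (u j) p))%:E)%E).
    apply: integral_le_lin2 => //.
    - exact: (measurable_energy oO gR cM (su j)).
    - by move=> p Op; exact: (tangent_norm2_ge0 gR).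
    - by move=> p Op; exact: (tangent_norm2_ge0 gR).
    - by move=> p Op; exact: (tangent_norm2_ge0 gR).
    by move=> p Op; exact: tangent_norm2_le.
  by apply: leeD => //; apply: lee_wpmul2l.
apply: (le_trans le1).
apply: (@le_trans _ _ (2%:E * (d ^+ 2)%:E + 2%:E * (C%:E * (2%:E * E + 2%:E * (d ^+ 2)%:E)))%E).
  apply: leeD; apply: lee_wpmul2l => //.
  by apply: (le_trans Hc); apply: lee_wpmul2l.
have d20 : 0 <= d ^+ 2 by exact: sqr_ge0.
rewrite ge0_muleDr ?mule_ge0 ?lee_fin// ge0_muleDr ?mule_ge0 ?lee_fin// !muleA -!EFinM addeCA -EFinD.
rewrite (_ : (2 * C * 2 = 4 * C)%R); last by ring.
rewrite (_ : (2 * d ^+ 2 + 4 * C * d ^+ 2 = K * d ^+ 2)%R); last by rewrite /K; ring.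
by rewrite dE mulrCA mulfV ?mulr1// gt_eqF.
Qed.

End closure.

(** * The punctured manifold *)

Lemma qform_scalar (R : realType) n (l : R) (v : 'rV[R]_n) : qform l%:M v = l * sqnorm v.
Proof. by rewrite /qform mul_mx_scalar -scalemxAl mxE sqnormE. Qed.

Section punctured_manifold.
Context {R : realType} {k : nat} {M : ptopologicalType}.
Local Notation n := k.+2.
Variables (S : smooth_manifold R n M) (N : nat) (pt : 'I_N -> M).
Local Notation O := (punctured pt).

Lemma open_punctured : open O.
Proof.
rewrite openE => p Op; rewrite /interior.
apply: filter_forall => i.
have oi : open [set q | q != pt i].
  rewrite (_ : [set q | q != pt i] = ~` [set pt i]); last first.
    by apply/seteqP; split=> q /eqP.
  apply: closed_openC; apply: accessible_closed_set1; apply: hausdorff_accessible.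
  exact: manifold_hausdorff S.
by apply: (open_nbhs_nbhs (conj oi _)); exact: Op.
Qed.

(** Pigeonhole principle: a coordinate neighbourhood contains N + 1 different
    points, which the N punctures cannot exhaust. *)
Lemma dense_punctured (U : set M) : open U -> U !=set0 -> (U `&` O) !=set0.
Proof.
move=> oU [p Up]; apply: contrapT => UO.
have [Sc cp] := chart_atP S p; set c := chart_at S p in Sc cp.
have : nbhs (chart_map c p) (chart_map c @` (chart_dom c `&` U)).
  by apply: open_nbhs_nbhs; split; [exact: open_chart_image|exists p].
move=> /nbhs_box[e e0 [BU _]].
(* N + 1 points on the diagonal of a small box. *)
pose t (j : 'I_N.+1) : R := e / j.+1%:R.
have t_bnd j : 0 <= t j <= e.
  apply/andP; split; first by rewrite divr_ge0 ?ler0n// ltW.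
  by rewrite ler_pdivrMr ?ltr0n// ler_peMr ?ler1n// ltW.
pose y j : 'rV[R]_n := chart_map c p + const_mx (t j).
have yU j : (chart_map c @` (chart_dom c `&` U)) (y j).
  by apply: BU => i; rewrite !mxE; have := t_bnd j; move: e0; lra.
have y_inj : injective y.
  move=> j j' /addrI /rowP /(_ ord0); rewrite !mxE /t => /(mulfI (lt0r_neq0 e0)) /invr_inj /eqP.
  by rewrite eqr_nat eqSS => /eqP /val_inj.
have hit j : exists i, chart_inv c (y j) = pt i.
  apply: contrapT => H; apply: UO; have [q [cq Uq] qy] := yU j.
  exists q; split=> // i; apply/eqP => qi; apply: H; exists i.
  by rewrite -qy chart_mapK.
pose F j : 'I_N := sval (cid (hit j)).
have FE j : chart_inv c (y j) = pt (F j) by rewrite /F; case: cid.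
have : injective F.
  move=> j j' jj'; apply: y_inj.
  have := FE j; rewrite jj' -FE.
  have [q [cq _] <-] := yU j; have [q' [cq' _] <-] := yU j'.
  by rewrite !chart_mapK// => ->.
by move=> /leq_card; rewrite !card_ord ltnn.
Qed.

Variables (omega : M -> 'M[R]_n) (dV : {measure set (borel (M := M)) -> \bar R}).
Hypotheses (cM : compact [set: M]) (omegaP : poincare_like_metric S pt omega)
  (dVE : volume_element S O omega dV).
Local Notation good := (good S O omega dV).

(** Quasi-isometry bounds the form of the metric, in the coordinates of the cusp,
    by multiples of P^-2 times the Euclidean one. *)
Lemma good_puncture i : exists2 W, good W & W (pt i).
Proof.
have [gR _ [ds [dsR [phi [phiP phiD phiG]]] [c c1 Hc]]] := omegaP.
have [Sa ap a0 imga] := phiP i; set a := phi i in Sa ap a0 imga.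
have aO p : chart_dom a p -> (O p <-> p <> pt i).
  move=> dp; split=> [/(_ i)/eqP//|pi j]; apply/eqP => pj.
  have [ij|ij] := eqVneq i j; first by apply: pi; rewrite pj ij.
  have [_ ajp _ _] := phiP j.
  suff : set0 (pt j) by [].
  by rewrite -(phiD i j ij); split=> //; rewrite -pj.
have bound p v : chart_dom a p -> O p ->
    c^-1 * ((cusp_scale (sqnorm (chart_map a p)) ^+ 2)^-1 * sqnorm v) <=
    qform (gram S omega a p) v <=
    c * ((cusp_scale (sqnorm (chart_map a p)) ^+ 2)^-1 * sqnorm v).
  move=> dp Op.
  have := Hc p Op (v *m change_frame a (chart_at S p) p).
  rewrite /tangent_norm2 -/(qform _ _) -/(qform _ _) -!qform_gram.
  have /eqP pi := (aO p dp).1 Op.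
  by rewrite (phiG i p dp pi) qform_scalar enormE exprMn.
have [s s0 Hs] := poincare_cusp open_punctured gR dVE cM Sa a0 imga aO c1 bound.
exists (chart_pull a (interior (cbox n s))); last first.
  split=> //; rewrite /preimage/= a0.
  apply/nbhs_ballP; exists s => //= y [_ H]; apply/cboxP => j.
  by have := H 0 j; rewrite /ball/= mxE sub0r normrN => /ltW.
apply: (good_chart_pull open_punctured Hs) => p [[dp Bp] Op]; split=> //; split=> // p0.
by apply: ((aO p dp).1 Op); rewrite -(chart_mapK dp) p0 -a0 chart_mapK.
Qed.

Lemma good_everywhere p : exists2 W, good W & W p.
Proof.
have [gR _ _] := omegaP.
have [Op|] := pselect (O p); first exact: (good_interior open_punctured gR dVE cM).
move=> nOp; have [i ->] : exists i, p = pt i.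
  apply: contrapT => H; apply: nOp => i; apply/eqP => pi; apply: H; by exists i.
exact: good_puncture.
Qed.

End punctured_manifold.

Theorem theorem5p1 (R : realType) (n : nat) (M : ptopologicalType)
  (S : smooth_manifold R n M) (k : nat) (pt : 'I_k -> M)
  (omega : M -> 'M[R]_n)
  (dV : {measure set (borel (M := M)) -> \bar R}) :
  (2 <= n)%N ->
  compact [set: M] -> connected [set: M] ->
  injective pt ->
  poincare_like_metric S pt omega ->
  volume_element S (punctured pt) omega dV ->
  exists2 lambda1 : R, 0 < lambda1 &
    forall (f : M -> R) (grad_f : M -> 'rV[R]_n),
      H1 S (punctured pt) omega dV f grad_f ->
      (\int[dV]_(p in punctured pt) (f p)%:E = 0)%E ->
      (\int[dV]_(p in punctured pt) (f p ^+ 2)%:E <=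
       lambda1^-1%:E *
       \int[dV]_(p in punctured pt)
         (tangent_norm omega p (grad_f p) ^+ 2)%:E)%E.
Proof.
case: n S omega => [|[|n]] // S omega _ cM connM _ omegaP dVE.
have [gR _ _] := omegaP.
have oO := open_punctured S pt.
apply: (poincare_H1 oO gR cM); apply: (poincare_global oO gR dVE cM connM) => [U|p].
  exact: (dense_punctured S).
exact: good_everywhere.
Qed.
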